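(* Consider the probing simple random walk (PSRW) $\{K_t\}$ on growing domains $\{\mathbb{D}_t\}$ in $\mathbb{Z}^d$ (as defined in the context), with $m(t)$ probes sent at time $t$ and running average $\overline{m}_t:=t^{-1}\sum_{s=1}^t m(s)$. (a) For $\mathbb{Z}^d$, $d\ge2$, and any $\epsilon>0$, there exist $\mathcal{F}_t$-adapted $\{m(t)\}$ and choices of the $m(t)$ probe positions at $\mathbb{Z}^d$-distance one from $\mathbb{D}_t$, such that a.s. eventually (for all large $t$) $\overline{m}_t<\epsilon$ and the sample path of $\{K_t\}$ is a.s. transient. There also exist (some other) such probe numbers and locations for which eventually $\overline{m}_t>\epsilon^{-1}$ and the sample path of $\{K_t\}$ is a.s. recurrent. (b) Suppose each probed site is chosen according to the hitting measure of $\mathbb{D}_t^c$ by a simple random walk on $\mathbb{Z}^d$ which starts at the current position $K_t$ of the PSRW. Then: for each $d\ge3$ there exist a finite constant $c_d$ and an $\mathcal{F}_t$-adapted process $\{m(t)\}$ such that a.s. $\limsup_{t\to\infty}\overline{m}_t<c_d$ and the PSRW sample path is a.s. transient; and for $d=2$ there exist $\mathcal{F}_t$-adapted processes $\{m(t)\}$ with $\liminf_{t\to\infty}\overline{m}_t$ arbitrarily large (i.e. for every $M<\infty$ one with a.s. $\liminf_{t\to\infty}\overline{m}_t\ge M$) and a finite constant $c$ (possibly depending on $M$) with a.s. $\limsup_{t\to\infty}\overline{m}_t<c$, for which the PSRW sample path is a.s. recurrent.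
   Context: Probing simple random walk (PSRW): the walk $\{K_t\}_{t\ge0}$ starts at $K_0=0$ with domain $\mathbb{D}_0=\{0\}\subset\mathbb{Z}^d$, $d\ge2$. At each time $t$ the walk may send some $\mathcal{F}_t$-adapted number $m(t)\ge0$ of probes. Each probe adds precisely one site of $\mathbb{Z}^d$ to the domain (and opens all relevant edges of $\mathbb{Z}^d$ connecting this site with the existing graph). The domain after all $m(t)$ probes sent at time $t$ is $\mathbb{D}_{t+1}$; all this happens prior to the walk's move from $K_t$ to $K_{t+1}\in\mathbb{D}_{t+1}$, which is chosen uniformly among the neighbors of $K_t$ in $\mathbb{D}_{t+1}$. The probes of a given time are sent one after another: the condition on the position of a probe (being at $\mathbb{Z}^d$-distance one from $\mathbb{D}_t$ in (a), or being distributed according to the hitting measure of $\mathbb{D}_t^c$ in (b)) refers to the current domain, including the sites added by the probes already sent at that time; and the decision how many probes to send may depend on all that has been observed so far, including the sites added by the probes already sent. The sample path is recurrent if $K_t=0$ for infinitely many $t$, and transient otherwise. *)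

(* Defs.v *)
From HB Require Import structures.
From mathcomp Require Import all_boot all_order all_algebra.
From mathcomp Require Import all_classical all_reals all_analysis.
From mathcomp Require Import measurable_realfun.

Set Implicit Arguments.
Unset Strict Implicit.
Unset Printing Implicit Defensive.

Import Order.TTheory GRing.Theory Num.Theory.
Import numFieldNormedType.Exports.

Local Open Scope classical_set_scope.
Local Open Scope ring_scope.

Notation site d := ('rV[int]_d).

(* The pair (i, b) stands for the direction (-1)^b e_i. *)
Definition direction (d : nat) : finType := ('I_d * bool)%type.

Definition unit_step (d : nat) (e : direction d) : site d :=
  (-1) ^+ e.2 *: delta_mx 0 e.1.

Definition dist1 (d : nat) (x y : site d) : nat :=
  (\sum_(i < d) `|x 0%R i - y 0%R i|)%N.

(* dist(y, D) = 1, where dist(y, D) is the minimum of dist1 x y for x in D. *)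
Definition at_distance_one (d : nat) (D : seq (site d)) (y : site d) : Prop :=
  (exists2 x, x \in D & dist1 x y = 1%N) /\
  (forall x, x \in D -> (1 <= dist1 x y)%N).

(* A history lists, for successive times s, the position K_s of the walk
   together with the sites probed at time s, in the order of probing. *)
Notation history d := (seq (site d * seq (site d))).

Definition domain (d : nat) (h : history d) : seq (site d) :=
  0 :: flatten [seq o.2 | o <- h].

Definition past (d : nat) (T : Type) (K : nat -> T -> site d)
    (Q : nat -> T -> seq (site d)) (t : nat) (w : T) : history d :=
  mkseq (fun s => (K s w, Q s w)) t.

(* What has been observed at time t once the first i probes of that time have
   been sent (all of them, if they are fewer than i): [domain] of it is D_t for
   i = 0, while D_(t+1) is [domain (past K Q t.+1 w)]. *)
Definition observed (d : nat) (T : Type) (K : nat -> T -> site d)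
    (Q : nat -> T -> seq (site d)) (t i : nat) (w : T) : history d :=
  rcons (past K Q t w) (K t w, take i (Q t w)).

(* The sigma-algebra generated by a map with values in a countable set. *)
Definition sigma_of (T H : Type) (f : T -> H) : set (set T) :=
  <<s range (fun h : H => f @^-1` [set h]) >>.

(* g is a version of the conditional probability P(E | F). *)
Definition is_cond_prob (R : realType) (disp : measure_display)
    (T : measurableType disp) (P : probability T R)
    (F : set (set T)) (E : set T) (g : T -> \bar R) : Prop :=
  (forall B : set (\bar R), measurable B -> F (g @^-1` B)) /\
  (forall A : set T, F A -> P (A `&` E) = (\int[P]_(w in A) g w)%E).

(* The walk moves in the subgraph of Z^d induced by D. *)
Definition uniform_neighbor (R : realType) (d : nat) (D : seq (site d))
    (x y : site d) : R :=
  if (y \in D) && [exists e : direction d, y == x + unit_step e]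
  then (#|[pred e : direction d | x + unit_step e \in D]|)%:R^-1
  else 0.

Definition srw_path (d n : nat) (x : site d) (s : n.-tuple (direction d))
    (k : nat) : site d :=
  x + \sum_(e <- take k s) unit_step e.

(* The probability that a simple random walk on Z^d started at x first leaves D
   at step n, and does so at y: the proportion of such paths among the
   (2 d)^n equally likely ones of length n. *)
Definition srw_exit_at (R : realType) (d : nat) (D : seq (site d))
    (x y : site d) (n : nat) : R :=
  (#|[pred s : n.-tuple (direction d) |
       [forall k : 'I_n, srw_path x s k \in D]
       && (srw_path x s n \notin D) && (srw_path x s n == y)]|)%:R
  / (2 * d)%:R ^+ n.

(* The hitting measure of the complement of D from x, evaluated at {y}. *)
Definition hitting_measure (R : realType) (d : nat) (D : seq (site d))
    (x y : site d) : \bar R :=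
  (\sum_(0 <= n <oo) (srw_exit_at R D x y n)%:E)%E.

(* Q t w is the sequence of the sites probed at time t, so m(t) = size (Q t w).
   The last but one clause says that the number of probes is a stopping time of
   the observations made along the successive probes of time t.
   In the last clause, the total mass of [uniform_neighbor] is 0 when K_t has no
   neighbor in D_(t+1); hence this almost surely does not happen, and m(0) > 0
   almost surely. *)
Definition is_psrw (R : realType) (disp : measure_display)
    (T : measurableType disp) (P : probability T R) (d : nat)
    (K : nat -> T -> site d) (Q : nat -> T -> seq (site d)) : Prop :=
  [/\ forall t x, measurable [set w | K t w = x],
      forall t q, measurable [set w | Q t w = q],
      forall w, K 0%N w = 0,
      forall t i, sigma_of (observed K Q t i) [set w | (size (Q t w) <= i)%N]
    & forall t y,
        is_cond_prob P (sigma_of (past K Q t.+1)) [set w | K t.+1 w = y]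
          (fun w => (uniform_neighbor R (domain (past K Q t.+1 w))
                       (K t w) y)%:E)].

Definition probes_chosen_at_distance_one (d : nat) (T : Type)
    (K : nat -> T -> site d) (Q : nat -> T -> seq (site d)) : Prop :=
  (forall t i x,
     sigma_of (observed K Q t i) [set w | onth (Q t w) i = Some x]) /\
  (forall t i x w, onth (Q t w) i = Some x ->
     at_distance_one (domain (observed K Q t i w)) x).

Definition probes_by_hitting_measure (R : realType) (disp : measure_display)
    (T : measurableType disp) (P : probability T R) (d : nat)
    (K : nat -> T -> site d) (Q : nat -> T -> seq (site d)) : Prop :=
  forall t i x,
    is_cond_prob P (sigma_of (observed K Q t i))
      [set w | onth (Q t w) i = Some x]
      (fun w => if (i < size (Q t w))%N
                then hitting_measure R (domain (observed K Q t i w)) (K t w) x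
                else 0%E).

Definition mean_probes (R : realType) (d : nat) (T : Type)
    (Q : nat -> T -> seq (site d)) (w : T) (t : nat) : R :=
  t%:R^-1 * \sum_(1 <= s < t.+1) (size (Q s w))%:R.

Definition recurrent (d : nat) (T : Type) (K : nat -> T -> site d) (w : T) :
    Prop :=
  forall n : nat, exists2 t, (n <= t)%N & K t w = 0.

Definition transient (d : nat) (T : Type) (K : nat -> T -> site d) (w : T) :
    Prop :=
  ~ recurrent K w.

(* Main.v *)
Require Import Defs.
From HB Require Import structures.
From mathcomp Require Import all_boot all_order all_algebra.
From mathcomp Require Import all_classical all_reals all_analysis.
From mathcomp Require Import measurable_realfun.
From mathcomp Require Import zify ring lra.

Set Implicit Arguments.
Unset Strict Implicit.
Unset Printing Implicit Defensive.

Import Order.TTheory GRing.Theory Num.Theory.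
Import numFieldNormedType.Exports.

Local Open Scope classical_set_scope.
Local Open Scope ring_scope.

(** All processes come from one construction: a Markov chain on histories that makes one step per
    probe and one step per move. A state contains its whole past, so it has a single possible
    predecessor ([undo]) and can occur at a single step ([nsteps]). Conditioning on what has been
    observed is therefore conditioning on the state of the chain at a fixed step, which yields
    [psrw_of_chain], [hitting_of_chain] and [at_distance_one_of_chain]. Almost sure statements come
    from Lyapunov functions: if V >= 0 and the mean of V after a step plus the indicator of B is at
    most V, then the expected number of visits to B is at most V at the start ([lyapunov_sum]).

    For (b) the greedy strategy probes until all 2 d neighbours of the walk are in the domain and at
    least M probes have been sent. The walk is then simple random walk on Z^d. For d >= 3 a bounded
    superharmonic function, strictly so at the origin, gives transience ([greedy_transient]). For d
    = 2 a function close to log |x| gives recurrence ([greedy_recurrent], from the criterion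
    [recurrent_of_chain]). A missing neighbour is hit with probability at least 1 / (2 d), so an
    exponential supermartingale bounds the running average ([greedy_limsup]).

    For (a), recurrent case, a half-line is prolonged by M sites at each time
    ([half_line_recurrent]). The walk never catches up with the far end and is a reflected walk on
    the half-line.

    For (a), transient case, the domain grows in stages. At the start of stage k a comb with 2 ^ k
    teeth of length 4 ^ k is attached at the current position, to the right of everything built
    before. The stage ends when the walk is at the tip of a tooth at some time not before C 8 ^ (k +
    1). The origin is rarely visited during a stage, for three reasons. The teeth, in parallel,
    conduct much better than the long way back, so a tip is reached before the origin except with
    probability of order 2 ^ (-k) ([escape_super], [esc_base]). While the walk waits, it strays from
    that tip by about the square root of the time, which is small compared with 4 ^ k
    ([lap_gap_sqr], [delay_tooth]). After the waiting time, the relative distance already covered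
    bounds the probability of reaching the origin before returning to that tip. These costs are of
    order (3/4) ^ k, hence summable, and [risk_step] assembles them in one Lyapunov function that
    counts the stages in which the origin is visited. Every stage ends because its domain is finite
    ([stage_step]), so only finitely many visits remain ([path_transient]). A comb has about 8 ^ k
    sites and comes after time C 8 ^ k, so the running average is at most 4 / C ([path_mean]). *)

Definition uniform01 (R : realType) : probability (measurableTypeR R) R :=
  uniform_prob (@ltr01 R).

(** * Sampling a finitely branching Markov chain from one uniform variable *)

Section Locate.
Context (R : realType) (S : eqType) (s0 : S).
Implicit Types (l : seq (S * R)) (a w : R) (s : S).

Definition mass l : R := \sum_(x <- l) x.2.

Definition nonneg_weights l := all (fun x => 0 <= x.2) l.

(* The half-open intervals of lengths given by the weights of l are laid end to
   end from a on. *)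
Fixpoint locate a l w : S :=
  if l is x :: l' then
    if w < a + x.2 then x.1 else locate (a + x.2) l' w
  else s0.

Lemma mass_cons x l : mass (x :: l) = x.2 + mass l.
Proof. by rewrite /mass big_cons. Qed.

Lemma mass_ge0 l : nonneg_weights l -> 0 <= mass l.
Proof. by move=> /allP l0; rewrite /mass big_seq sumr_ge0. Qed.

Lemma locate_cat a l1 l2 w : nonneg_weights l1 -> a <= w ->
  locate a (l1 ++ l2) w =
  if w < a + mass l1 then locate a l1 w else locate (a + mass l1) l2 w.
Proof.
elim: l1 a => [|x l1 IH] a /=.
  by move=> _ aw; rewrite /mass big_nil addr0 ltNge aw.
move=> /andP[x0 l0] aw; rewrite mass_cons addrA.
case: ifPn => [wx|]; last by rewrite -leNgt => xw; rewrite IH.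
by rewrite (lt_le_trans wx)// lerDl mass_ge0.
Qed.

Lemma locate_mem a l w : a <= w < a + mass l -> locate a l w \in map fst l.
Proof.
elim: l a => [|x l IH] a /=.
  by rewrite /mass big_nil addr0 => /andP[/le_lt_trans h /h]; rewrite ltxx.
move=> /andP[aw]; rewrite mass_cons addrA => wl.
case: ifPn => [wx|]; first by rewrite in_cons eqxx.
by rewrite -leNgt => xw; rewrite in_cons IH ?orbT// xw.
Qed.

(** Each interval is cut in proportion to the weights of [next], so a fixed point w meets at the
    finer level a successor of the state that it meets at the coarser one. *)
Lemma locate_refine (next : S -> seq (S * R)) a l w :
  nonneg_weights l ->
  (forall s, s \in map fst l -> nonneg_weights (next s)) ->
  (forall s, s \in map fst l -> mass (next s) = 1) ->
  a <= w < a + mass l ->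
  locate a (flatten [seq [seq (y.1, x.2 * y.2) | y <- next x.1] | x <- l]) w
    \in map fst (next (locate a l w)).
Proof.
elim: l a => [|x l IH] a /=.
  by rewrite /mass big_nil addr0 => _ _ _ /andP[/le_lt_trans h /h]; rewrite ltxx.
move=> /andP[x0 l0] ln ln1 /andP[aw]; rewrite mass_cons addrA => wl.
have xl : x.1 \in map fst (x :: l) by rewrite in_cons eqxx.
have mx : mass [seq (y.1, x.2 * y.2) | y <- next x.1] = x.2.
  by rewrite /mass big_map/= -mulr_sumr -/(mass _) ln1 ?mulr1.
rewrite locate_cat ?mx//; last first.
  by rewrite /nonneg_weights all_map; apply: sub_all (ln _ xl) => y /= y0; rewrite mulr_ge0.
case: ifPn => [wx|].
  have -> : map fst (next x.1) = map fst [seq (y.1, x.2 * y.2) | y <- next x.1].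
    by rewrite -map_comp.
  by apply: locate_mem; rewrite mx aw.
rewrite -leNgt => xw; apply: IH => //.
- by move=> s sl; apply: ln; rewrite in_cons sl orbT.
- by move=> s sl; apply: ln1; rewrite in_cons sl orbT.
- by rewrite xw.
Qed.

Lemma uniform01_itvco (a b : R) : 0 <= a -> a <= b -> b <= 1 ->
  uniform01 R (`[a, b[%classic : set R) = (b - a)%:E.
Proof.
move=> a0 ab b1; rewrite /uniform01/= /uniform_prob integral_uniform_pdf.
have -> : `[a, b[%classic `&` `[0, 1]%classic = `[a, b[%classic.
  rewrite setIidl// => x /=; rewrite !in_itv/= => /andP[ax xb].
  by rewrite (le_trans a0 ax) (le_trans (ltW xb) b1).
rewrite (eq_integral (cst 1%E)).
  rewrite integral_cst//= mul1e lebesgue_measure_itv/= lte_fin.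
  by move: ab; rewrite le_eqVlt => /predU1P[->|->]//; rewrite ltxx subrr.
move=> x; rewrite inE/= in_itv/= => /andP[ax xb].
rewrite /uniform_pdf (le_trans a0 ax) (le_trans (ltW xb) b1)/=.
by rewrite subr0 invr1.
Qed.

Lemma locate_law (A : S -> Prop) a l : nonneg_weights l ->
  0 <= a -> a + mass l <= 1 ->
  measurable [set w : R | a <= w < a + mass l /\ A (locate a l w)] /\
  uniform01 R [set w : R | a <= w < a + mass l /\ A (locate a l w)]
    = (\sum_(x <- l) x.2 * (`[< A x.1 >])%:R)%:E.
Proof.
elim: l a => [|x l IH] a /=.
  move=> _ _ _; have -> : [set w : R | a <= w < a + mass [::] /\ A s0] = set0.
    apply/seteqP; split => w //= [+ _].
    by rewrite /mass big_nil addr0 => /andP[/le_lt_trans h /h]; rewrite ltxx.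
  by rewrite measure0 big_nil; split.
move=> /andP[x0 l0] a0; rewrite mass_cons addrA => l1.
have [mE PE] := IH (a + x.2) l0 (addr_ge0 a0 x0) l1.
have ax1 : a + x.2 <= 1 by rewrite (le_trans _ l1)// lerDl mass_ge0.
pose I : set R := if `[< A x.1 >] then `[a, (a + x.2)[%classic else set0.
have -> : [set w : R | a <= w < a + x.2 + mass l /\
             A (if w < a + x.2 then x.1 else locate (a + x.2) l w)] =
    I `|` [set w | a + x.2 <= w < a + x.2 + mass l /\ A (locate (a + x.2) l w)].
  apply/seteqP; split => w /=.
    move=> [/andP[aw wl]]; case: ifPn => [wx Ax|wx Aw].
      by left; rewrite /I asboolT//= in_itv/= aw wx.
    by right; rewrite leNgt wx wl.
  move=> [|[/andP[xw wl] Aw]].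
    rewrite /I; case: asboolP => //= Ax; rewrite in_itv/= => /andP[aw wx].
    rewrite aw (lt_le_trans wx) ?wx//.
    by rewrite lerDl mass_ge0.
  rewrite wl (le_trans _ xw) ?lerDl//; split => //.
  by case: ifPn => // /lt_geF; rewrite xw.
have mI : measurable I by rewrite /I; case: ifP.
split; first exact: measurableU.
rewrite measureU//.
  rewrite big_cons EFinD; congr (_ + _)%E; rewrite /I.
  have [Ax|Ax] := pselect (A x.1); rewrite ?(asboolT Ax) ?(asboolF Ax).
    etransitivity; first by apply: uniform01_itvco; rewrite ?lerDl.
    by congr (_%:E); rewrite addrAC subrr add0r mulr1.
  by rewrite measure0 mulr0.
  exact: PE.
apply/seteqP; split => w //= [Iw [/andP[xw _] _]]; move: Iw.
rewrite /I; case: ifP => //= _; rewrite in_itv/= => /andP[_].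
by rewrite ltNge xw.
Qed.

End Locate.

Section Chain.
Context (R : realType) (S : countType).
Variables (next : S -> seq (S * R)) (s0 : S).

(** One entry per trajectory of n steps, so states may recur. The successors of an entry take its
    place in the list: the intervals of step n + 1 subdivide those of step n. *)
Fixpoint law n : seq (S * R) :=
  if n is n'.+1 then
    flatten [seq [seq (y.1, x.2 * y.2) | y <- next x.1] | x <- law n']
  else [:: (s0, 1)].

Definition mean n (F : S -> R) : R := \sum_(x <- law n) x.2 * F x.1.

Definition average (F : S -> R) s : R := \sum_(y <- next s) y.2 * F y.1.

Definition stochastic_on (inv : S -> Prop) :=
  forall s, inv s -> [/\ nonneg_weights (next s), mass (next s) = 1 &
    forall s', s' \in map fst (next s) -> inv s'].

(** Only the law at each single step is recorded. This loses nothing for the chains of histories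
    below, whose states contain their whole past. *)
Definition chain_law (d : measure_display) (T : measurableType d)
    (P : probability T R) (X : nat -> T -> S) :=
  forall n (A : S -> Prop), measurable [set w | A (X n w)] /\
    P [set w | A (X n w)] = (mean n (fun s => (`[< A s >])%:R))%:E.

Definition chain_path (x : nat -> S) :=
  x 0%N = s0 /\ forall n, x n.+1 \in map fst (next (x n)).

Lemma meanS n F : mean n.+1 F = mean n (average F).
Proof.
rewrite /mean/= big_flatten/= big_map; apply: eq_bigr => x _.
rewrite big_map/= /average mulr_sumr; apply: eq_bigr => y _.
by rewrite mulrA.
Qed.

Variable inv : S -> Prop.
Hypothesis inv0 : inv s0.
Hypothesis next_inv : stochastic_on inv.

Lemma law_inv n s : s \in map fst (law n) -> inv s.
Proof.
elim: n s => [s|n IH s] /=; first by rewrite inE => /eqP ->.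
move=> /mapP[x /flatten_mapP[y yn /mapP[z zy ->]] ->] /=.
have /next_inv[_ _] : inv y.1 by apply: IH; exact: map_f.
by apply; exact: map_f.
Qed.

Lemma law_weights n : nonneg_weights (law n).
Proof.
elim: n => [|n IH]; first by rewrite /nonneg_weights/= ler01.
apply/allP => x /flatten_mapP[y yn /mapP[z zy ->]] /=.
have /next_inv[/allP nn _ _] : inv y.1 by apply: (@law_inv n); exact: map_f.
by apply: mulr_ge0; [exact: (allP IH y yn)|exact: nn].
Qed.

Lemma eq_mean n F G : (forall s, inv s -> F s = G s) -> mean n F = mean n G.
Proof.
move=> FG; rewrite /mean big_seq [RHS]big_seq; apply: eq_bigr => x xn.
by rewrite FG//; apply: (@law_inv n); exact: map_f.
Qed.

Lemma le_mean n F G : (forall s, inv s -> F s <= G s) -> mean n F <= mean n G.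
Proof.
move=> FG; rewrite /mean big_seq [leRHS]big_seq; apply: ler_sum => x xn.
rewrite ler_wpM2l// ?FG//; first exact: (allP (law_weights n) x xn).
by apply: (@law_inv n); exact: map_f.
Qed.

Lemma mean_cst n (c : R) : mean n (fun=> c) = c.
Proof.
elim: n => [|n IH]; first by rewrite /mean big_seq1 mul1r.
rewrite meanS -{2}IH; apply: eq_mean => s /next_inv[_ s1 _].
by rewrite /average -mulr_suml -/(mass _) s1 mul1r.
Qed.

Lemma law_mass n : mass (law n) = 1.
Proof.
rewrite -(mean_cst n 1) /mean /mass.
by apply: eq_bigr => x _; rewrite mulr1.
Qed.

Lemma meanD n F G : mean n (fun s => F s + G s) = mean n F + mean n G.
Proof. by rewrite /mean -big_split; apply: eq_bigr => x _; rewrite mulrDr. Qed.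

Lemma mean_ge0 n F : (forall s, inv s -> 0 <= F s) -> 0 <= mean n F.
Proof. by move=> F0; rewrite -(mean_cst n 0); exact: le_mean. Qed.

(** The sample space is all of R and paths are to be correct for every w. The points outside [0, 1)
    form a null set and are replaced by 0. *)
Definition sample n (w : R) : S := locate s0 0 (law n) (if 0 <= w < 1 then w else 0).

Lemma sample_path w : chain_path (sample ^~ w).
Proof.
have w01 : 0 <= (if 0 <= w < 1 then w else 0) < 0 + 1.
  by case: ifPn; rewrite add0r// lexx ltr01.
split=> [|n]; first by rewrite /sample/= if_same.
apply: locate_refine.
- exact: law_weights.
- by move=> s /law_inv /next_inv[].
- by move=> s /law_inv /next_inv[].
- by rewrite law_mass.
Qed.

Lemma sample_law : chain_law (uniform01 R) sample.
Proof.
move=> n A; have l1 := law_mass n.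
have := @locate_law R S s0 A 0 (law n) (law_weights n) (lexx 0).
rewrite l1 add0r => /(_ (lexx 1))[mE PE].
set E := [set w | _ /\ _] in mE PE.
have -> : [set w | A (sample n w)] =
    E `|` (~` `[0, 1[%classic `&` [set w | A (sample n w)]).
  apply/seteqP; split => w /=; rewrite in_itv/=.
    move=> Aw; case: (boolP (0 <= w < 1)) => w01; last by right; split => //; exact/negP.
    by left; split => //; move: Aw; rewrite /sample w01.
  by move=> [[w01]|[]//]; rewrite /sample w01.
have mN : measurable (~` `[(0:R), 1[%classic `&` [set w | A (sample n w)]).
  have [A0|A0] := pselect (A (locate s0 0 (law n) 0)).
    rewrite setIidl; first exact: measurableC.
    by move=> w /=; rewrite /sample in_itv/= => /negP/negbTE ->.
  rewrite (_ : _ `&` _ = set0)//; apply/seteqP; split => w //= -[].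
  by rewrite in_itv/= /sample => /negP/negbTE ->.
have PN : uniform01 R
    (~` `[(0:R), 1[%classic `&` [set w | A (sample n w)]) = 0%E.
  have P0 : uniform01 R (~` `[(0:R), 1[%classic) = 0%E.
    rewrite probability_setC//; have -> := uniform01_itvco (lexx 0) ler01 (lexx (1:R)).
    by rewrite subr0 subee.
  have mC : measurable (~` `[(0:R), 1[%classic) by exact: measurableC.
  apply/eqP; rewrite -measure_le0 -P0; apply: le_measure; rewrite ?inE//.
split; first exact: measurableU.
rewrite measureU//.
  by rewrite -[RHS]adde0; congr (_ + _)%E; assumption.
apply/seteqP; split => w //= -[[w01 _] []].
by rewrite in_itv/= w01.
Qed.

End Chain.

(** * Lyapunov functions and numbers of visits *)

Section Lyapunov.
Context (R : realType) (S : countType).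
Variables (next : S -> seq (S * R)) (s0 : S) (inv : S -> Prop).
Hypothesis inv0 : inv s0.
Hypothesis next_inv : stochastic_on next inv.

(** Telescoping: each visit to B costs V one unit on average, and V stays nonnegative. *)
Lemma lyapunov_sum (V : S -> R) (B : S -> Prop) N :
  (forall s, inv s -> 0 <= V s) ->
  (forall s, inv s -> average next V s + (`[< B s >])%:R <= V s) ->
  \sum_(n < N) mean next s0 n (fun s => (`[< B s >])%:R) <= V s0.
Proof.
move=> V0 VB; suff: \sum_(n < N) mean next s0 n (fun s => (`[< B s >])%:R) +
    mean next s0 N V <= V s0.
  apply: le_trans; rewrite lerDl.
  exact: (@mean_ge0 _ _ next s0 inv).
elim: N => [|N IH]; first by rewrite big_ord0 add0r /mean big_seq1 mul1r.
rewrite big_ord_recr/= -addrA meanS; apply: le_trans IH.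
rewrite lerD2l -meanD; apply: (@le_mean _ _ next s0 inv) => // s si.
by rewrite addrC VB.
Qed.

Context (d : measure_display) (T : measurableType d) (P : probability T R).
Variable X : nat -> T -> S.
Hypothesis PX : chain_law next s0 P X.

Let mX n (A : S -> Prop) : measurable [set w | A (X n w)].
Proof. by case: (PX n A). Qed.

Lemma lyapunov_series (V : S -> R) (B : S -> Prop) :
  (forall s, inv s -> 0 <= V s) ->
  (forall s, inv s -> average next V s + (`[< B s >])%:R <= V s) ->
  (\sum_(0 <= n <oo) P [set w | B (X n w)] <= (V s0)%:E)%E.
Proof.
move=> V0 VB; apply: lime_le.
  by apply: is_cvg_nneseries => n _ _; exact: measure_ge0.
apply: nearW => N; rewrite big_mkord.
rewrite (eq_bigr (fun n : 'I_N => (mean next s0 n (fun s => (`[< B s >])%:R))%:E)).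
  by rewrite sumEFin lee_fin lyapunov_sum.
by move=> n _; case: (PX n B).
Qed.

Lemma lyapunov_hit (V : S -> R) (B : S -> Prop) :
  (forall s, inv s -> 0 <= V s) ->
  (forall s, inv s -> average next V s + (`[< B s >])%:R <= V s) ->
  measurable [set w | exists n, B (X n w)] /\
  (P [set w | exists n, B (X n w)] <= (V s0)%:E)%E.
Proof.
move=> V0 VB; have -> : [set w | exists n, B (X n w)] = \bigcup_n [set w | B (X n w)].
  by apply/seteqP; split => [w [n Bn]|w [n _ Bn]]; exists n.
have mU : measurable (\bigcup_n [set w | B (X n w)]) by exact: bigcup_measurable.
split=> //; apply: le_trans (lyapunov_series V0 VB).
exact: measure_sigma_subadditive.
Qed.

(** Borel-Cantelli, since the probabilities of being in B are summable. *)
Lemma lyapunov_finite (V : S -> R) (B : S -> Prop) :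
  (forall s, inv s -> 0 <= V s) ->
  (forall s, inv s -> average next V s + (`[< B s >])%:R <= V s) ->
  {ae P, forall w, exists N, forall n, (N <= n)%N -> ~ B (X n w)}.
Proof.
move=> V0 VB; exists (lim_sup_set (fun n => [set w | B (X n w)])); split.
- by apply: bigcap_measurable => // k _; exact: bigcup_measurable.
- apply: lim_sup_set_cvg0 => //.
  by apply: le_lt_trans (lyapunov_series V0 VB) _; rewrite ltry.
- move=> w /= nfin N _ /=; apply: contrapT => nB; apply: nfin.
  by exists N => n Nn Bn; apply: nB; exists n.
Qed.

End Lyapunov.

(* Redefining the chain on a null set makes an almost sure property sure. *)
Lemma chain_surely (R : realType) (S : countType) (next : S -> seq (S * R))
    (s0 : S) (G : (nat -> S) -> Prop)
    (d : measure_display) (T : measurableType d) (P : probability T R)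
    (X : nat -> T -> S) :
  chain_law next s0 P X -> (forall w, chain_path next s0 (X ^~ w)) ->
  {ae P, forall w, G (X ^~ w)} ->
  exists X' : nat -> T -> S, chain_law next s0 P X' /\
    forall w, chain_path next s0 (X' ^~ w) /\ G (X' ^~ w).
Proof.
move=> PX pX [N [mN PN GN]].
have [w0 Nw0] : exists w0, ~ N w0.
  apply: contrapT => /forallNP nN.
  have NT : N = setT by apply/seteqP; split => // w _; apply: contrapT; exact: nN.
  move: PN; rewrite NT probability_setT => -[] /eqP.
  by rewrite oner_eq0.
have GX w : ~ N w -> G (X ^~ w) by move=> Nw; apply: contrapT => /GN.
pose f w := if `[< N w >] then w0 else w.
exists (fun n w => X n (f w)); split; last first.
  move=> w; split; first exact: pX.
  by rewrite /f; case: asboolP => Nw; apply: GX.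
move=> n A; have [mA PA] := PX n A.
pose C := if `[< A (X n w0) >] then N else set0.
have mC : measurable C by rewrite /C; case: ifP.
have -> : [set w | A (X n (f w))] = ([set w | A (X n w)] `\` N) `|` C.
  apply/seteqP; split => w /=; rewrite /f /C.
    case: asboolP => Nw Aw; last by left.
    by right; rewrite asboolT.
  have [Nw|Nw] := pselect (N w); rewrite ?(asboolT Nw) ?(asboolF Nw).
    by case=> [[]|] //; case: asboolP.
  by case=> [[]|] //; case: ifP.
have mD : measurable ([set w | A (X n w)] `\` N) by exact: measurableD.
split; first exact: measurableU.
have PC : P C = 0%E by rewrite /C; case: ifP.
rewrite -PA; apply/eqP; rewrite eq_le; apply/andP; split.
  apply: le_trans (measureU2 P mD mC) _.
  by rewrite [X in (_ + X <= _)%E]PC adde0; apply: le_measure; rewrite ?inE// => w [].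
apply: (@le_trans _ _ (P (([set w | A (X n w)] `\` N) `|` N))).
  apply: le_measure; rewrite ?inE//; first exact: measurableU.
  by move=> w Aw; have [Nw|Nw] := pselect (N w); [right|left].
apply: le_trans (measureU2 P mD mN) _.
rewrite [X in (_ + X <= _)%E]PN adde0; apply: le_measure; rewrite ?inE//; exact: measurableU.
Qed.

Lemma chain_exists (R : realType) (S : countType) (next : S -> seq (S * R))
    (s0 : S) (inv : S -> Prop) (G : (nat -> S) -> Prop) :
  inv s0 -> stochastic_on next inv ->
  (forall (d : measure_display) (T : measurableType d) (P : probability T R)
     (X : nat -> T -> S), chain_law next s0 P X -> {ae P, forall w, G (X ^~ w)}) ->
  exists (d : measure_display) (T : measurableType d) (P : probability T R)
     (X : nat -> T -> S), chain_law next s0 P X /\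
     forall w, chain_path next s0 (X ^~ w) /\ G (X ^~ w).
Proof.
move=> inv0 ninv Gae.
have PX : chain_law next s0 (uniform01 R) (sample next s0).
  exact: (@sample_law _ _ _ _ inv).
have pX w : chain_path next s0 ((sample next s0) ^~ w).
  exact: (@sample_path _ _ _ _ inv).
have [X' HX'] := chain_surely PX pX (Gae _ _ _ _ PX).
by exists _, _, (uniform01 R), X'.
Qed.

(** * The chain of histories, one step per probe and per move *)

Section States.
Context (R : realType) (d : nat).

(* A history whose last entry is set apart, as further probes may be added to it. *)
Definition state : Type := (history d * (site d * seq (site d)))%type.
HB.instance Definition _ := Countable.on state.

Implicit Types (s : state) (x y : site d).

Definition hist s : history d := rcons s.1 s.2.
Definition dom s := domain (hist s).
Definition pos s := s.2.1.
Definition probe s x : state := (s.1, (s.2.1, rcons s.2.2 x)).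
Definition move s y : state := (rcons s.1 s.2, (y, [::])).
Definition start : state := ([::], (0, [::])).

(** The last step was a probe exactly when the current entry contains a site, since a move opens an
    entry without probes. At [start] the value is a mere default. *)
Definition undo s : state :=
  if s.2.2 is [::] then (take (size s.1).-1 s.1, last (0, [::]) s.1)
  else (s.1, (s.2.1, take (size s.2.2).-1 s.2.2)).

(** The only step of the chain at which s can occur ([nsteps_path]). *)
Definition nsteps s : nat := \sum_(o <- s.1) (size o.2).+1 + size s.2.2.

Definition nopen (D : seq (site d)) x := #|[pred e : direction d | x + unit_step e \in D]|.

Variables (ask : state -> bool) (aim : state -> seq (site d * R)).

Definition step s : seq (state * R) :=
  if ask s then [seq (probe s z.1, z.2) | z <- aim s]
  else [seq (move s (pos s + unit_step e), (nopen (dom s) (pos s))%:R^-1)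
       | e <- enum [pred e : direction d | pos s + unit_step e \in dom s]].

Lemma undo_probe s x : undo (probe s x) = s.
Proof.
case: s => p [k q]; rewrite /undo /probe/= size_rcons/=.
by case: q => [|y q]//=; rewrite -cats1 take_size_cat.
Qed.

Lemma undo_move s y : undo (move s y) = s.
Proof.
by case: s => p c; rewrite /undo /move/= size_rcons/= last_rcons -cats1 take_size_cat.
Qed.

Lemma probe_inj s s' x x' : probe s x = probe s' x' -> s = s' /\ x = x'.
Proof.
move=> ss'; split; first by rewrite -(undo_probe s x) ss' undo_probe.
by case: ss' => _ _ /rcons_inj[].
Qed.

Lemma move_inj s s' x x' : move s x = move s' x' -> s = s' /\ x = x'.
Proof.
move=> ss'; split; first by rewrite -(undo_move s x) ss' undo_move.
by case: ss'.
Qed.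

Lemma probe_neq_move s s' x x' : probe s x <> move s' x'.
Proof. by case=> _ _; case: s.2.2. Qed.

Lemma nsteps_probe s x : nsteps (probe s x) = (nsteps s).+1.
Proof. by rewrite /nsteps/= size_rcons addnS. Qed.

Lemma nsteps_move s x : nsteps (move s x) = (nsteps s).+1.
Proof. by rewrite /nsteps/= addn0 -cats1 big_cat/= big_seq1 addnS. Qed.

Lemma dom_probe s x : dom (probe s x) = rcons (dom s) x.
Proof.
by rewrite /dom /hist /domain/= !map_rcons !flatten_rcons/= -rcons_cat.
Qed.

Lemma dom_move s x : dom (move s x) = dom s.
Proof.
by rewrite /dom /hist /domain/= !map_rcons !flatten_rcons/= cats0.
Qed.

(** Infinitely many moves are required, because otherwise the walk would stay at one time for ever
    and send probes without end. *)
Definition psrw_path (x : nat -> state) :=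
  chain_path step start x /\ forall n, exists2 m, (n <= m)%N & ~~ ask (x m).

(** The step at which the probing of time t is over and the walk is about to move. [get] picks some
    such step; by [moment_uniq] there is only one. *)
Definition moment (x : nat -> state) t : nat :=
  get [set n | size (x n).1 = t /\ ~~ ask (x n)].

Section Path.
Variable x : nat -> state.
Hypothesis xP : psrw_path x.

Lemma step_cases n :
  (ask (x n) /\ exists2 y, y \in map fst (aim (x n)) & x n.+1 = probe (x n) y) \/
  (~~ ask (x n) /\ exists2 e, pos (x n) + unit_step e \in dom (x n) &
     x n.+1 = move (x n) (pos (x n) + unit_step e)).
Proof.
case: xP => -[_ /(_ n)] + _; rewrite /step; case: (boolP (ask (x n))) => an.
  move=> /mapP[z /mapP[y ya ->] ->]; left; split => //.
  by exists y.1 => //; exact: map_f.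
move=> /mapP[z /mapP[e]]; rewrite mem_enum inE => en -> ->; right; split => //.
by exists e.
Qed.

Lemma step_ask n : ask (x n) -> exists y, x n.+1 = probe (x n) y.
Proof.
by case: (step_cases n) => [[_ [y _ ->]]|[/negbTE ->]]// _; exists y.
Qed.

Lemma step_move n : ~~ ask (x n) -> exists y, x n.+1 = move (x n) y.
Proof.
case: (step_cases n) => [[-> //]|[_ [e _ ->]]] _.
by exists (pos (x n) + unit_step e).
Qed.

Lemma undo_path n : undo (x n.+1) = x n.
Proof.
by case: (step_cases n) => [[_ [y _ ->]]|[_ [e _ ->]]];
  rewrite ?undo_probe ?undo_move.
Qed.

Lemma nsteps_path n : nsteps (x n) = n.
Proof.
elim: n => [|n IH]; first by case: xP => -[-> _] _; rewrite /nsteps big_nil.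
by case: (step_cases n) => [[_ [y _ ->]]|[_ [e _ ->]]];
  rewrite ?nsteps_probe ?nsteps_move IH.
Qed.

Lemma time_mono m n : (m <= n)%N -> (size (x m).1 <= size (x n).1)%N.
Proof.
elim: n => [|n IH]; first by rewrite leqn0 => /eqP ->.
rewrite leq_eqVlt ltnS => /predU1P[->//|/IH /leq_trans]; apply.
by case: (step_cases n) => [[_ [y _ ->]]|[_ [e _ ->]]]//=; rewrite size_rcons.
Qed.

(** Between two moves only the list of current probes changes, by growing at its end. *)
Lemma same_time m n : (m <= n)%N -> size (x m).1 = size (x n).1 ->
  [/\ (x n).1 = (x m).1, pos (x n) = pos (x m),
      (size (x m).2.2 <= size (x n).2.2)%N &
      take (size (x m).2.2) (x n).2.2 = (x m).2.2].
Proof.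
elim: n => [|n IH]; first by rewrite leqn0 => /eqP -> _; split => //; exact: take_size.
rewrite leq_eqVlt ltnS => /predU1P[->|mn]; first by split => //; exact: take_size.
move=> tm; have tn : size (x m).1 = size (x n).1.
  by apply/eqP; rewrite eqn_leq time_mono// tm time_mono.
have [e1 e2 e3 e4] := IH mn tn.
case: (boolP (ask (x n))) => [/step_ask|/step_move] [y xn]; move: tm; rewrite xn/=; last first.
  by rewrite size_rcons -tn => /n_Sn.
move=> _; split => //; first by rewrite size_rcons (leq_trans e3).
by rewrite -cats1 takel_cat.
Qed.

Lemma next_move n : exists m, [/\ (n <= m)%N, ~~ ask (x m) & size (x m).1 = size (x n).1].
Proof.
have ex : exists k, ~~ ask (x (n + k)).
  by have [m nm am] := xP.2 n; exists (m - n)%N; rewrite subnKC.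
case: (ex_minnP ex) => k ak kmin; exists (n + k)%N; split; rewrite ?leq_addr//.
have {ak kmin} : forall j, (j < k)%N -> ask (x (n + j)).
  by move=> j jk; apply: contraTT jk => /kmin; rewrite leqNgt.
elim: k => [|k IHk] ak; first by rewrite addn0.
have [|y] := @step_ask (n + k) _; first exact: ak.
by rewrite addnS => ->; apply: IHk => j jk; apply: ak; exact: ltnW.
Qed.

Lemma momentP t : size (x (moment x t)).1 = t /\ ~~ ask (x (moment x t)).
Proof.
suff ex : exists n, size (x n).1 = t /\ ~~ ask (x n) by exact: (getPex ex).
elim: t => [|t [n [tn an]]].
  have [m [_ am tm]] := next_move 0; exists m; split=> //.
  by rewrite tm; case: xP => -[-> _].
have [m [_ am tm]] := next_move n.+1; exists m; split=> //.
by rewrite tm; have [y ->] := step_move an; rewrite /= size_rcons tn.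
Qed.

Lemma le_moment n t : size (x n).1 = t -> (n <= moment x t)%N.
Proof.
move=> nt; have [mt am] := momentP t; rewrite leqNgt; apply/negP => /time_mono.
by have [y ->] := step_move am; rewrite /= size_rcons mt nt ltnn.
Qed.

Lemma moment_uniq n t : size (x n).1 = t -> ~~ ask (x n) -> n = moment x t.
Proof.
move=> nt an; apply/eqP; rewrite eqn_leq le_moment//= leqNgt; apply/negP => /time_mono.
by have [y ->] := step_move an; rewrite /= size_rcons nt (momentP t).1 ltnn.
Qed.

End Path.

End States.

(** * Reading the walk and its probes off the chain *)

Section Walk.
Context (R : realType) (d : nat) (T : Type).
Variables (ask : state d -> bool) (aim : state d -> seq (site d * R)).
Variable X : nat -> T -> state d.
Hypothesis XP : forall w, psrw_path ask aim (X ^~ w).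

Implicit Types (w : T) (s : state d).

Definition walk t w : site d := pos (X (moment ask (X ^~ w) t) w).
Definition probes t w : seq (site d) := (X (moment ask (X ^~ w) t) w).2.2.

Let K := walk.
Let Q := probes.

Lemma momentE t w : X (moment ask (X ^~ w) t) w = (past K Q t w, (K t w, Q t w)).
Proof.
rewrite (surjective_pairing (X _ w)) (surjective_pairing (X _ w).2); congr pair.
elim: t => [|t IH].
  by apply/size0nil; case: (momentP (XP w) 0).
have [mt am] := momentP (XP w) t; have [mt1 am1] := momentP (XP w) t.+1.
have [y Xy] := step_move (XP w) am.
have t1 : size (X (moment ask (X ^~ w) t).+1 w).1 = t.+1 by rewrite Xy/= size_rcons mt.
have le1 := le_moment (XP w) t1.
have := same_time (XP w) le1 _; rewrite mt1 => /(_ t1)[-> _ _ _].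
rewrite Xy/= IH /past mkseqS; congr rcons.
by rewrite (surjective_pairing (X _ w).2).
Qed.

Lemma ask_full t w : ~~ ask (past K Q t w, (K t w, Q t w)).
Proof. by rewrite -momentE; case: (momentP (XP w) t). Qed.

Lemma size_past t w : size (past K Q t w) = t.
Proof. exact: size_mkseq. Qed.

Lemma visitedP n w t s : X n w = s -> size s.1 = t ->
  [/\ s.1 = past K Q t w, pos s = K t w, (size s.2.2 <= size (Q t w))%N &
      take (size s.2.2) (Q t w) = s.2.2].
Proof.
move=> <- nt; have nm := le_moment (XP w) nt.
have [mt _] := momentP (XP w) t.
have := same_time (XP w) nm _; rewrite mt momentE/= => /(_ nt)[<- <- sQ sq].
by split.
Qed.

(** Backwards from the move at time t: each [undo] removes the last probe of that time. *)
Lemma visited t w i : (i <= size (Q t w))%N -> exists n,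
  X n w = (past K Q t w, (K t w, take i (Q t w))).
Proof.
move=> iQ; rewrite -(subKn iQ); elim: (size (Q t w) - i)%N => [|j [n Xn]].
  by rewrite subn0 take_size; exists (moment ask (X ^~ w) t); rewrite momentE.
have [Qj|jQ] := leqP (size (Q t w)) j.
  have -> : (size (Q t w) - j.+1 = size (Q t w) - j)%N by lia.
  by exists n.
exists n.-1; have := nsteps_path (XP w) n; rewrite Xn.
case: n Xn => [|n] Xn.
  by rewrite /nsteps/= size_takel ?leq_subr//; lia.
move=> _; rewrite -(undo_path (XP w)) Xn /undo/=.
case E : (take _ _) => [|y q].
  by have : size (take (size (Q t w) - j) (Q t w)) = 0%N; [rewrite E|rewrite size_takel ?leq_subr//; lia].
rewrite -E size_takel ?leq_subr// -subnS take_takel//; lia.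
Qed.

Lemma visitedE t w s : size s.1 = t ->
  X (nsteps s) w = s <->
  [/\ s.1 = past K Q t w, pos s = K t w, (size s.2.2 <= size (Q t w))%N &
      take (size s.2.2) (Q t w) = s.2.2].
Proof.
move=> st; split; first by move=> /visitedP; exact.
move=> [s1 sK sQ sq]; have [n Xn] := visited sQ.
have {}Xn : X n w = s.
  by rewrite Xn -s1 -sK sq; case: (s) => p [k q].
by rewrite -[in X (nsteps s) w]Xn (nsteps_path (XP w)) Xn.
Qed.

(** An observation made after exactly i probes is a state, and a state determines its step. The
    event thus concerns the chain at one fixed step. *)
Lemma observedE t i w s : size s.1 = t -> size s.2.2 = i ->
  observed K Q t i w = hist s <-> X (nsteps s) w = s.
Proof.
move=> st si; rewrite (visitedE w st) /observed /hist si; split.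
  case: s st si => p [k q] /= st si /rcons_inj[<- <- qE].
  split=> //; have [/ltnW//|iQ] := ltnP i (size (Q t w)).
  by rewrite -si -qE take_oversize.
move=> [-> sK _ ->]; congr rcons; rewrite -sK.
by case: (s) => p [k q].
Qed.

Lemma past_fullE t w s : past K Q t.+1 w = hist s <->
  [/\ size s.1 = t, ~~ ask s & X (nsteps s) w = s].
Proof.
rewrite /past mkseqS -/(past K Q t w) /hist; split.
  case: s => p [k q] /= /rcons_inj[<- <- <-].
  split; [exact: size_past|exact: ask_full|].
  by rewrite -momentE (nsteps_path (XP w)).
move=> [st sa sX]; have := moment_uniq (XP w) (t := t) (n := nsteps s).
rewrite sX => /(_ st sa) nt; move: sX; rewrite nt momentE => <- /=.
by [].
Qed.

(** A truncation to i sites that is shorter than i has cut nothing off, so s is already the last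
    state of time t. *)
Lemma take_overE t i w s : hist s = observed K Q t i w -> (size s.2.2 < i)%N ->
  s = (past K Q t w, (K t w, Q t w)).
Proof.
case: s => p [k q] /rcons_inj[-> -> ->] /=; rewrite size_take; case: ifP => [|+ _].
  by rewrite ltnn.
by move/negbT; rewrite -leqNgt => iQ; rewrite take_oversize.
Qed.

Lemma size_observed t i w s : hist s = observed K Q t i w ->
  [/\ size s.1 = t, (size s.2.2 <= i)%N & pos s = K t w].
Proof.
case: s => p [k q] /rcons_inj[-> -> ->]; rewrite size_past; split => //=.
by rewrite size_take; case: ltnP.
Qed.

(** Whether a further probe follows the first i is decided by [ask] at the state reached after them;
    if the observation shows fewer than i sites, probing has stopped before. *)
Lemma size_probesE t i w s : hist s = observed K Q t i w ->
  (i < size (Q t w))%N = (size s.2.2 == i) && ask s.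
Proof.
move=> so; have [st si sK] := size_observed so.
move: si; rewrite leq_eqVlt => /predU1P[si|si]; last first.
  have := take_overE so si => E; rewrite E/= in si *.
  by rewrite ltnNge ltnW// (ltn_eqF si).
rewrite si eqxx/=; have := (observedE w st si).1 (esym so) => Xs.
have [_ _ sQ sq] := (visitedE w st).1 Xs; rewrite si in sQ sq.
apply/idP/idP => [iQ|sa].
  apply: contraT => sa; have := moment_uniq (XP w) (t := t) (n := nsteps s).
  rewrite Xs => /(_ st sa) nt; move: Xs; rewrite nt momentE => sE.
  by move: si iQ; rewrite -sE/= => ->; rewrite ltnn.
have := @step_ask _ _ _ _ _ (XP w) (nsteps s); rewrite Xs => /(_ sa)[y Xy].
have [|_ _ + _] := @visitedP _ w t (probe s y) Xy; first by [].
by rewrite /= size_rcons si.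
Qed.

Lemma onth_probesE t i w s y : hist s = observed K Q t i w ->
  onth (Q t w) i = Some y <->
  size s.2.2 = i /\ X (nsteps s).+1 w = probe s y.
Proof.
move=> so; have [st si sK] := size_observed so; split.
  move=> Qy; have iQ : (i < size (Q t w))%N by rewrite -onthTE Qy.
  have := size_probesE so; rewrite iQ => /esym/andP[/eqP {}si sa]; split=> //.
  rewrite -(nsteps_probe _ y) (@visitedE t)//=.
  have Xs := (observedE w st si).1 (esym so).
  have [? ? ? sq] := (visitedE w st).1 Xs; split=> //.
    by rewrite size_rcons si.
  rewrite size_rcons si (take_nth y)// -{}sq si; congr rcons.
  exact: onth_nth.
move=> [{}si Xy]; have [|_ _ iQ] := @visitedP _ w t (probe s y) Xy; first by [].
rewrite /= size_rcons si in iQ *; rewrite (take_nth y)// => /rcons_inj[_ E].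
by rewrite onthE (nth_map y)// E.
Qed.

Lemma walkS t w s y : past K Q t.+1 w = hist s ->
  K t.+1 w = y <-> X (nsteps s).+1 w = move s y.
Proof.
move=> /past_fullE[st sa sX].
have := @step_move _ _ _ _ _ (XP w) (nsteps s); rewrite sX => /(_ sa)[z Xz].
have [|_ + _ _] := @visitedP _ w t.+1 (move s z) Xz; first by rewrite /= size_rcons st.
rewrite Xz => <-; split => [<-//|/move_inj[_ ->]//].
Qed.

Lemma walk0 w : K 0%N w = 0.
Proof.
have [[X0 _] _] := XP w.
by have [|_ <-] := @visitedP 0 w 0 _ X0.
Qed.

End Walk.

(** * Conditional probabilities given a countable-valued observation *)

Section SigmaOf.
Context (T : Type) (H : countType) (g : T -> H).

(** With countably many values, any preimage is a countable union of fibres. Together with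
    [sigma_ofE] this identifies the generated sigma-algebra with the family of all preimages. *)
Lemma sigma_of_preimage (A : set H) : sigma_of g (g @^-1` A).
Proof.
have -> : g @^-1` A =
    \bigcup_n [set w | A (g w) /\ pickle (g w) = n].
  by apply/seteqP; split => [w Aw|w [n _ []]//]; exists (pickle (g w)).
have [s0 sC sU] := smallest_sigma_algebra setT (range (fun h : H => g @^-1` [set h])).
apply: sU => n; have [[w0 [Aw0 n0]]|nw] :=
    pselect (exists w, A (g w) /\ pickle (g w) = n).
  apply: sub_sigma_algebra; exists (g w0) => //.
  apply/seteqP; split => w /= => [->//|[Aw]].
  by rewrite -n0 => /(pcan_inj pickleK).
rewrite (_ : [set _ | _] = set0)//; apply/seteqP; split => w //= Aw.
by apply: nw; exists w.
Qed.

Lemma sigma_of_eq (E : set T) (A : set H) : (forall w, E w <-> A (g w)) -> sigma_of g E.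
Proof.
move=> EA; have -> : E = g @^-1` A by apply/seteqP; split => w /EA.
exact: sigma_of_preimage.
Qed.

Lemma sigma_ofE (E : set T) : sigma_of g E -> exists A : set H, E = g @^-1` A.
Proof.
suff sub : sigma_of g `<=` [set E | exists A : set H, E = g @^-1` A] by exact: sub.
apply: smallest_sub => [|_ [h _ <-]]; last by exists [set h].
split.
- by exists set0; rewrite preimage_set0.
- by move=> _ [A ->]; exists (~` A); rewrite setTD preimage_setC.
- move=> F FA; exists (\bigcup_n sval (cid (FA n))); rewrite preimage_bigcup.
  by apply: eq_bigcupr => n _; rewrite -(svalP (cid (FA n))).
Qed.

End SigmaOf.

Section Conditional.
Context (R : realType) (d : measure_display) (T : measurableType d).
Variable P : probability T R.

Lemma measurable_fibers (H : countType) (g : T -> H) (A : set H) :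
  (forall h, measurable [set w | g w = h]) -> measurable [set w | A (g w)].
Proof.
move=> mg; have -> : [set w | A (g w)] =
    \bigcup_n [set w | A (g w) /\ pickle (g w) = n].
  by apply/seteqP; split => [w Aw|w [n _ []]//]; exists (pickle (g w)).
apply: bigcup_measurable => n _; have [[w0 [Aw0 n0]]|nw] :=
    pselect (exists w, A (g w) /\ pickle (g w) = n).
  have -> : [set w | A (g w) /\ pickle (g w) = n] = [set w | g w = g w0].
    apply/seteqP; split => w /= => [[Aw]|->//].
    by rewrite -n0 => /(pcan_inj pickleK).
  exact: mg.
rewrite (_ : [set _ | _] = set0)//; apply/seteqP; split => w //= Aw.
by apply: nw; exists w.
Qed.

(** The fibres of g are the atoms of the sigma-algebra. The defining identity is checked on each of
    them, where f is constant, and then summed. *)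
Lemma is_cond_probP (H : countType) (g : T -> H) (E : set T) (G : H -> \bar R)
    (f : T -> \bar R) :
  (forall w, f w = G (g w)) -> (forall h, (0 <= G h)%E) ->
  (forall h, measurable [set w | g w = h]) -> measurable E ->
  (forall h, P ([set w | g w = h] `&` E) = (G h * P [set w | g w = h])%E) ->
  is_cond_prob P (sigma_of g) E f.
Proof.
move=> /funext -> G0 mg mE PE; split=> [B _|_ /sigma_ofE[A ->]].
  by apply: (@sigma_of_eq _ _ _ _ (G @^-1` B)).
(* The fibres are numbered by [pickle]: each F n is a single fibre of g or empty. *)
pose F n := [set w | A (g w) /\ pickle (g w) = n].
have mgA (C : set H) : measurable [set w | C (g w)] by exact: measurable_fibers.
have mF n : measurable (F n) by apply: (mgA [set h | A h /\ pickle h = n]).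
have tF : trivIset setT F.
  by move=> i j _ _ [w [[_ <-] [_ <-]]].
have -> : g @^-1` A = \bigcup_n F n.
  by apply/seteqP; split => [w Aw|w [n _ []]//]; exists (pickle (g w)).
rewrite ge0_integral_bigcup//; last first.
  by move=> mD B mB; apply: measurableI => //; exact: (mgA (G @^-1` B)).
rewrite setI_bigcupl measure_bigcup//=; first last.
- by apply/trivIsetP => i j _ _ ij; have /trivIsetP/(_ i j I I ij) := tF;
    rewrite setIACA => ->; rewrite set0I.
- by move=> n _; exact: measurableI.
rewrite (eq_eseriesl (Q := xpredT)); last by move=> n; rewrite in_setT.
apply: eq_eseriesr => n _.
have [[w0 [Aw0 n0]]|nw] := pselect (exists w, A (g w) /\ pickle (g w) = n).
  have -> : F n = [set w | g w = g w0].
    apply/seteqP; split => w /= => [[Aw]|wE].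
      by rewrite -n0 => /(pcan_inj pickleK).
    by rewrite /F/= wE.
  rewrite PE; transitivity (\int[P]_(w in [set w | g w = g w0]) cst (G (g w0)) w)%E.
    by rewrite integral_cst.
  by apply: eq_integral => w /=; rewrite inE/= => ->.
have -> : F n = set0.
  by apply/seteqP; split => w //= Aw; apply: nw; exists w.
by rewrite set0I measure0 integral_set0.
Qed.

End Conditional.

(** * From the chain to a probing simple random walk *)

Section UnitSteps.
Context (d : nat).
Implicit Types (e : direction d) (x y : site d).

Lemma unit_stepE e i : unit_step e 0 i = (-1 : int) ^+ e.2 * (i == e.1)%:R.
Proof. by rewrite /unit_step !mxE eqxx. Qed.

Lemma unit_step_inj : injective (@unit_step d).
Proof.
move=> e e' /matrixP/(_ 0) E; have := E e.1; rewrite !unit_stepE eqxx mulr1.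
case: e e' E => [i b] [j c] E /=; case: eqVneq => [->|]; last by rewrite mulr0; case: (b).
by rewrite mulr1; case: b c {E} => -[].
Qed.

Lemma dist1_unit_step x e : dist1 x (x + unit_step e) = 1%N.
Proof.
rewrite /dist1 (bigD1 e.1)//= big1 => [|i ie]; rewrite mxE unit_stepE ?eqxx ?(negbTE ie).
  by rewrite mulr1 opprD addNKr addn0 abszN; case: e.2.
by rewrite mulr0 addr0 subrr.
Qed.

Lemma dist1_gt0 x y : x != y -> (1 <= dist1 x y)%N.
Proof.
apply: contraNT; rewrite -ltnNge ltnS leqn0 /dist1 sum_nat_eq0 => /forallP h.
apply/eqP/matrixP => i j; rewrite (ord1 i).
by have := h j; rewrite /= absz_eq0 subr_eq0 => /eqP.
Qed.

End UnitSteps.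

Section PSRW.
Context (R : realType) (d : nat).
Variables (ask : state d -> bool) (aim : state d -> seq (site d * R)).
Variable inv : state d -> Prop.
Hypothesis inv0 : inv (start d).
Hypothesis step_inv : stochastic_on (step ask aim) inv.

Implicit Types (s : state d).

Definition aimed s y : R := \sum_(z <- aim s | z.1 == y) z.2.

Let delta s' s : R := (`[< s = s' >])%:R.

Lemma average_undo s' s : s != undo s' -> average (step ask aim) (delta s') s = 0.
Proof.
move=> ss'; rewrite /average big_seq big1// => z zs; rewrite /delta asboolF ?mulr0//.
move=> zE; move: ss'; rewrite -zE; move: zs; rewrite /step.
by case: ifP => _ /mapP[u _ ->]/=; rewrite ?undo_probe ?undo_move eqxx.
Qed.

Lemma average_move s y : ~~ ask s ->
  average (step ask aim) (delta (move s y)) s = uniform_neighbor R (dom s) (pos s) y.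
Proof.
move=> sa; rewrite /average /step (negbTE sa) big_map big_enum/=.
rewrite /uniform_neighbor -/(nopen _ _); case: ifPn => [/andP[yD /existsP[e /eqP ye]]|nxy].
  rewrite (bigD1 e)/=; last by rewrite inE -ye.
  rewrite /delta -ye asboolT// mulr1 big1 ?addr0// => e' /andP[_ ee'].
  rewrite asboolF ?mulr0// => /move_inj[_]; rewrite ye => /addrI/unit_step_inj ee.
  by rewrite ee eqxx in ee'.
rewrite big1// => e; rewrite inE => eD; rewrite /delta asboolF ?mulr0//.
move=> /move_inj[_ ey]; move: nxy; rewrite -ey eD/= => /existsP[]; exists e.
by rewrite eqxx.
Qed.

Lemma average_probe s y : ask s ->
  average (step ask aim) (delta (probe s y)) s = aimed s y.
Proof.
move=> sa; rewrite /average /step sa big_map/= /aimed [RHS]big_mkcond.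
apply: eq_bigr => z _; rewrite /delta; case: eqP => [->|zy].
  by rewrite asboolT ?mulr1.
by rewrite asboolF ?mulr0// => /probe_inj[_].
Qed.

Context (disp : measure_display) (T : measurableType disp) (P : probability T R).
Variable X : nat -> T -> state d.
Hypothesis PX : chain_law (step ask aim) (start d) P X.
Hypothesis XP : forall w, psrw_path ask aim (X ^~ w).

Let K := walk ask X.
Let Q := probes ask X.

Let mX n (A : state d -> Prop) : measurable [set w | A (X n w)].
Proof. by case: (PX n A). Qed.

Lemma inv_path n w : inv (X n w).
Proof.
have [[X0 XS] _] := XP w; elim: n => [|n IH]; first by rewrite X0.
by have [_ _] := step_inv IH; apply; exact: XS.
Qed.

(** No sum over predecessors occurs: s' can only be reached from [undo s']. *)
Lemma law_step n s' : P [set w | X n.+1 w = s'] =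
  ((average (step ask aim) (delta s') (undo s'))%:E * P [set w | X n w = undo s'])%E.
Proof.
have [_ ->] := PX n.+1 (fun s => s = s'); have [_ ->] := PX n (fun s => s = undo s').
rewrite meanS -EFinM; congr (_%:E); rewrite /mean mulr_sumr; apply: eq_bigr => z _.
rewrite mulrCA; congr (_ * _); case: asboolP => [->|zs]; first by rewrite mulr1.
by rewrite mulr0 average_undo//; apply/eqP.
Qed.

Lemma unhist (h : history d) : h = [::] \/ exists s, h = hist s.
Proof.
case/lastP: h => [|p c]; [by left|right].
by exists (p, c).
Qed.

Lemma measurable_moment t (A : state d -> Prop) :
  measurable [set w | A (X (moment ask (X ^~ w) t) w)].
Proof.
apply: (@measurable_fibers _ _ _ (fun w => X (moment ask (X ^~ w) t) w)) => s.
have -> :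
    [set w | X (moment ask (X ^~ w) t) w = s] =
    [set w | (fun s' => [/\ size s.1 = t, ~~ ask s & s' = s]) (X (nsteps s) w)].
  apply/seteqP; split => w /=.
    move=> <-; have [mt am] := momentP (XP w) t; split=> //.
    by rewrite (nsteps_path (XP w)).
  move=> [st sa sX]; have := moment_uniq (XP w) (t := t) (n := nsteps s).
  by rewrite sX => /(_ st sa) <-.
exact: (mX (nsteps s) (fun s' => [/\ size s.1 = t, ~~ ask s & s' = s])).
Qed.

Lemma measurable_walk t x : measurable [set w | K t w = x].
Proof. exact: (measurable_moment t (fun s => pos s = x)). Qed.

Lemma measurable_probes t q : measurable [set w | Q t w = q].
Proof. exact: (measurable_moment t (fun s => s.2.2 = q)). Qed.

Lemma measurable_past t h : measurable [set w | past K Q t w = h].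
Proof.
have -> : [set w | past K Q t w = h] =
    [set w | (fun s => s.1 = h) (X (moment ask (X ^~ w) t) w)].
  by apply/seteqP; split => w /=; rewrite (momentE XP).
exact: (measurable_moment t (fun s => s.1 = h)).
Qed.

Lemma measurable_observed t i h : measurable [set w | observed K Q t i w = h].
Proof.
have -> : [set w | observed K Q t i w = h] =
    [set w | (fun s => rcons s.1 (s.2.1, take i s.2.2) = h) (X (moment ask (X ^~ w) t) w)].
  by apply/seteqP; split => w /=; rewrite (momentE XP).
exact: (measurable_moment t (fun s => rcons s.1 (s.2.1, take i s.2.2) = h)).
Qed.

Lemma psrw_of_chain : is_psrw P K Q.
Proof.
split.
- exact: measurable_walk.
- exact: measurable_probes.
- exact: walk0.
- move=> t i; apply: (@sigma_of_eq _ _ _ _ [set h | exists s, h = hist s /\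
    ~~ ((size s.2.2 == i) && ask s)]) => w /=; rewrite leqNgt; split.
    move=> iQ; exists (past K Q t w, (K t w, take i (Q t w))); split=> //.
    by rewrite -(size_probesE XP (t := t) (w := w))//.
  by move=> [s [/esym so]]; rewrite (size_probesE XP so).
move=> t y; pose u (h : history d) := uniform_neighbor R (domain h) (last (0, [::]) h).1 y.
apply: (@is_cond_probP _ _ _ _ _ _ _ (fun h => (u h)%:E)).
- by move=> w; rewrite /u /past mkseqS last_rcons.
- by move=> h; rewrite lee_fin /u /uniform_neighbor; case: ifP => // _; rewrite invr_ge0.
- exact: measurable_past.
- exact: measurable_walk.
move=> h; have [->|[s ->]] := unhist h.
  rewrite (_ : [set _ | _] = set0) ?set0I ?measure0 ?mule0//.
  by apply/seteqP; split => w //=; rewrite /past mkseqS => /(congr1 size); rewrite size_rcons.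
have [[st sa]|ns] := pselect (size s.1 = t /\ ~~ ask s); last first.
  rewrite (_ : [set _ | _] = set0) ?set0I ?measure0 ?mule0//.
  by apply/seteqP; split => w //= /(past_fullE XP)[st sa _]; apply: ns.
have -> : [set w | past K Q t.+1 w = hist s] = [set w | X (nsteps s) w = s].
  by apply/seteqP; split => w /=; rewrite (past_fullE XP) => // -[].
have -> : [set w | X (nsteps s) w = s] `&` [set w | K t.+1 w = y] =
    [set w | X (nsteps s).+1 w = move s y].
  apply/seteqP; split => w /=.
    move=> [Xs Ky]; have sp : past K Q t.+1 w = hist s by apply/(past_fullE XP).
    exact: (walkS XP y sp).1.
  move=> Xs; have Xn : X (nsteps s) w = s by rewrite -(undo_path (XP w)) Xs undo_move.
  have sp : past K Q t.+1 w = hist s by apply/(past_fullE XP).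
  by split=> //; apply/(walkS XP y sp).
by rewrite law_step undo_move average_move// /u /hist last_rcons.
Qed.

Lemma hitting_of_chain :
  (forall s, inv s -> ask s -> forall y,
     (aimed s y)%:E = hitting_measure R (dom s) (pos s) y) ->
  probes_by_hitting_measure P K Q.
Proof.
(* The version u has to depend on the history alone; it vanishes unless that history is a state at
   which the probe with index i is about to be sent. *)
move=> hit t i x; pose u (h : history d) : \bar R :=
  if `[< exists s, [/\ h = hist s, inv s, size s.2.2 = i & ask s] >]
  then hitting_measure R (domain h) (last (0, [::]) h).1 x else 0%E.
have uT s : inv s -> size s.2.2 = i -> ask s ->
    u (hist s) = hitting_measure R (dom s) (pos s) x.
  by move=> si s2 sa; rewrite /u asboolT /hist ?last_rcons//; exists s.
have uF s : ~ (inv s /\ size s.2.2 = i /\ ask s) -> u (hist s) = 0%E.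
  move=> ns; rewrite /u asboolF// => -[s' [/rcons_inj[e1 e2] si s2 sa]].
  by apply: ns; rewrite (surjective_pairing s) e1 e2 -surjective_pairing.
apply: (@is_cond_probP _ _ _ _ _ _ _ u).
- move=> w; pose s : state d := (past K Q t w, (K t w, take i (Q t w))).
  have so : hist s = observed K Q t i w by [].
  rewrite -so (size_probesE XP so); have [st _ _] := size_observed so.
  case: (boolP (_ && _)) => [/andP[/eqP si sa]|ns].
    rewrite uT//; have := (observedE XP w st si).1 (esym so) => <-.
    exact: inv_path.
  by rewrite uF// => -[_ [/eqP si sa]]; rewrite si sa in ns.
- move=> h; rewrite /u; case: ifP => // _; apply: nneseries_ge0 => n _ _.
  by rewrite lee_fin /srw_exit_at divr_ge0// exprn_ge0.
- exact: measurable_observed.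
- exact: (measurable_moment t (fun s => onth s.2.2 i = Some x)).
move=> h; have [->|[s ->]] := unhist h.
  rewrite (_ : [set _ | _] = set0) ?set0I ?measure0 ?mule0//.
  by apply/seteqP; split => w //=; rewrite /observed => /(congr1 size); rewrite size_rcons.
have [st|st] := pselect (size s.1 = t); last first.
  rewrite (_ : [set _ | _] = set0) ?set0I ?measure0 ?mule0//.
  by apply/seteqP; split => w //= /esym so; have [] := size_observed so.
have [si|si] := pselect (size s.2.2 = i); last first.
  rewrite uF ?mul0e; last by case=> _ [].
  rewrite (_ : _ `&` _ = set0) ?measure0//.
  by apply/seteqP; split => w //= -[/esym so] /(onth_probesE XP x so)[].
have -> : [set w | observed K Q t i w = hist s] = [set w | X (nsteps s) w = s].
  by apply/seteqP; split => w /=; rewrite (observedE XP).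
have -> : [set w | X (nsteps s) w = s] `&` [set w | onth (Q t w) i = Some x] =
    [set w | X (nsteps s).+1 w = probe s x].
  apply/seteqP; split => w /=.
    move=> [Xs Qx]; have /esym so : observed K Q t i w = hist s by apply/(observedE XP).
    by have [] := (onth_probesE XP x so).1 Qx.
  move=> Xs; have Xn : X (nsteps s) w = s by rewrite -(undo_path (XP w)) Xs undo_probe.
  have /esym so : observed K Q t i w = hist s by apply/(observedE XP).
  by split=> //; apply/(onth_probesE XP x so).
have [sa|sa] := boolP (ask s); last first.
  rewrite uF ?mul0e; last by case=> _ [_]; exact/negP.
  rewrite (_ : [set _ | _] = set0) ?measure0//; apply/seteqP; split => w //= Xs.
  have Xn : X (nsteps s) w = s by rewrite -(undo_path (XP w)) Xs undo_probe.
  have := @step_move _ _ _ _ _ (XP w) (nsteps s); rewrite Xn => /(_ sa)[y].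
  by rewrite Xs; exact: probe_neq_move.
rewrite law_step undo_probe average_probe//; have [si'|ns] := pselect (inv s).
  by rewrite uT// hit.
rewrite (_ : [set _ | _] = set0) ?measure0 ?mule0//; apply/seteqP; split => w //= Xs.
by apply: ns; rewrite -Xs; exact: inv_path.
Qed.

Lemma at_distance_one_of_chain (site_of : state d -> site d) :
  (forall s, inv s -> ask s -> aim s = [:: (site_of s, 1)]) ->
  (forall s, inv s -> ask s -> at_distance_one (dom s) (site_of s)) ->
  probes_chosen_at_distance_one K Q.
Proof.
move=> aimE site1.
have QE t i x w s : hist s = observed K Q t i w ->
    onth (Q t w) i = Some x <-> [/\ inv s, size s.2.2 = i, ask s & x = site_of s].
  move=> so; have [st _ _] := size_observed so; split.
    move=> Qx; have iQ : (i < size (Q t w))%N by rewrite -onthTE Qx.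
    have := size_probesE XP so; rewrite iQ => /esym/andP[/eqP si sa].
    have Xs := (observedE XP w st si).1 (esym so).
    have [_ Xx] := (onth_probesE XP x so).1 Qx.
    have sinv : inv s by rewrite -Xs; exact: inv_path.
    split=> //; have := step_cases (XP w) (nsteps s).
    rewrite Xs sa => -[[_ [y ya]]|[]//]; rewrite Xx => /probe_inj[_ ->].
    by move: ya; rewrite aimE//= inE => /eqP.
  move=> [sinv si sa ->]; apply/(onth_probesE XP _ so); split=> //.
  have Xs := (observedE XP w st si).1 (esym so).
  have := step_cases (XP w) (nsteps s).
  rewrite Xs sa => -[[_ [y ya]]|[]//] ->; congr probe.
  by move: ya; rewrite aimE//= inE => /eqP.
split=> [t i x|t i x w].
  apply: (@sigma_of_eq _ _ _ _ [set h | exists s,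
    [/\ h = hist s, inv s, size s.2.2 = i, ask s & x = site_of s]]) => w /=.
  split.
    move=> Qx; exists (past K Q t w, (K t w, take i (Q t w))).
    have so : hist (past K Q t w, (K t w, take i (Q t w))) = observed K Q t i w by [].
    by have [? ? ? ?] := (QE _ _ _ _ _ so).1 Qx.
  by move=> [s [/esym so ? ? ? ?]]; apply/(QE _ _ _ _ _ so).
have so : hist (past K Q t w, (K t w, take i (Q t w))) = observed K Q t i w by [].
move=> /(QE _ _ _ _ _ so)[sinv _ sa ->]; rewrite -so.
exact: site1.
Qed.

End PSRW.

(** * Simple random walk and its exit from a finite domain *)

Section SquareNorm.
Context (d : nat).
Implicit Types (x : site d) (e : direction d).

Definition sqnorm x : int := \sum_(i < d) (x 0 i) ^+ 2.

Lemma sqnorm_ge0 x : 0 <= sqnorm x.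
Proof. by apply: sumr_ge0 => i _; exact: sqr_ge0. Qed.

Lemma sqnorm_step x e :
  sqnorm (x + unit_step e) = sqnorm x + 1 + (-1) ^+ e.2 * x 0 e.1 *+ 2.
Proof.
rewrite /sqnorm (bigD1 e.1)//= [in RHS](bigD1 e.1)//= mxE unit_stepE eqxx mulr1.
rewrite (eq_bigr (fun i => (x 0 i) ^+ 2)) => [|i ie].
  by rewrite sqrrD -exprM mulnC exprM sqrrN expr1n; ring.
by rewrite mxE unit_stepE (negbTE ie) mulr0 addr0.
Qed.

Lemma sum_direction (V : nmodType) (F : direction d -> V) :
  \sum_(e : direction d) F e = \sum_(i < d) (F (i, false) + F (i, true)).
Proof.
rewrite (eq_bigr (fun e => F (e.1, e.2))) => [|[]//].
rewrite -(pair_bigA _ (fun i b => F (i, b)))/=; apply: eq_bigr => i _.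
by rewrite big_bool addrC.
Qed.

Lemma sum_sqnorm x :
  \sum_(e : direction d) sqnorm (x + unit_step e) = (2 * d)%:R * (sqnorm x + 1).
Proof.
rewrite sum_direction (eq_bigr (fun=> (sqnorm x + 1) *+ 2)) => [|i _].
  by rewrite sumr_const card_ord -mulrnA mulr_natl.
by rewrite !sqnorm_step/=; ring.
Qed.

Lemma card_direction : #|direction d| = (2 * d)%N.
Proof. by rewrite card_prod card_ord card_bool mulnC. Qed.

End SquareNorm.

Section HittingMeasure.
Context (R : realType) (d : nat).
Hypothesis d0 : (0 < d)%N.
Implicit Types (D : seq (site d)) (x y : site d).

Let dR0 : (2 * d)%:R != 0 :> R.
Proof. by rewrite pnatr_eq0 muln_eq0 -lt0n d0. Qed.

Definition spread (f : site d -> R) x : R :=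
  (2 * d)%:R^-1 * \sum_(e : direction d) f (x + unit_step e).

Lemma spread_cst (c : R) x : spread (fun=> c) x = c.
Proof. by rewrite /spread sumr_const card_direction -[c *+ _]mulr_natl mulKf. Qed.

Lemma spreadD f g x : spread (fun y => f y + g y) x = spread f x + spread g x.
Proof. by rewrite /spread big_split mulrDr. Qed.

Lemma spreadZ (c : R) f x : spread (fun y => c * f y) x = c * spread f x.
Proof. by rewrite /spread -mulr_sumr mulrCA. Qed.

Lemma spread_sum I (r : seq I) (f : I -> site d -> R) x :
  spread (fun y => \sum_(i <- r) f i y) x = \sum_(i <- r) spread (f i) x.
Proof. by rewrite /spread exchange_big/= mulr_sumr. Qed.

Lemma le_spread f g x : (forall e, f (x + unit_step e) <= g (x + unit_step e)) ->
  spread f x <= spread g x.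
Proof. by move=> fg; rewrite /spread ler_wpM2l// ler_sum. Qed.

Lemma eq_spread f g x : (forall e, f (x + unit_step e) = g (x + unit_step e)) ->
  spread f x = spread g x.
Proof. by move=> fg; rewrite /spread (eq_bigr _ (fun e _ => fg e)). Qed.

Lemma spread_ge0 f x : (forall e, 0 <= f (x + unit_step e)) -> 0 <= spread f x.
Proof. by move=> f0; rewrite -(spread_cst 0 x); exact: le_spread. Qed.

Lemma spread_sqnorm x : spread (fun y => (sqnorm y)%:~R) x = (sqnorm x)%:~R + 1.
Proof.
by rewrite /spread -rmorph_sum sum_sqnorm rmorphM rmorph_nat mulKf// rmorphD.
Qed.

Lemma srw_exit_at0 D x y : srw_exit_at R D x y 0 = ((x \notin D) && (x == y))%:R.
Proof.
rewrite /srw_exit_at expr0 divr1.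
rewrite (eq_card (B := [pred s : 0.-tuple (direction d) | (x \notin D) && (x == y)])).
  by case: (_ && _); rewrite ?card0// -(@eq_card _ predT)// card_tuple expn0.
move=> s; rewrite !inE /srw_path take0 big_nil addr0.
by rewrite (_ : [forall k : 'I_0, _] = true)//; apply/forallP => -[].
Qed.

(** Decomposition according to the first step of the path. *)
Lemma srw_exit_atS D x y n : srw_exit_at R D x y n.+1 =
  if x \in D then spread (fun z => srw_exit_at R D z y n) x else 0.
Proof.
pose A z (s : seq (direction d)) (m : nat) :=
  (all (fun k => z + \sum_(e <- take k s) unit_step e \in D) (iota 0 m)) &&
  (z + \sum_(e <- take m s) unit_step e \notin D) &&
  (z + \sum_(e <- take m s) unit_step e == y).
have AE m z : srw_exit_at R D z y m =
    (\sum_(s : m.-tuple (direction d)) A z s m)%N%:R / (2 * d)%:R ^+ m.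
  rewrite /srw_exit_at -sum1_card big_mkcond/=; congr (_%:R / _); apply: eq_bigr => s _.
  rewrite inE /A /srw_path; set b := [forall _, _].
  have -> : b = all (fun k => z + \sum_(e <- take k s) unit_step e \in D) (iota 0 m).
    apply/forallP/allP => [h k|h k].
      by rewrite mem_iota add0n => /= km; have := h (Ordinal km).
    by apply: h; rewrite mem_iota add0n/=.
  by case: (_ && _).
rewrite AE; have -> : (\sum_(s : n.+1.-tuple (direction d)) A x s n.+1 =
    \sum_(e : direction d) \sum_(s : n.-tuple (direction d)) A x (e :: s) n.+1)%N.
  rewrite pair_big/=; rewrite (reindex (fun p : direction d * n.-tuple (direction d) => [tuple of p.1 :: p.2]))//=.
  exists (fun s : n.+1.-tuple (direction d) => (thead s, [tuple of behead s])) => [[e s] _|s _]/=.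
    by congr pair; exact: val_inj.
  by apply: val_inj; rewrite /= [in RHS](tuple_eta s).
have AS e (s : n.-tuple (direction d)) :
    A x (e :: s) n.+1 = (x \in D) && A (x + unit_step e) s n.
  rewrite /A/= big_nil addr0 !big_cons !addrA -!andbA; congr (_ && (_ && _)).
  rewrite -[X in iota X]addn0 iotaDl all_map; apply: eq_all => k /=.
  by rewrite big_cons addrA.
case: ifPn => xD.
  rewrite /spread mulr_sumr natr_sum mulr_suml; apply: eq_bigr => e _.
  rewrite AE exprS invfM mulrCA; congr (_ * (_%:R * _)); apply: eq_bigr => s _.
  by rewrite AS xD.
rewrite big1 ?mul0r// => e _; rewrite big1// => s _.
by rewrite AS (negbTE xD).
Qed.

Definition boundary D : seq (site d) :=
  undup [seq y <- [seq x + unit_step e | x <- D, e <- enum (direction d)] | y \notin D].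

Lemma boundary_notin D y : y \in boundary D -> y \notin D.
Proof. by rewrite mem_undup mem_filter => /andP[]. Qed.

Lemma step_boundary D x e : x \in D -> x + unit_step e \notin D ->
  x + unit_step e \in boundary D.
Proof.
move=> xD xeD; rewrite mem_undup mem_filter xeD /=.
by apply/allpairsP; exists (x, e); rewrite mem_enum.
Qed.

Lemma boundary_step D y : y \in boundary D ->
  exists2 x, x \in D & exists e, y = x + unit_step e.
Proof.
rewrite mem_undup mem_filter => /andP[_ /allpairsP[[x e] [/= xD _ ->]]].
by exists x => //; exists e.
Qed.

(** The probability of no exit up to and including step n, which is the remainder in the total mass
    of the exit law. *)
Fixpoint staying D n x : R :=
  if x \in D then if n is m.+1 then spread (staying D m) x else 1 else 0.

Lemma staying_ge0 D n x : 0 <= staying D n x.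
Proof.
elim: n x => [|n IH] x /=; case: ifP => // _.
by apply: spread_ge0 => e; exact: IH.
Qed.

Let closed D := [predU D & boundary D].

Let closed_step D x e : x \in D -> x + unit_step e \in closed D.
Proof.
move=> xD; rewrite inE/=; case: (boolP (_ \in D)) => //= xeD.
exact: step_boundary.
Qed.

Lemma exit_staying D n x : x \in closed D ->
  \sum_(k < n.+1) \sum_(y <- boundary D) srw_exit_at R D x y k + staying D n x = 1.
Proof.
have bd z : z \notin D -> z \in boundary D ->
    \sum_(y <- boundary D) srw_exit_at R D z y 0 = 1.
  move=> zD zb; rewrite (bigD1_seq z)//= ?undup_uniq// srw_exit_at0 zD eqxx big1 ?addr0//.
  by move=> y yz; rewrite srw_exit_at0 eq_sym (negbTE yz) andbF.
elim: n x => [|n IH] x; rewrite inE/= => /orP[xD|xb].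
- rewrite big_ord_recl big_ord0 addr0 xD big1 ?add0r// => y _.
  by rewrite srw_exit_at0 xD.
- have xD := boundary_notin xb.
  by rewrite big_ord_recl big_ord0 !addr0 (negbTE xD) bd// addr0.
- rewrite big_ord_recl/= xD [X in X + _ + _]big1 ?add0r; last first.
    by move=> y _; rewrite srw_exit_at0 xD.
  under eq_bigr do (under eq_bigr do rewrite /bump/= add1n srw_exit_atS xD; rewrite -spread_sum).
  rewrite -spread_sum -spreadD -[RHS](spread_cst 1 x); apply: eq_spread => e.
  exact/IH/closed_step.
- have xD := boundary_notin xb.
  rewrite big_ord_recl/= (negbTE xD) bd// [X in 1 + X]big1 ?addr0// => k _.
  by rewrite big1// => y _; rewrite /bump/= add1n srw_exit_atS (negbTE xD).
Qed.

(* The expected exit time is bounded by [C - |x|^2]. *)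
Lemma staying_sum D (C : R) N x : (forall z, z \in closed D -> (sqnorm z)%:~R <= C) ->
  x \in closed D -> \sum_(n < N) staying D n x <= C - (sqnorm x)%:~R.
Proof.
move=> DC; elim: N x => [|N IH] x xc; first by rewrite big_ord0 subr_ge0 DC.
case: (boolP (x \in D)) => xD; last first.
  by rewrite big1 ?subr_ge0 ?DC// => -[[|n] _] _/=; rewrite (negbTE xD).
rewrite big_ord_recl/= xD.
rewrite (eq_bigr (fun n : 'I_N => spread (staying D n) x)) => [|n _]; last first.
  by rewrite add0n.
rewrite -spread_sum.
have : spread (fun y => \sum_(i < N) staying D i y) x <=
    spread (fun y => C + (-1) * (sqnorm y)%:~R) x.
  by apply: le_spread => e; rewrite mulN1r; exact/IH/closed_step.
rewrite spreadD spread_cst spreadZ spread_sqnorm; lra.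
Qed.

(** By [staying_sum] the series of these probabilities is bounded, so its terms tend to 0: the walk
    leaves a finite domain almost surely. *)
Lemma staying_cvg0 D x : x \in D -> staying D n x @[n --> \oo] --> (0 : R).
Proof.
move=> xD; apply: cvg_series_cvg_0; apply: nondecreasing_is_cvgn.
  apply/nondecreasing_seqP => n; rewrite /series/= big_nat_recr//= lerDl.
  exact: staying_ge0.
pose C : R := \sum_(z <- D ++ boundary D) (sqnorm z)%:~R.
have sq0 (z : site d) : 0 <= (sqnorm z)%:~R :> R by rewrite ler0z sqnorm_ge0.
have DC z : z \in closed D -> (sqnorm z)%:~R <= C.
  rewrite inE/= -mem_cat => zD; rewrite /C (big_rem _ zD)/= lerDl.
  by apply: sumr_ge0 => y _; exact: sq0.
exists (C - (sqnorm x)%:~R) => _ [n _ <-]; rewrite /series/= big_mkord.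
by apply: staying_sum => //; rewrite inE/= xD.
Qed.

Lemma srw_exit_at_ge0 D x y n : 0 <= srw_exit_at R D x y n.
Proof. by rewrite /srw_exit_at divr_ge0// exprn_ge0. Qed.

Lemma hitting_measure_ge0 D x y : (0 <= hitting_measure R D x y)%E.
Proof. by apply: nneseries_ge0 => n _ _; rewrite lee_fin srw_exit_at_ge0. Qed.

(** Total mass one is what allows the hitting measure to serve as the law of the next probe. *)
Lemma hitting_measure_sum D x : x \in D ->
  (\sum_(y <- boundary D) hitting_measure R D x y = 1)%E.
Proof.
move=> xD; rewrite /hitting_measure -nneseries_sum; last first.
  by move=> y n _; rewrite lee_fin srw_exit_at_ge0.
apply: cvg_lim => //; rewrite -cvg_shiftS/=.
rewrite (_ : (fun n => _) = (fun n => (1 - staying D n x)%:E)).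
  apply: cvg_EFin; first by near=> n.
  rewrite -[X in _ --> X](subr0 (1 : R)).
  by apply: cvgB; [exact: cvg_cst|exact: staying_cvg0].
apply/funext => n; rewrite big_mkord.
under eq_bigr do rewrite sumEFin.
rewrite sumEFin; congr (_%:E).
by rewrite -(@exit_staying D n x) ?addrK// inE/= xD.
Unshelve. all: by end_near. Qed.

Lemma hitting_measure_fin D x y : x \in D -> y \in boundary D ->
  hitting_measure R D x y \is a fin_num.
Proof.
move=> xD yb; rewrite ge0_fin_numE ?hitting_measure_ge0//.
apply: (@le_lt_trans _ _ 1%E); last exact: ltry.
rewrite -(hitting_measure_sum xD) (big_rem _ yb)/= leeDl// sume_ge0// => z _.
exact: hitting_measure_ge0.
Qed.

Lemma srw_exit_at_out D x y n : x \in closed D -> y \notin boundary D ->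
  srw_exit_at R D x y n = 0.
Proof.
move=> + yb; elim: n x => [|n IH] x xc.
  rewrite srw_exit_at0; case: eqP xc => [->|]; rewrite ?andbF// inE/= (negbTE yb) orbF.
  by move=> ->.
rewrite srw_exit_atS; case: ifP => // xD.
by rewrite -[RHS](spread_cst 0 x); apply: eq_spread => e; exact/IH/closed_step.
Qed.

Lemma hitting_measure_out D x y : x \in D -> y \notin boundary D ->
  hitting_measure R D x y = 0%E.
Proof.
move=> xD yb; rewrite /hitting_measure; apply: eseries0 => n _ _.
by rewrite srw_exit_at_out// inE/= xD.
Qed.

(** The walk may step to the missing neighbour at once. *)
Lemma hitting_measure_neighbor D x e : x \in D -> x + unit_step e \notin D ->
  (((2 * d)%:R^-1)%:E <= hitting_measure R D x (x + unit_step e))%E.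
Proof.
move=> xD xeD; apply: (@le_trans _ _ (srw_exit_at R D x (x + unit_step e) 1)%:E).
  rewrite srw_exit_atS xD lee_fin /spread (bigD1 e)//= srw_exit_at0 xeD eqxx mulrDr mulr1.
  by rewrite lerDl mulr_ge0// sumr_ge0// => f _; exact: srw_exit_at_ge0.
have : forall n : nat, (0 <= n)%N -> true -> (0 <= (srw_exit_at R D x (x + unit_step e) n)%:E)%E.
  by move=> n _ _; rewrite lee_fin srw_exit_at_ge0.
move=> /(nneseries_lim_ge 2); apply: le_trans.
by rewrite !big_nat_recr//= big_nil add0e leeDr// lee_fin srw_exit_at_ge0.
Qed.

End HittingMeasure.

(** * Counting probes and transferring limits from the chain *)

Section Chronicles.
Context (R : realType) (d : nat).
Variables (ask : state d -> bool) (aim : state d -> seq (site d * R)).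

Definition finitely_many_asks (x : nat -> state d) :=
  forall t, exists N, forall n, (N <= n)%N -> ~ (ask (x n) /\ (size (x n).1 <= t)%N).

(** A chain that only probes from some step on keeps its time fixed, and so would ask infinitely
    often at that time. *)
Lemma psrw_pathP x : chain_path (step ask aim) (start d) x ->
  finitely_many_asks x -> psrw_path ask aim x.
Proof.
move=> xP xa; split=> // n; apply: contrapT => nm.
have {}nm m : (n <= m)%N -> ask (x m).
  by move=> nm'; apply: contrapT => /negP am; apply: nm; exists m.
have xt k : size (x (n + k)%N).1 = size (x n).1.
  elim: k => [|k IH]; first by rewrite addn0.
  have := xP.2 (n + k)%N; rewrite /step nm ?leq_addr// addnS => /mapP[z /mapP[y _ ->] ->] /=.
  exact: IH.
have [N xN] := xa (size (x n).1).
apply: (xN (n + N)%N); rewrite ?leq_addl// xt; split=> //.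
by rewrite nm// leq_addr.
Qed.

Lemma time_le_step (x : nat -> state d) n :
  psrw_path ask aim x -> (size (x n).1 <= n)%N.
Proof.
move=> xP; elim: n => [|n IH]; first by case: xP => -[-> _].
by case: (step_cases xP n) => [[_ [y _ ->]]|[_ [e _ ->]]]/=;
  rewrite ?size_rcons ?ltnS// (leq_trans IH).
Qed.

Definition nprobes (s : state d) : nat := \sum_(o <- s.1) size o.2 + size s.2.2.

Lemma nprobes_probe s y : nprobes (probe s y) = (nprobes s).+1.
Proof. by rewrite /nprobes/= size_rcons addnS. Qed.

Lemma nprobes_move s y : nprobes (move s y) = nprobes s.
Proof. by rewrite /nprobes/= -cats1 big_cat/= big_seq1 addn0. Qed.

Section Transfer.
Context (T : Type) (X : nat -> T -> state d) (w : T).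
Hypothesis XP : forall w, psrw_path ask aim (X ^~ w).
Let K := walk ask X.
Let Q := probes ask X.

Lemma le_time_moment t : (t <= moment ask (X ^~ w) t)%N.
Proof. by rewrite -{1}(momentP (XP w) t).1; exact: time_le_step (XP w). Qed.

Lemma transient_of_chain N :
  (forall n, (N <= n)%N -> ~ (~~ ask (X n w) /\ pos (X n w) = 0)) -> transient K w.
Proof.
move=> XN /(_ N)[t Nt K0]; apply: (XN (moment ask (X ^~ w) t)).
  exact: leq_trans (le_time_moment t).
by split; [case: (momentP (XP w) t)|exact: K0].
Qed.

Lemma sum_probes t :
  (\sum_(0 <= s < t.+1) size (Q s w))%N = nprobes (X (moment ask (X ^~ w) t) w).
Proof.
rewrite (momentE XP) /nprobes/= -/K -/Q /past /mkseq big_map big_nat_recr//=.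
by rewrite /index_iota subn0.
Qed.

Lemma mean_probes_le (c : R) t : (0 < t)%N -> 
  (nprobes (X (moment ask (X ^~ w) t) w))%:R <= c * t%:R ->
  mean_probes R Q w t <= c.
Proof.
move=> t0 nc; rewrite /mean_probes ler_pdivrMl ?ltr0n// mulrC.
apply: le_trans nc; rewrite -sum_probes big_nat_recl//= natrD natr_sum.
by rewrite big_add1/= lerDr.
Qed.

Lemma mean_probes_ge (m : nat) t : (0 < t)%N ->
  (forall s, (m <= size (Q s w))%N) -> m%:R <= mean_probes R Q w t.
Proof.
move=> t0 mQ; rewrite /mean_probes ler_pdivlMl ?ltr0n// -natr_sum -natrM ler_nat.
have -> : (t * m = \sum_(1 <= s < t.+1) m)%N by rewrite sum_nat_const_nat subSS subn0.
by apply: leq_sum => s _; exact: mQ.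
Qed.

End Transfer.
End Chronicles.

Lemma limn_esup_le (R : realType) (u : nat -> R) (c : R) :
  (exists N, forall n, (N <= n)%N -> u n <= c) ->
  (limn_esup (fun n => (u n)%:E) <= c%:E)%E.
Proof.
move=> [N uN]; rewrite limn_esup_lim; apply: lime_le; first exact: is_cvg_esups.
exists N => // n /= Nn; apply: ge_ereal_sup => _ [m /= nm <-].
by rewrite lee_fin uN// (leq_trans Nn).
Qed.

Lemma limn_einf_ge (R : realType) (u : nat -> R) (c : R) :
  (exists N, forall n, (N <= n)%N -> c <= u n) ->
  (c%:E <= limn_einf (fun n => (u n)%:E))%E.
Proof.
move=> [N uN]; rewrite limn_einf_lim; apply: lime_ge; first exact: is_cvg_einfs.
exists N => // n /= Nn; apply: le_ereal_inf_tmp => _ [m /= nm <-].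
by rewrite lee_fin uN// (leq_trans Nn).
Qed.

(** * The greedy strategy for probes by hitting measure *)

Section Greedy.
Context (R : realType) (d : nat) (M : nat).
Hypothesis d0 : (0 < d)%N.
Implicit Types (s : state d) (y : site d).

Definition missing s : nat := #|[pred e : direction d | pos s + unit_step e \notin dom s]|.

(** When probing stops, all 2 d neighbours are open, so the walk moves as simple random walk on Z^d.
    The bound M forces the running average up. *)
Definition greedy_ask s : bool := (size s.2.2 < M)%N || (0 < missing s)%N.

Definition greedy_aim s : seq (site d * R) :=
  [seq (y, fine (hitting_measure R (dom s) (pos s) y)) | y <- boundary (dom s)].

Definition in_dom s : Prop := pos s \in dom s.

Let ask := greedy_ask.
Let nxt := step ask greedy_aim.

Let dR0 : (2 * d)%:R != 0 :> R.
Proof. by rewrite pnatr_eq0 muln_eq0 -lt0n d0. Qed.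

Let dRgt0 : 0 < (2 * d)%:R :> R.
Proof. by rewrite lt0r dR0/= ler0n. Qed.

Lemma missing0 s e : missing s = 0%N -> pos s + unit_step e \in dom s.
Proof.
by move=> /card0_eq/(_ e); rewrite -!topredE/= => /negbFE.
Qed.

Lemma missing_le s : (missing s <= 2 * d)%N.
Proof. by rewrite -card_direction; exact: max_card. Qed.

Lemma ask_missing s : ~~ ask s -> missing s = 0%N.
Proof. by rewrite /ask /greedy_ask negb_or -!leqNgt leqn0 => /andP[_ /eqP]. Qed.

Lemma ask_count s : ~~ ask s -> (M <= size s.2.2)%N.
Proof. by rewrite /ask /greedy_ask negb_or -leqNgt => /andP[]. Qed.

Lemma nopen_all s : missing s = 0%N -> nopen (dom s) (pos s) = (2 * d)%N.
Proof.
move=> s0; rewrite /nopen -card_direction; apply: eq_card => e.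
by rewrite -!topredE/= missing0.
Qed.

Lemma fine_hitting_sum s : in_dom s ->
  \sum_(y <- boundary (dom s)) fine (hitting_measure R (dom s) (pos s) y) = 1.
Proof.
move=> si; apply: EFin_inj; rewrite -sumEFin -(hitting_measure_sum R d0 si).
rewrite big_seq [RHS]big_seq; apply: eq_bigr => y yb.
by rewrite fineK// hitting_measure_fin.
Qed.

Lemma greedy_stochastic : stochastic_on nxt in_dom.
Proof.
move=> s si; rewrite /nxt /step; case: ifPn => sa; split.
- apply/allP => z /mapP[u /mapP[y _ ->] ->] /=.
  by rewrite fine_ge0// hitting_measure_ge0.
- by rewrite /mass /greedy_aim !big_map/= fine_hitting_sum.
- move=> _ /mapP[z /mapP[u _ ->] ->]; rewrite /in_dom dom_probe.
  by rewrite mem_rcons in_cons orbC; move: si; rewrite /in_dom => ->.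
- by apply/allP => z /mapP[e _ ->] /=; rewrite invr_ge0.
- rewrite /mass big_map/= big_enum/= sumr_const -/(nopen _ _) nopen_all ?ask_missing//.
  by rewrite -[_ *+ _]mulr_natl divff.
- move=> _ /mapP[z /mapP[e + ->] ->]; rewrite mem_enum -topredE /in_dom dom_move.
  by [].
Qed.

Lemma in_dom_start : in_dom (start d).
Proof. by rewrite /in_dom /dom /domain/= inE. Qed.

Lemma average_open V s : ~~ ask s ->
  average nxt V s = spread (fun y => V (move s y)) (pos s).
Proof.
move=> sa; rewrite /average /nxt /step (negbTE sa) big_map big_enum/=.
rewrite nopen_all ?ask_missing// -mulr_sumr; congr (_ * _).
by apply: eq_bigl => e; rewrite -topredE/= missing0// ask_missing.
Qed.

Lemma average_ask V s (c : R) : in_dom s -> ask s ->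
  (forall y, y \in boundary (dom s) -> V (probe s y) <= c) -> average nxt V s <= c.
Proof.
move=> si sa Vc; rewrite /average /nxt /step sa /greedy_aim !big_map/=.
rewrite -[leRHS]mul1r -(fine_hitting_sum si) mulr_suml big_seq [leRHS]big_seq.
apply: ler_sum => y yb; rewrite ler_wpM2l ?Vc//.
by rewrite fine_ge0// hitting_measure_ge0.
Qed.

(** The missing neighbour carries hitting mass at least 1 / (2 d), so a gain g there lowers the mean
    by at least g / (2 d). *)
Lemma average_ask_gain V s (c g : R) e : in_dom s -> ask s ->
  pos s + unit_step e \notin dom s -> 0 <= g ->
  (forall y, y \in boundary (dom s) -> V (probe s y) <= c) ->
  V (probe s (pos s + unit_step e)) <= c - g ->
  average nxt V s <= c - (2 * d)%:R^-1 * g.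
Proof.
move=> si sa es g0 Vc Ve; set y := pos s + unit_step e in es Ve.
have yb : y \in boundary (dom s) by exact: step_boundary si es.
have h0 z : 0 <= fine (hitting_measure R (dom s) (pos s) z).
  by rewrite fine_ge0// hitting_measure_ge0.
have hy : (2 * d)%:R^-1 <= fine (hitting_measure R (dom s) (pos s) y).
  rewrite -lee_fin fineK ?hitting_measure_fin//.
  exact: hitting_measure_neighbor.
rewrite /average /nxt /step sa /greedy_aim !big_map/=.
rewrite [X in X - _](_ : c = \sum_(z <- boundary (dom s))
    fine (hitting_measure R (dom s) (pos s) z) * c); last first.
  by rewrite -mulr_suml fine_hitting_sum ?mul1r.
rewrite !(bigD1_seq y)/= ?undup_uniq// addrAC; apply: lerD.
  apply: le_trans (ler_wpM2l (h0 y) Ve) _.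
  by rewrite mulrBr lerD2l lerN2 ler_wpM2r.
rewrite big_seq_cond [leRHS]big_seq_cond; apply: ler_sum => z /andP[zb _].
by rewrite ler_wpM2l// Vc.
Qed.

Lemma missing_probe s y : (missing (probe s y) <= missing s)%N.
Proof.
apply/subset_leq_card/fintype.subsetP => e; rewrite -!topredE/= dom_probe mem_rcons.
by rewrite in_cons negb_or => /andP[].
Qed.

Lemma missing_probe_step s e : pos s + unit_step e \notin dom s ->
  (missing (probe s (pos s + unit_step e)) < missing s)%N.
Proof.
move=> es; rewrite /missing; apply: proper_card; apply/fintype.properP; split.
  apply/fintype.subsetP => e'; rewrite -!topredE/= dom_probe mem_rcons.
  by rewrite in_cons negb_or => /andP[].
by exists e; rewrite -!topredE//= dom_probe mem_rcons in_cons eqxx.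
Qed.

Lemma missing_ex s : (0 < missing s)%N -> exists e, pos s + unit_step e \notin dom s.
Proof. by move=> /card_gt0P[e es]; exists e; rewrite -topredE in es. Qed.

Let missing_move s y : (missing (move s y) <= 2 * d)%N.
Proof. exact: missing_le. Qed.

Section Chain.
Context (disp : measure_display) (T : measurableType disp) (P : probability T R).
Variable X : nat -> T -> state d.
Hypothesis PX : chain_law nxt (start d) P X.

(** The function V bounds the expected number of probes still to come up to time t, with 2 d for
    each missing neighbour and for each probe still due to reach M. *)
Lemma greedy_finitely_many_asks :
  {ae P, forall w, finitely_many_asks ask (X ^~ w)}.
Proof.
apply: ae_foralln => t.
(* The largest cost of one new time, at which all 2 d neighbours may be missing and M probes are
   due. *)
pose k : R := (2 * d)%:R * (2 * d + M)%:R.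
pose V s : R := if (size s.1 <= t)%N then
  (t - size s.1)%:R * k + (2 * d)%:R * (missing s + (M - size s.2.2))%:R else 0.
have V0 s : 0 <= V s.
  by rewrite /V; case: ifP => // _; rewrite addr_ge0 ?mulr_ge0.
have Vmove s y : V (move s y) <= V s.
  rewrite /V /= size_rcons; case: (ltnP (size s.1) t) => [st|]; last first.
    by case: ifP => // _ _; rewrite addr_ge0 ?mulr_ge0.
  rewrite (ltnW st) subn0 -(subnSK st) -natr1 mulrDl mul1r -addrA lerD2l.
  apply: (@le_trans _ _ k); last by rewrite lerDl mulr_ge0.
  by rewrite /k ler_wpM2l// ler_nat leq_add2r missing_le.
have Vprobe s y : V (probe s y) <= V s.
  rewrite /V /=; case: ifP => // _; rewrite lerD2l ler_wpM2l// ler_nat.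
  by rewrite leq_add ?missing_probe// leq_sub2l// size_rcons.
apply: (@lyapunov_finite _ _ nxt (start d) in_dom in_dom_start greedy_stochastic
  _ _ _ X PX V (fun s => ask s /\ (size s.1 <= t)%N)) => // s si.
case: (boolP (ask s)) => sa; last first.
  rewrite asboolF; last by case.
  rewrite addr0 average_open// -(spread_cst d0 (V s) (pos s)).
  by apply: le_spread => e; exact: Vmove.
have [st|st] := leqP (size s.1) t; last first.
  rewrite asboolF; last by case.
  by rewrite addr0; apply: average_ask => // y _; exact: Vprobe.
rewrite asboolT// -lerBrDr.
have [|s0] := posnP (missing s); last first.
  have [e es] := missing_ex s0; have := missing_probe_step es => lt_e.
  rewrite -[X in _ - X](mulVf dR0); apply: (average_ask_gain si sa es) => //.
  rewrite /V /= st lerBrDr -addrA lerD2l -[X in _ + X]mulr1 -mulrDr ler_wpM2l//.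
  rewrite natr1 ler_nat -addSn leq_add// leq_sub2l// size_rcons.
  by [].
move=> s0; move: (sa); rewrite /ask /greedy_ask s0 orbF => sM.
apply: average_ask => // y _; rewrite lerBrDr /V /= st -addrA lerD2l.
apply: (@le_trans _ _ ((2 * d)%:R * (missing (probe s y) + (M - size (rcons s.2.2 y))).+1%:R)).
  by rewrite -[X in _ <= _ * X]natr1 mulrDr mulr1 lerD2l ler1n muln_gt0.
rewrite ler_wpM2l// ler_nat -addnS leq_add ?missing_probe//.
by rewrite size_rcons subnSK.
Qed.

End Chain.
End Greedy.

(** * The running average of the greedy strategy *)

Section GreedyMean.
Context (R : realType) (d : nat) (M : nat).
Hypothesis d0 : (0 < d)%N.
Implicit Types (s : state d) (y : site d).

Let ask := @greedy_ask d M.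
Let nxt := step ask (@greedy_aim R d).

Let dRgt0 : 0 < (2 * d)%:R :> R.
Proof. by rewrite ltr0n muln_gt0. Qed.

Variables A B : R.
Hypothesis A_gt1 : 1 < A.
Hypothesis AE : A * (1 - (2 * d)%:R^-1 / 2) = 1.
Hypothesis BE : B = 2 * 2 ^+ (2 * d) * A ^+ M.

Let A_ge1 : 1 <= A. Proof. exact: ltW. Qed.
Let A_gt0 : 0 < A. Proof. exact: lt_trans ltr01 A_gt1. Qed.
Let B_gt0 : 0 < B. Proof. by rewrite BE !mulr_gt0// exprn_gt0. Qed.

(** An exponential supermartingale. While a neighbour is missing, a probe multiplies W by at most A,
    and by at most A / 2 with probability at least 1 / (2 d); [AE] says that these balance. A move
    may restore the factor 2 ^ (2 d) A ^ M, and B pays for it with a factor 2 to spare. *)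
Let W s : R := A ^+ (nprobes s + (M - size s.2.2)) * 2 ^+ missing s / B ^+ size s.1.

Let W_gt0 s : 0 < W s.
Proof. by rewrite /W divr_gt0 ?mulr_gt0// exprn_gt0. Qed.

Let W_move s y : ~~ ask s -> W (move s y) <= W s / 2.
Proof.
move=> sa; rewrite /W nprobes_move/= size_rcons (ask_missing sa) expr0 mulr1 subn0.
have /eqP -> : (M - size s.2.2 == 0)%N by rewrite subn_eq0 (ask_count sa).
rewrite addn0 exprD exprS invfM.
have E (a b c x y' : R) : a * b * c * (x * y') = a * y' * (b * c * x) by ring.
rewrite E ler_wpM2l ?divr_ge0 ?exprn_ge0 ?(ltW A_gt0) ?(ltW B_gt0)//.
rewrite ler_pdivrMr// BE !mulrA mulVf// mul1r mulrC.
by rewrite ler_wpM2r ?exprn_ge0 ?(ltW A_gt0)// ler_weXn2l ?missing_le ?ler1n.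
Qed.

Let W_probe s y : W (probe s y) <= A * W s.
Proof.
rewrite /W nprobes_probe/= size_rcons !mulrA ler_wpM2r ?invr_ge0 ?exprn_ge0 ?(ltW B_gt0)//.
apply: ler_pM; rewrite ?exprn_ge0 ?(ltW A_gt0)//.
  by rewrite -exprS ler_weXn2l// addSn ltnS leq_add2l leq_sub2l.
by rewrite ler_weXn2l ?ler1n ?missing_probe.
Qed.

Let W_probe_step s e : pos s + unit_step e \notin dom s ->
  W (probe s (pos s + unit_step e)) <= A * W s - A * W s / 2.
Proof.
move=> es; have -> : A * W s - A * W s / 2 = A * W s / 2.
  by rewrite -[X in X - _]mulr1 -mulrBr; congr (_ * _); lra.
rewrite /W nprobes_probe/= size_rcons.
have -> : A * (A ^+ (nprobes s + (M - size s.2.2)) * 2 ^+ missing s / B ^+ size s.1) / 2 =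
  A ^+ (nprobes s + (M - size s.2.2)).+1 * (2 ^+ missing s / 2) / B ^+ size s.1.
  by rewrite exprS !mulrA -!(mulrAC _ 2^-1).
rewrite ler_wpM2r ?invr_ge0 ?exprn_ge0 ?(ltW B_gt0)//.
apply: ler_pM; rewrite ?exprn_ge0 ?(ltW A_gt0)//.
  by rewrite ler_weXn2l// addSn ltnS leq_add2l leq_sub2l.
rewrite ler_pdivlMr// -exprSr ler_weXn2l ?ler1n//.
exact: missing_probe_step.
Qed.

Let W_probe_count s y : missing s = 0%N -> (size s.2.2 < M)%N -> W (probe s y) <= W s.
Proof.
move=> s0 sM; rewrite /W nprobes_probe/= size_rcons.
rewrite ler_wpM2r ?invr_ge0 ?exprn_ge0 ?(ltW B_gt0)//.
have := missing_probe s y; rewrite s0 leqn0 => /eqP ->.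
by rewrite addSn -addnS subnSK.
Qed.

Let W_ask s : in_dom s -> ask s -> average nxt W s <= W s.
Proof.
move=> si sa; have [s0|] := posnP (missing s).
  apply: average_ask => // y _; apply: W_probe_count => //.
  by move: sa; rewrite /ask /greedy_ask s0 orbF.
move=> /missing_ex[e es].
have := average_ask_gain (V := W) (c := A * W s) (g := A * W s / 2) d0 si sa es.
have -> : A * W s - (2 * d)%:R^-1 * (A * W s / 2) =
    A * (1 - (2 * d)%:R^-1 / 2) * W s.
  by move: (W s) ((2 * d)%:R^-1) => x q; ring.
rewrite AE mul1r; apply.
- by rewrite divr_ge0// mulr_ge0// ltW.
- by move=> y _; exact: W_probe.
- exact: W_probe_step.
Qed.

Section Chain.
Context (disp : measure_display) (T : measurableType disp) (P : probability T R).
Variable X : nat -> T -> state d.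
Hypothesis PX : chain_law nxt (start d) P X.
Hypothesis XP : forall w, psrw_path ask (@greedy_aim R d) (X ^~ w).

(** At a move W equals A ^ nprobes / B ^ time and is at least halved on average, so 2 W can pay one
    unit whenever W is at least 1. *)
Lemma greedy_exponential_bound : {ae P, forall w, exists N, forall n, (N <= n)%N ->
  ~ (~~ ask (X n w) /\ B ^+ size (X n w).1 <= A ^+ nprobes (X n w))}.
Proof.
apply: (@lyapunov_finite _ _ nxt (start d) (@in_dom d) (in_dom_start d)
  (@greedy_stochastic R d M d0) _ _ _ X PX (fun s => 2 * W s)
  (fun s => ~~ ask s /\ B ^+ size s.1 <= A ^+ nprobes s)) => s si.
  by rewrite mulr_ge0// ltW.
have [sa|/negP sa] := pselect (is_true (ask s)).
  rewrite asboolF; last by case=> /negP.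
  rewrite addr0 (_ : average _ _ _ = 2 * average nxt W s).
    by rewrite ler_wpM2l// W_ask.
  by rewrite /average mulr_sumr; apply: eq_bigr => z _; rewrite mulrCA.
rewrite average_open// spreadZ.
have : spread (fun y => W (move s y)) (pos s) <= W s / 2.
  rewrite -[leRHS](spread_cst d0 _ (pos s)); apply: le_spread => e.
  exact: W_move.
rewrite -(ler_pM2l (_ : 0 < 2 :> R))// => /le_trans h.
have B1 : (`[< ~~ ask s /\ B ^+ size s.1 <= A ^+ nprobes s >])%:R <= W s.
  case: asboolP => [[_ BA]|_]; last exact: ltW.
  rewrite /W (ask_missing sa) expr0 mulr1.
  have /eqP -> : (M - size s.2.2 == 0)%N by rewrite subn_eq0 (ask_count sa).
  by rewrite addn0 ler_pdivlMr ?exprn_gt0// mul1r.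
apply: le_trans (lerD (h _ (lexx _)) B1) _.
by move: (W s) => x; lra.
Qed.

End Chain.
End GreedyMean.

(** Bernoulli's inequality. *)
Lemma exprn_unbounded (R : realType) (A B : R) : 1 < A -> exists c : nat, B <= A ^+ c.
Proof.
move=> A1; have bern n : 1 + n%:R * (A - 1) <= A ^+ n.
  elim: n => [|n IH]; first by rewrite mul0r addr0 expr0.
  rewrite exprSr; apply: le_trans (ler_wpM2r (ltW (lt_trans ltr01 A1)) IH).
  rewrite -natr1; have : 0 <= n%:R * (A - 1) * (A - 1) by rewrite !mulr_ge0// subr_ge0 ltW.
  by move: (n%:R : R) => x; nra.
exists (Num.bound `|B / (A - 1)|); apply: le_trans (bern _).
rewrite -lerBlDl -ler_pdivrMr ?subr_gt0//.
apply: le_trans (ltW (archi_boundP (normr_ge0 _))).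
apply: le_trans (ler_norm _); rewrite ler_pM2r ?invr_gt0 ?subr_gt0//; lra.
Qed.

Section GreedyExists.
Context (R : realType) (d : nat) (M : nat).
Hypothesis d0 : (0 < d)%N.

Let ask := @greedy_ask d M.
Let aim := @greedy_aim R d.

Lemma greedy_chain : exists (disp : measure_display) (T : measurableType disp)
    (P : probability T R) (X : nat -> T -> state d),
  chain_law (step ask aim) (start d) P X /\ forall w, psrw_path ask aim (X ^~ w).
Proof.
have [|disp [T [P [X [PX Xp]]]]] := chain_exists (in_dom_start d)
    (@greedy_stochastic R d M d0) (G := @finitely_many_asks d ask).
  by move=> disp T P X PX; exact: greedy_finitely_many_asks PX.
by exists disp, T, P, X; split=> // w; have [xp xa] := Xp w; exact: psrw_pathP.
Qed.

Section Chain.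
Context (disp : measure_display) (T : measurableType disp) (P : probability T R).
Variable X : nat -> T -> state d.
Hypothesis PX : chain_law (step ask aim) (start d) P X.
Hypothesis XP : forall w, psrw_path ask aim (X ^~ w).

Lemma greedy_psrw : is_psrw P (walk ask X) (probes ask X).
Proof. exact: (psrw_of_chain PX XP). Qed.

Lemma greedy_hitting : probes_by_hitting_measure P (walk ask X) (probes ask X).
Proof.
apply: (hitting_of_chain (in_dom_start d) (@greedy_stochastic R d M d0)) => //.
move=> s si sa y; rewrite /aimed /aim /greedy_aim big_map/=.
have [yb|yb] := boolP (y \in boundary (dom s)).
  rewrite -big_filter (eq_in_filter (a2 := pred1 y)) //.
  by rewrite filter_pred1_uniq ?undup_uniq// big_seq1 fineK// hitting_measure_fin.
rewrite hitting_measure_out// big_seq_cond big1// => z /andP[zb /eqP zy].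
by rewrite -zy zb in yb.
Qed.

Lemma greedy_mean_ge w t : (0 < t)%N -> M%:R <= mean_probes R (probes ask X) w t.
Proof.
move=> t0; apply: mean_probes_ge => // s.
by have := ask_full XP s w => /ask_count.
Qed.

End Chain.

Lemma greedy_limsup : exists c : R,
  forall (disp : measure_display) (T : measurableType disp) (P : probability T R)
    (X : nat -> T -> state d),
  chain_law (step ask aim) (start d) P X -> (forall w, psrw_path ask aim (X ^~ w)) ->
  {ae P, forall w,
    (limn_esup (fun t => (mean_probes R (probes ask X) w t)%:E) < c%:E)%E}.
Proof.
have q0 : 0 < (2 * d)%:R^-1 :> R by rewrite invr_gt0 ltr0n muln_gt0.
have q1 : (2 * d)%:R^-1 <= 1 :> R by rewrite invf_le1// ?ler1n ?ltr0n muln_gt0.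
pose rho : R := 1 - (2 * d)%:R^-1 / 2.
have r0 : 0 < rho by rewrite /rho; lra.
have r1 : rho < 1 by rewrite /rho; lra.
have A1 : 1 < rho^-1 by rewrite invf_gt1.
have AE : rho^-1 * rho = 1 by rewrite mulVf// gt_eqF.
have [c Bc] := exprn_unbounded (2 * 2 ^+ (2 * d) * rho^-1 ^+ M) A1.
(* Eventually A ^ nprobes < B ^ t <= A ^ (c t), so nprobes is at most c t; the additional 1 makes
   the inequality for the limsup strict. *)
exists (c.+1)%:R => disp T P X PX XP.
have := greedy_exponential_bound d0 A1 AE erefl PX.
apply: filterS => w [N XN].
apply: (@le_lt_trans _ _ (c%:R)%:E); last by rewrite lte_fin ltr_nat.
apply: limn_esup_le; exists (maxn N 1) => t; rewrite geq_max => /andP[Nt t0].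
apply: (mean_probes_le XP) => //; have [mt am] := momentP (XP w) t.
rewrite -natrM ler_nat leqNgt; apply/negP => ct.
have := XN (moment ask (X ^~ w) t); apply.
  exact: leq_trans (le_time_moment w XP t).
split=> //; rewrite mt; apply: (@le_trans _ _ (rho^-1 ^+ c ^+ t)).
  have A0 : 0 <= rho^-1 by rewrite invr_ge0 ltW.
  by apply: lerXn2r => //; rewrite nnegrE ?mulr_ge0// exprn_ge0.
by rewrite -exprM; apply: ler_weXn2l; [exact: ltW|exact: ltnW].
Qed.

End GreedyExists.

(** * A superharmonic function on Z^3 and transience for d >= 3 *)

Section InverseNorm.
Context (R : realType).
Implicit Types (a b c s t v w : R).

Definition invsqrt_bound v : R := 1 - v / 2 + 3 / 8 * v ^+ 2 - 5 / 16 * v ^+ 3 + v ^+ 4.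

(* The fourth-order coefficient of the Taylor polynomial of (1 + v)^(-1/2) is
   35/128; taking 1 instead makes it an upper bound near 0. *)
Lemma invsqrt_le_bound v : -1 / 2 <= v <= 1 / 2 -> (Num.sqrt (1 + v))^-1 <= invsqrt_bound v.
Proof.
move=> /andP[v1 v2].
have vv : v ^+ 2 <= 1 / 4 by nra.
have vv0 : 0 <= v ^+ 2 by exact: sqr_ge0.
have v4 : 0 <= v ^+ 4 by rewrite (exprM v 2 2) sqr_ge0.
have P0 : 0 < invsqrt_bound v.
  have : - (1 / 8) <= v ^+ 3 <= 1 / 8.
    by rewrite (exprD v 2 1) expr1; apply/andP; split; nra.
  by rewrite /invsqrt_bound => /andP[]; lra.
have s0 : 0 < 1 + v by lra.
rewrite -(ler_pM2r (_ : 0 < Num.sqrt (1 + v))) ?sqrtr_gt0// mulVf; last first.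
  by rewrite gt_eqF// sqrtr_gt0.
have -> : invsqrt_bound v = Num.sqrt (invsqrt_bound v ^+ 2) by rewrite sqrtr_sqr gtr0_norm.
rewrite -sqrtrM ?sqr_ge0// -[leLHS]sqrtr1 ler_wsqrtr//.
(* The square of the bound times 1 + v equals 1 + v ^ 4 q, where q is this polynomial. *)
have q0 : 0 <= 93 / 64 + 39 / 32 * v - 99 / 256 * v ^+ 2 + 57 / 256 * v ^+ 3
    + 3 / 8 * v ^+ 4 + v ^+ 5.
  have : - (1 / 8) <= v ^+ 3.
    by rewrite (exprD v 2 1) expr1; nra.
  have : - (1 / 32) <= v ^+ 5.
    have : v ^+ 4 <= 1 / 16 by rewrite (exprM v 2 2); nra.
    by rewrite (exprD v 4 1) expr1; nra.
  by lra.
have := mulr_ge0 v4 q0; rewrite /invsqrt_bound; nra.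
Qed.

(** A bounded substitute for the Newtonian potential 1 / |x| on Z^3, with s = |x| ^ 2. The shift by
    12 makes it superharmonic at every site, near the origin too. *)
Definition potential3 s : R := (Num.sqrt (s + 12))^-1.

Definition potential3_pair a s : R := potential3 (s + 1 + 2 * a) + potential3 (s + 1 - 2 * a).

Let pair_le a s : a ^+ 2 <= s -> potential3_pair a s <= potential3 s *
  (invsqrt_bound ((1 + 2 * a) / (s + 12)) + invsqrt_bound ((1 - 2 * a) / (s + 12))).
Proof.
move=> as'; have s0 : 0 < s + 12 by have := sqr_ge0 a; lra.
have H u : `|u| <= 2 * `|a| -> potential3 (s + 1 + u) <=
    potential3 s * invsqrt_bound ((1 + u) / (s + 12)).
  move=> ua; have bnd : -1 / 2 <= (1 + u) / (s + 12) <= 1 / 2.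
    have : `|a| ^+ 2 <= s by rewrite real_normK ?num_real.
    move: ua; rewrite ler_norml => /andP[]; set n := `|a| => u1 u2 n2.
    have : 0 <= (n - 2) ^+ 2 by exact: sqr_ge0.
    rewrite (_ : (n - 2) ^+ 2 = n ^+ 2 - 4 * n + 4); last by ring.
    by move=> h; apply/andP; split; [rewrite ler_pdivlMr//|rewrite ler_pdivrMr//]; lra.
  rewrite /potential3 (_ : s + 1 + u + 12 = (s + 12) * (1 + (1 + u) / (s + 12))).
    rewrite sqrtrM ?(ltW s0)// invfM ler_wpM2l ?invr_ge0 ?sqrtr_ge0//.
    exact: invsqrt_le_bound.
  by field; rewrite gt_eqF.
rewrite mulrDr; apply: lerD; [apply: H|rewrite -mulrN; apply: H].
  by rewrite normrM ger0_norm.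
by rewrite mulrN normrN normrM ger0_norm.
Qed.

(** With w = 1 / (s + 12), the terms of order w cancel, as for 1 / |x| in dimension three. The shift
    leaves - 36 w ^ 2, against at most (9/4 + 32) w ^ 2 from the other terms. *)
Lemma potential3_superharmonic a b c s : s = a ^+ 2 + b ^+ 2 + c ^+ 2 ->
  potential3_pair a s + potential3_pair b s + potential3_pair c s <= 6 * potential3 s.
Proof.
move=> sE; have [a0 b0 c0] : [/\ 0 <= a ^+ 2, 0 <= b ^+ 2 & 0 <= c ^+ 2].
  by split; exact: sqr_ge0.
apply: (le_trans (lerD (lerD (pair_le (a := a) _) (pair_le (a := b) _)) (pair_le (a := c) _))); try lra.
rewrite -!mulrDr mulrC ler_wpM2r ?invr_ge0 ?sqrtr_ge0//.
have s12 : 0 < s + 12 by lra.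
set w := (s + 12)^-1.
have w0 : 0 < w by rewrite invr_gt0.
have w1 : w <= 1 / 12 by rewrite /w div1r lef_pV2 ?posrE//; lra.
have sw : s * w = 1 - 12 * w by rewrite /w; field; rewrite gt_eqF.
have tE x : invsqrt_bound ((1 + 2 * x) * w) + invsqrt_bound ((1 - 2 * x) * w) =
    2 - w + 3 / 8 * (2 + 8 * x ^+ 2) * w ^+ 2 - 5 / 16 * (2 + 24 * x ^+ 2) * w ^+ 3 +
    (2 + 48 * x ^+ 2 + 32 * x ^+ 4) * w ^+ 4.
  by rewrite /invsqrt_bound; field.
rewrite !tE.
have x4 : a ^+ 4 + b ^+ 4 + c ^+ 4 <= s ^+ 2.
  by rewrite sE !(exprM _ 2 2); move: a0 b0 c0; nra.
have w20 : 0 <= w ^+ 2 by exact: sqr_ge0.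
have w4 : (a ^+ 4 + b ^+ 4 + c ^+ 4) * w ^+ 4 <= (1 - 12 * w) ^+ 2 * w ^+ 2.
  rewrite -sw exprMn -mulrA -exprD ler_wpM2r//.
  by rewrite (exprM w 2 2) sqr_ge0.
have w3 : 0 <= (6 + 24 * s) * w ^+ 3.
  by rewrite mulr_ge0 ?exprn_ge0 ?(ltW w0)//; lra.
have -> : 2 - w + 3 / 8 * (2 + 8 * a ^+ 2) * w ^+ 2 - 5 / 16 * (2 + 24 * a ^+ 2) * w ^+ 3 +
    (2 + 48 * a ^+ 2 + 32 * a ^+ 4) * w ^+ 4 +
   (2 - w + 3 / 8 * (2 + 8 * b ^+ 2) * w ^+ 2 - 5 / 16 * (2 + 24 * b ^+ 2) * w ^+ 3 +
    (2 + 48 * b ^+ 2 + 32 * b ^+ 4) * w ^+ 4) +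
   (2 - w + 3 / 8 * (2 + 8 * c ^+ 2) * w ^+ 2 - 5 / 16 * (2 + 24 * c ^+ 2) * w ^+ 3 +
    (2 + 48 * c ^+ 2 + 32 * c ^+ 4) * w ^+ 4) =
   6 - 3 * w + 3 * (s * w) * w + 9 / 4 * w ^+ 2 - 5 / 16 * ((6 + 24 * s) * w ^+ 3) +
   (6 * w ^+ 4 + 48 * (s * w) * w ^+ 3) + 32 * ((a ^+ 4 + b ^+ 4 + c ^+ 4) * w ^+ 4).
  by rewrite sE; field.
rewrite sw.
have : 6 * w ^+ 4 + 48 * (1 - 12 * w) * w ^+ 3 + 32 * ((1 - 12 * w) ^+ 2 * w ^+ 2) <= 32 * w ^+ 2.
  have -> : 6 * w ^+ 4 + 48 * (1 - 12 * w) * w ^+ 3 + 32 * ((1 - 12 * w) ^+ 2 * w ^+ 2) =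
     (32 - w * (720 - 4038 * w)) * w ^+ 2 by ring.
  by rewrite ler_wpM2r//; nra.
have -> : 6 - 3 * w + 3 * (1 - 12 * w) * w = 6 - 36 * w ^+ 2 by ring.
move: w4 w3; set z := _ * w ^+ 4; set z' := _ * w ^+ 3; lra.
Qed.

Lemma potential3_decreasing : potential3 1 < potential3 0.
Proof.
by rewrite /potential3 ltf_pV2 ?posrE ?sqrtr_gt0// ltr_sqrt; lra.
Qed.

Lemma potential3_ge0 s : 0 <= potential3 s.
Proof. by rewrite invr_ge0 sqrtr_ge0. Qed.

End InverseNorm.

Section Transience.
Context (R : realType) (d' M : nat).
Let d := d'.+3.
Implicit Types (x : site d).

Let i0 : 'I_d := ord0.
Let i1 : 'I_d := lift ord0 ord0.
Let i2 : 'I_d := lift ord0 (lift ord0 ord0).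

Let coord x i : R := (x 0 i)%:~R.
Let sq3 x : R := coord x i0 ^+ 2 + coord x i1 ^+ 2 + coord x i2 ^+ 2.

(* Superharmonic on Z^d because it only depends on a projection to Z^3. *)
Let f x : R := potential3 (sq3 x).

Let coord_step x i b j :
  coord (x + unit_step (i, b)) j = coord x j + (-1) ^+ b * (j == i)%:R.
Proof.
by rewrite /coord mxE unit_stepE rmorphD rmorphM rmorphXn rmorphN1 rmorph_nat.
Qed.

(** Steps along the other d' axes leave f unchanged. At the origin the six remaining neighbours all
    have [sq3] equal to 1, whence a strict loss that pays for the visit. *)
Let sum_pairs x : \sum_(e : direction d) f (x + unit_step e) <=
  (2 * d)%:R * f x - 6 * (f x - potential3 (sq3 x + 1)) * (x == 0)%:R.
Proof.
rewrite sum_direction !big_ord_recl/= -/i0 -/i1 -/i2.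
set S3 := \sum_(i < d') _.
have -> : S3 = (2 * d')%:R * f x.
  rewrite /S3 (eq_bigr (fun=> f x *+ 2)).
    by rewrite sumr_const card_ord -mulrnA mulr_natl.
  by move=> i _; rewrite /f /sq3 !coord_step/= !mulr0 !addr0 mulr2n.
have E i b : i \in [:: i0; i1; i2] -> f (x + unit_step (i, b)) =
    potential3 (sq3 x + 1 + (-1) ^+ b * 2 * coord x i).
  rewrite !inE => /or3P[]/eqP->; rewrite /f /sq3 !coord_step/= !mulr0 !addr0 mulr1;
    congr potential3; case: b; rewrite ?expr1 ?expr0; ring.
rewrite !E ?inE ?eqxx ?orbT// expr1 expr0 !mul1r !mulN1r !mulNr.
have := @potential3_superharmonic R (coord x i0) (coord x i1) (coord x i2) (sq3 x) erefl.
rewrite /potential3_pair.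
have -> : (2 * d)%:R = 6 + (2 * d')%:R :> R by rewrite -natrD; congr (_%:R); rewrite /d; lia.
rewrite [X in _ <= X - _]mulrDl.
have [->|_] := eqVneq x 0; last by rewrite mulr0 subr0 -/(f x); lra.
by rewrite /coord !mxE !mulr0 !subr0 !addr0 mulr1 -/(f 0) => _; lra.
Qed.

Let delta : R := (2 * d)%:R^-1 * (6 * (potential3 0 - potential3 1)).

Let delta_gt0 : 0 < delta.
Proof.
by rewrite /delta !mulr_gt0 ?invr_gt0 ?ltr0n ?muln_gt0// subr_gt0 potential3_decreasing.
Qed.

Let spread_f x : spread f x <= f x - delta * (x == 0)%:R.
Proof.
have d0 : (2 * d)%:R != 0 :> R by rewrite pnatr_eq0.
apply: le_trans (ler_wpM2l _ (sum_pairs x)) _; first by rewrite invr_ge0.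
rewrite mulrBr mulKf// lerD2l lerN2 /delta.
have [->|_] := eqVneq x 0; last by rewrite !mulr0.
by rewrite /f /sq3 /coord !mxE expr0n/= !addr0 add0r !mulr1.
Qed.

Variables (disp : measure_display) (T : measurableType disp) (P : probability T R).
Variable X : nat -> T -> state d.
Hypothesis PX : chain_law (step (@greedy_ask d M) (@greedy_aim R d)) (start d) P X.
Hypothesis XP : forall w, psrw_path (@greedy_ask d M) (@greedy_aim R d) (X ^~ w).

Lemma greedy_transient : {ae P, forall w, transient (walk (@greedy_ask d M) X) w}.
Proof.
have d0 : (0 < d)%N by [].
suff : {ae P, forall w, exists N, forall n, (N <= n)%N ->
    ~ (~~ greedy_ask M (X n w) /\ pos (X n w) = 0)}.
  by apply: filterS => w [N XN]; exact: (transient_of_chain XP XN).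
pose V s := delta^-1 * f (pos s).
apply: (lyapunov_finite (in_dom_start d) (@greedy_stochastic R d M d0) PX (V := V)
  (B := fun s => ~~ greedy_ask M s /\ pos s = 0)) => s si.
  by rewrite /V mulr_ge0 ?invr_ge0 ?(ltW delta_gt0)// potential3_ge0.
have [sa|/negP sa] := pselect (is_true (greedy_ask M s)).
  rewrite asboolF ?addr0; last by case=> /negP.
  by apply: average_ask.
rewrite average_open// spreadZ /V -lerBrDr.
apply: le_trans (ler_wpM2l _ (spread_f (pos s))) _.
  by rewrite invr_ge0 ltW.
rewrite mulrBr mulKf ?gt_eqF// lerD2l lerN2 ler_nat.
by case: asboolP => [[_ ->]|//]; rewrite eqxx.
Qed.

End Transience.

(** * A recurrence criterion *)

Section Recurrence.
Context (R : realType) (d : nat).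
Variables (ask : state d -> bool) (aim : state d -> seq (site d * R)).
Variable inv : state d -> Prop.
Hypothesis inv0 : inv (start d).
Hypothesis step_inv : stochastic_on (step ask aim) inv.
Implicit Types (s : state d) (x y : site d).

Let nxt := step ask aim.

Lemma average_move_le (V G : state d -> R) s : inv s -> ~~ ask s ->
  (forall e, pos s + unit_step e \in dom s ->
     V (move s (pos s + unit_step e)) <= G (move s (pos s + unit_step e))) ->
  average nxt V s <= average nxt G s.
Proof.
move=> si sa VG; rewrite /average big_seq [leRHS]big_seq; apply: ler_sum => z zs.
have [/allP/(_ _ zs) z0 _ _] := step_inv si; rewrite ler_wpM2l//.
move: zs; rewrite /nxt /step (negbTE sa) => /mapP[e]; rewrite mem_enum => es -> /=.
exact: VG.
Qed.

Lemma average_probe_const V s (c : R) : inv s -> ask s ->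
  (forall y, V (probe s y) = c) -> average nxt V s = c.
Proof.
move=> si sa Vc; have [_ s1 _] := step_inv si.
rewrite -[RHS]mul1r -s1 /mass mulr_suml /average; apply: eq_big_seq => z.
by rewrite /nxt /step sa => /mapP[u _ ->] /=; rewrite Vc.
Qed.

Lemma average_const s (c : R) : inv s -> average nxt (fun=> c) s = c.
Proof.
by move=> si; have [_ s1 _] := step_inv si; rewrite /average -mulr_suml -/(mass _) s1 mul1r.
Qed.

Lemma averageD F G s : average nxt (fun s => F s + G s) s = average nxt F s + average nxt G s.
Proof. by rewrite /average -big_split; apply: eq_bigr => z _; rewrite mulrDr. Qed.

Lemma averageZ (c : R) F s : average nxt (fun s => c * F s) s = c * average nxt F s.
Proof. by rewrite /average mulr_sumr; apply: eq_bigr => z _; rewrite mulrCA. Qed.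

Variables (V0 S0 : site d -> R) (bound : nat -> R).
Hypothesis V0_ge0 : forall x, 0 <= V0 x.
Hypothesis S0_ge0 : forall x, 0 <= S0 x.
Hypothesis V0_super : forall s, inv s -> ~~ ask s -> pos s != 0 ->
  average nxt (V0 \o @pos d) s <= V0 (pos s).
Hypothesis S0_sub : forall s, inv s -> ~~ ask s -> pos s != 0 ->
  S0 (pos s) + 1 <= average nxt (S0 \o @pos d) s.
Hypothesis V0_proper : forall N : nat, exists2 C : R, 0 < C & forall x, V0 x < N%:R ->
  S0 x <= C /\ forall e, S0 (x + unit_step e) <= C.
Hypothesis V0_bound : forall s, inv s -> V0 (pos s) <= bound (size s.1).

Section Level.
Variables (t0 N : nat) (C : R).
Hypothesis N0 : (0 < N)%N.
Hypothesis C0 : 0 < C.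
Hypothesis CP : forall x, V0 x < N%:R -> S0 x <= C /\ forall e, S0 (x + unit_step e) <= C.

(** From time t0 on, the walk is followed until it is at the origin or V0 reaches N. The flag
    [stopped] concerns the times from t0 on that lie strictly before the present. *)
Let stop x := (x == 0) || (N%:R <= V0 x).
Let stopped s := has stop (drop t0 (map fst s.1)).
Let k : R := (N%:R * C)^-1.
(** Before stopping, V0 / N is superharmonic, and the second summand, between 0 and 1 / N, falls by
    at least k per step on average, which forces the walk to stop. The 1 in [vbar] accounts for this
    summand. *)
Let L x : R := V0 x / N%:R + k * (C - S0 x).
Let W x : R := if x == 0 then 0 else if N%:R <= V0 x then 1 else L x.
Let vbar : R := (bound t0 + 1) / N%:R.
Let V s : R := if (size s.1 < t0)%N then vbar else if stopped s then 0 else W (pos s).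

Let NR0 : 0 < N%:R :> R. Proof. by rewrite ltr0n. Qed.
Let k0 : 0 < k. Proof. by rewrite invr_gt0 mulr_gt0. Qed.
Let ki : 0 <= k^-1. Proof. by rewrite invr_ge0 ltW. Qed.
Let kC : k * C = N%:R^-1.
Proof. by rewrite /k; field; rewrite !gt_eqF. Qed.

Let L_ge0 x : S0 x <= C -> 0 <= L x.
Proof. by move=> xC; rewrite addr_ge0 ?divr_ge0 ?mulr_ge0 ?subr_ge0// ltW. Qed.

Let W_le x : S0 x <= C -> W x <= L x.
Proof.
move=> xC; rewrite /W; case: ifP => _; first exact: L_ge0.
case: ifP => // Nx; have : 1 <= V0 x / N%:R by rewrite ler_pdivlMr// mul1r.
have : 0 <= k * (C - S0 x) by rewrite mulr_ge0 ?subr_ge0// ltW.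
by rewrite /L; lra.
Qed.

Let W_ge0 x : 0 <= W x.
Proof.
rewrite /W; case: ifP => // _; case: ifPn => //; rewrite -ltNge => xN.
by apply: L_ge0; case: (CP xN).
Qed.

Let W_vbar s : inv s -> size s.1 = t0 -> W (pos s) <= vbar.
Proof.
move=> si st; have := V0_bound si; rewrite st => bd.
have Nb : V0 (pos s) / N%:R <= vbar - N%:R^-1.
  by rewrite /vbar mulrDl mul1r addrK ler_pM2r ?invr_gt0.
have N1 : 0 <= N%:R^-1 :> R by rewrite invr_ge0.
have V0N : 0 <= V0 (pos s) / N%:R by rewrite divr_ge0.
rewrite /W; case: ifP => _; first by lra.
case: ifPn => NV.
  have : 1 <= V0 (pos s) / N%:R by rewrite ler_pdivlMr// mul1r.
  by lra.
have : k * (C - S0 (pos s)) <= N%:R^-1 by rewrite -kC ler_wpM2l ?(ltW k0)// lerBlDr lerDl.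
by rewrite /L; lra.
Qed.

Let stopped_move s y : (t0 <= size s.1)%N -> stopped (move s y) = stopped s || stop (pos s).
Proof.
move=> ts; rewrite /stopped /= map_rcons -cats1 drop_cat size_map.
case: ltnP => [_|st]; first by rewrite has_cat /= orbF.
have {ts}st : size s.1 = t0 by apply/eqP; rewrite eqn_leq st.
by rewrite st subnn drop0 /= orbF drop_oversize ?size_map ?st.
Qed.

Let stopped_start s : size s.1 = t0 -> stopped s = false.
Proof. by move=> st; rewrite /stopped drop_oversize// size_map st. Qed.

Let hits s := [/\ (t0 <= size s.1)%N, ~~ stopped s, ~~ ask s, pos s != 0 & N%:R <= V0 (pos s)].
Let live s := [/\ (t0 <= size s.1)%N, ~~ stopped s, ~~ ask s & ~~ stop (pos s)].

Hypothesis vbar0 : 0 <= vbar.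

Let V_ge0 s : 0 <= V s.
Proof. by rewrite /V; case: ifP => // _; case: ifP. Qed.

Let V_probe s : inv s -> ask s -> average nxt V s = V s.
Proof. by move=> si sa; apply: average_probe_const. Qed.

Let V_early s : inv s -> (size s.1 < t0)%N -> average nxt V s <= V s.
Proof.
move=> si st; have [sa|sa] := boolP (ask s); first by rewrite V_probe.
rewrite {2}/V st -[leRHS](average_const vbar si).
have [_ _ ninv] := step_inv si.
apply: average_move_le => // e es; rewrite /V /= size_rcons; case: ltnP => // t0s.
have ts : size (move s (pos s + unit_step e)).1 = t0.
  by apply/eqP; rewrite eqn_leq /= size_rcons st t0s.
rewrite stopped_start//; apply: W_vbar => //; apply: ninv.
rewrite /step (negbTE sa) -map_comp; apply/mapP; exists e => //.
by rewrite mem_enum.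
Qed.

Let V_stop s : inv s -> ~~ ask s -> (t0 <= size s.1)%N -> stopped s || stop (pos s) ->
  average nxt V s = 0.
Proof.
move=> si sa ts ss; apply/eqP; rewrite eq_le; apply/andP; split.
  rewrite -(average_const 0 si); apply: average_move_le => // e es.
  by rewrite /V /= size_rcons ltnNge (leqW ts)/= stopped_move// ss.
by rewrite -(average_const 0 si); apply: average_move_le => // e es; exact: V_ge0.
Qed.

Let V_live s : inv s -> live s -> average nxt V s <= V s - k.
Proof.
move=> si [ts ss sa sp]; move: (sp); rewrite /stop negb_or -ltNge => /andP[p0 pN].
have [pC eC] := CP pN.
apply: (@le_trans _ _ (average nxt (fun s => L (pos s)) s)).
  apply: average_move_le => // e es.
  rewrite /V /= size_rcons ltnNge (leqW ts)/= stopped_move// (negbTE ss) (negbTE sp).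
  exact/W_le/eC.
rewrite /V ltnNge ts/= (negbTE ss) /W (negbTE p0) (lt_geF pN) /L.
rewrite (_ : (fun s => _) = (fun s => N%:R^-1 * V0 (pos s) + (k * C + - k * S0 (pos s)))).
  rewrite averageD averageZ averageD average_const// (averageZ (- k)).
  have := V0_super si sa p0; have := S0_sub si sa p0; rewrite /comp => h1 h2.
  have Ni : 0 <= N%:R^-1 :> R by rewrite invr_ge0.
  have := ler_wpM2l (ltW k0) h1; have := ler_wpM2l Ni h2.
  set u := average nxt (fun s' => V0 (pos s')) s.
  set v := average nxt (fun s' => S0 (pos s')) s.
  move: (V0 (pos s)) (S0 (pos s)) u v (N%:R^-1) => a b u v n; lra.
by apply/funext => s'; ring.
Qed.

Section LevelChain.
Context (disp : measure_display) (T : measurableType disp) (P : probability T R).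
Variable X : nat -> T -> state d.
Hypothesis PX : chain_law nxt (start d) P X.
Hypothesis XP : forall w, psrw_path ask aim (X ^~ w).

Let V_start : V (start d) <= vbar.
Proof.
by rewrite /V /W /= eqxx; case: ifP.
Qed.

(** When level N is reached V is 1, and it is 0 afterwards. Its value at the start, at most [vbar],
    thus bounds the probability of reaching the level before the origin. *)
Lemma hits_prob : measurable [set w | exists n, hits (X n w)] /\
  (P [set w | exists n, hits (X n w)] <= vbar%:E)%E.
Proof.
have [||mH PH] := @lyapunov_hit _ _ nxt (start d) inv inv0 step_inv _ _ P X PX V hits.
- by move=> s _; exact: V_ge0.
- move=> s si; have [h|h] := pselect (hits s); [rewrite (asboolT h)|rewrite (asboolF h) addr0].
    have [ts ss sa p0 pN] := h; rewrite V_stop ?add0r//; last by rewrite /stop pN !orbT.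
    by rewrite /V ltnNge ts/= (negbTE ss) /W (negbTE p0) pN.
  have [sa|sa] := boolP (ask s); first by rewrite V_probe.
  have [st|ts] := ltnP (size s.1) t0; first exact: V_early.
  have [ss|ss] := boolP (stopped s || stop (pos s)); first by rewrite V_stop.
  move: ss; rewrite negb_or => /andP[ss sp].
  by apply: le_trans (V_live si _) _; rewrite ?lerBlDr ?lerDl ?ltW//; split.
by split=> //; apply: le_trans PH _; rewrite lee_fin.
Qed.

Lemma live_finite : {ae P, forall w, exists n0, forall n, (n0 <= n)%N -> ~ live (X n w)}.
Proof.
apply: (lyapunov_finite inv0 step_inv PX (V := fun s => k^-1 * V s)) => s si.
  by rewrite mulr_ge0 ?V_ge0// invr_ge0 ltW.
rewrite averageZ; have [h|h] := pselect (live s); [rewrite (asboolT h)|rewrite (asboolF h) addr0].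
  apply: (@le_trans _ _ (k^-1 * (V s - k) + 1)).
    by rewrite lerD2r (ler_wpM2l ki)// V_live.
  by rewrite mulrBr mulVf ?gt_eqF// subrK.
rewrite (ler_wpM2l ki)//.
have [sa|sa] := boolP (ask s); first by rewrite V_probe.
have [st|ts] := ltnP (size s.1) t0; first exact: V_early.
have [ss|ss] := boolP (stopped s || stop (pos s)); first by rewrite V_stop.
by move: ss; rewrite negb_or => /andP[ss sp]; case: h; split.
Qed.

(** If the walk avoids the origin from t0 on, then either it is never stopped, a null event by
    [live_finite], or it reaches level N. *)
Lemma escape_prob :
  (P [set w | forall t, (t0 <= t)%N -> walk ask X t w != 0%R] <= vbar%:E)%E.
Proof.
have [mH PH] := hits_prob; have [A [mA PA AP]] := live_finite.
have mE : measurable [set w | forall t, (t0 <= t)%N -> walk ask X t w != 0].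
  rewrite (_ : [set w | _] = \bigcap_(t in [set t | (t0 <= t)%N]) (~` [set w | walk ask X t w = 0])).
    apply: bigcap_measurable; first by exists t0 => /=.
    by move=> t _; apply: measurableC; exact: (measurable_walk PX XP).
  by apply/seteqP; split => w /= h t /h /eqP.
have sub : [set w | forall t, (t0 <= t)%N -> walk ask X t w != 0] `<=`
    A `|` [set w | exists n, hits (X n w)].
  move=> w /= w0; have [Aw|nA] := pselect (A w); [by left|right].
  have [n0 ln0] : exists n0, forall n, (n0 <= n)%N -> ~ live (X n w).
    by apply: contrapT => /(AP w).
  have mom t := momentP (XP w) t.
  have pX t : pos (X (moment ask (X ^~ w) t) w) = walk ask X t w by [].
  have pastX t : map fst (X (moment ask (X ^~ w) t) w).1 = mkseq (fun u => walk ask X u w) t.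
    by rewrite (momentE XP) /past /mkseq -map_comp.
  have stE t : (t0 <= t)%N -> stopped (X (moment ask (X ^~ w) t) w) =
      has (fun u => stop (walk ask X u w)) (iota t0 (t - t0)).
    move=> tt; rewrite /stopped pastX /mkseq -map_drop drop_iota add0n has_map.
    by apply: eq_has => u /=.
  have ex : exists t, (t0 <= t)%N && stop (walk ask X t w).
    apply: contrapT => nex.
    have {}nex t : (t0 <= t)%N -> ~~ stop (walk ask X t w).
      by move=> tt; apply/negP => st; apply: nex; exists t; rewrite tt.
    apply: (ln0 (moment ask (X ^~ w) (maxn n0 t0))).
      by rewrite (leq_trans _ (le_time_moment w XP _))// leq_maxl.
    have [mt am] := mom (maxn n0 t0); split=> //; first by rewrite mt leq_maxr.
      rewrite stE ?leq_maxr// -all_predC; apply/allP => u /=; rewrite mem_iota => /andP[tu _].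
      exact: nex.
    by rewrite pX nex// leq_maxr.
  case: (ex_minnP ex) => t /andP[tt st] tmin; exists (moment ask (X ^~ w) t).
  have [mt am] := mom t; split=> //; first by rewrite mt.
  - rewrite stE// -all_predC; apply/allP => u; rewrite mem_iota subnKC// => /andP[tu ut] /=.
    apply: contraTN ut => su; rewrite -leqNgt; apply: tmin.
    by rewrite tu.
  - by rewrite pX w0.
  - by move: st; rewrite /stop pX (negbTE (w0 _ tt)).
apply: le_trans (le_measure _ _ _ sub) _; rewrite ?inE//; first exact: measurableU.
apply: le_trans (measureU2 _ mA mH) _.
by rewrite [X in (X + _)%E]PA add0e.
Qed.

End LevelChain.
End Level.

Hypothesis bound_ge0 : forall t, 0 <= bound t.

Context (disp : measure_display) (T : measurableType disp) (P : probability T R).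
Variable X : nat -> T -> state d.
Hypothesis PX : chain_law nxt (start d) P X.
Hypothesis XP : forall w, psrw_path ask aim (X ^~ w).

(** For fixed t0 the bound [vbar] on the probability of never returning after t0 tends to 0 as N
    grows. *)
Lemma recurrent_of_chain : {ae P, forall w, recurrent (walk ask X) w}.
Proof.
apply: ae_foralln => t0.
pose E := [set w | forall t, (t0 <= t)%N -> walk ask X t w != 0].
have mE : measurable E.
  rewrite (_ : E = \bigcap_(t in [set t | (t0 <= t)%N]) (~` [set w | walk ask X t w = 0])).
    apply: bigcap_measurable; first by exists t0 => /=.
    by move=> t _; apply: measurableC; exact: (measurable_walk PX XP).
  by apply/seteqP; split => w /= h t /h /eqP.
exists E; split=> //; last first.
  move=> w /= nex t tt; apply/eqP => K0; apply: nex; exists t => //.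
apply/eqP; rewrite -measure_le0; apply/lee_addgt0Pr => e e0; rewrite add0e.
pose N := (Num.bound ((bound t0 + 1) / e)).+1.
have [C C0 CP] := V0_proper N.
have vb : 0 <= (bound t0 + 1) / N%:R by rewrite divr_ge0// addr_ge0.
apply: le_trans (escape_prob (t0 := t0) (ltn0Sn _) C0 CP vb PX XP) _.
rewrite lee_fin ler_pdivrMr ?ltr0n// mulrC -ler_pdivrMr//.
have /archi_boundP/ltW : 0 <= (bound t0 + 1) / e.
  by rewrite divr_ge0 ?(ltW e0)// addr_ge0.
by move=> /le_trans; apply; rewrite ler_nat.
Qed.

End Recurrence.

Section BoundedDisplacement.
Context (R : realType) (d : nat).
Variables (ask : state d -> bool) (aim : state d -> seq (site d * R)).

(** Moves have length one. This bounds V0 at time t0, as the recurrence criterion demands. *)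
Definition displaced (s : state d) : Prop := sqnorm (pos s) <= (size s.1)%:Z ^+ 2.

Lemma displaced_start : displaced (start d).
Proof. by rewrite /displaced/= /sqnorm big1// => i _; rewrite mxE. Qed.

Lemma sqr_coord_le (x : site d) i : x 0 i ^+ 2 <= sqnorm x.
Proof. by rewrite /sqnorm (bigD1 i)//= lerDl sumr_ge0// => j _; exact: sqr_ge0. Qed.

Lemma stochastic_displaced (inv : state d -> Prop) :
  stochastic_on (step ask aim) inv ->
  stochastic_on (step ask aim) (fun s => inv s /\ displaced s).
Proof.
move=> sinv s [si sd]; have [s0 s1 ss] := sinv s si; split=> // s' s's.
split; first exact: ss.
move: s's; rewrite /step; case: ifP => _ /mapP[z /mapP[u _ ->] ->] //.
rewrite /displaced /= size_rcons sqnorm_step.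
have := sqr_coord_le (pos s) u.1; move: sd; rewrite /displaced.
set n := size s.1; set v := pos s 0 u.1; set q := sqnorm _ => qn vq.
have vn : - n%:Z <= v <= n%:Z.
  by apply/andP; split; nia.
have -> : n.+1%:Z = n%:Z + 1 by lia.
by case: u.2; rewrite ?expr1 ?expr0; move: vn => /andP[]; nia.
Qed.

End BoundedDisplacement.

Lemma sqrD_eq0 (a b : int) : a ^+ 2 + b ^+ 2 = 0 -> a = 0 /\ b = 0.
Proof.
move=> /eqP; rewrite paddr_eq0 ?sqr_ge0// !sqrf_eq0.
by move=> /andP[/eqP -> /eqP ->].
Qed.

(** * A logarithmic function and recurrence for d = 2 *)

Section PlaneRecurrence.
Context (R : realType) (M : nat).
Implicit Types (x : site 2) (a b s n : int).

(* ln (|x|^2 - 1/2) is superharmonic off the origin of Z^2; it is shifted so as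
   to vanish at the origin, where the value is low enough. *)
Definition weight n : int := if n == 0 then 1 else 126 * n - 63.

Lemma weight0 : weight 0 = 1. Proof. by []. Qed.
Lemma weightE n : n != 0 -> weight n = 63 * (2 * n - 1).
Proof. by rewrite /weight => /negbTE ->; ring. Qed.

(** The neighbours of a unit vector have squared norms 4, 0, 2 and 2. With weight 1 at the origin
    the required inequality is an equality there, because 63 = 7 * 3 * 3. *)
Lemma weight_unit : weight 4 * weight 0 * (weight 2 * weight 2) = weight 1 ^+ 4.
Proof.
rewrite weight0 (@weightE 4 isT) (@weightE 2 isT) (@weightE 1 isT).
have : (63 : int) = (7 * 3 * 3 : int) by [].
move: (63 : int) => c cE; transitivity (c ^+ 3 * (7 * 3 * 3)); first by ring.
by rewrite -cE; ring.
Qed.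

(** Superharmonicity of the logarithm in multiplicative form over the integers. Away from the unit
    vectors the defect is 63 ^ 4 times 64 (a ^ 2 - b ^ 2) ^ 2. *)
Lemma weight_prod a b : a ^+ 2 + b ^+ 2 != 0 ->
  weight (a ^+ 2 + b ^+ 2 + 1 + 2 * a) * weight (a ^+ 2 + b ^+ 2 + 1 - 2 * a) *
  (weight (a ^+ 2 + b ^+ 2 + 1 + 2 * b) * weight (a ^+ 2 + b ^+ 2 + 1 - 2 * b))
  <= weight (a ^+ 2 + b ^+ 2) ^+ 4.
Proof.
move=> s0.
have [h|h] := boolP [|| (a == 1) && (b == 0), (a == -1) && (b == 0),
    (a == 0) && (b == 1) | (a == 0) && (b == -1)].
  have W n1 n2 n3 n4 s : n1 = 4 -> n2 = 0 -> n3 = 2 -> n4 = 2 -> s = 1 ->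
      weight n1 * weight n2 * (weight n3 * weight n4) <= weight s ^+ 4.
    by move=> -> -> -> -> ->; rewrite weight_unit lexx.
  case/or4P: h => /andP[/eqP -> /eqP ->].
  - by apply: W.
  - by rewrite [X in X * _ <= _]mulrC; apply: W.
  - by rewrite mulrC; apply: W.
  - by rewrite mulrC [X in X * _ <= _]mulrC; apply: W.
have nz (u v : int) : ~~ [|| (u == 1) && (v == 0) | (u == -1) && (v == 0)] ->
    u ^+ 2 + v ^+ 2 + 1 + 2 * u != 0 /\ u ^+ 2 + v ^+ 2 + 1 - 2 * u != 0.
  move=> uv; split; apply: contra uv => /eqP E; apply/orP; [right|left].
    by have [|u0 ->] := @sqrD_eq0 (u + 1) v; [rewrite -E; ring|rewrite -addr_eq0 u0].
  by have [|u0 ->] := @sqrD_eq0 (u - 1) v; [rewrite -E; ring|rewrite -subr_eq0 u0].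
have [] := nz a b; first by apply: contra h => /orP[]->; rewrite ?orbT.
have [] := nz b a.
  by apply: contra h => /orP[]/andP[-> ->]; rewrite ?orbT.
rewrite (addrC (b ^+ 2)); move: (s0); set s := a ^+ 2 + b ^+ 2 => s1 n3 n4 n1 n2.
rewrite !weightE//.
have -> : 63 * (2 * (s + 1 + 2 * a) - 1) * (63 * (2 * (s + 1 - 2 * a) - 1)) *
   (63 * (2 * (s + 1 + 2 * b) - 1) * (63 * (2 * (s + 1 - 2 * b) - 1))) =
   63 ^+ 4 * (((2 * s + 1) ^+ 2 - 16 * a ^+ 2) * ((2 * s + 1) ^+ 2 - 16 * b ^+ 2)) by ring.
rewrite exprMn ler_wpM2l//.
have -> : ((2 * s + 1) ^+ 2 - 16 * a ^+ 2) * ((2 * s + 1) ^+ 2 - 16 * b ^+ 2) =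
   (2 * s - 1) ^+ 4 - 64 * (a ^+ 2 - b ^+ 2) ^+ 2 by rewrite /s; ring.
by rewrite lerBlDr lerDl mulr_ge0// sqr_ge0.
Qed.

Definition log_weight n : R := ln (weight n)%:~R.

Lemma weight_gt0 n : 0 <= n -> 0 < weight n.
Proof. by rewrite /weight; case: eqP => //; lia. Qed.

Lemma log_weight_sum (n1 n2 n3 n4 s : int) : 0 <= n1 -> 0 <= n2 -> 0 <= n3 -> 0 <= n4 -> 0 <= s ->
  weight n1 * weight n2 * (weight n3 * weight n4) <= weight s ^+ 4 ->
  log_weight n1 + log_weight n2 + (log_weight n3 + log_weight n4) <= 4 * log_weight s.
Proof.
move=> p1 p2 p3 p4 ps h.
have P n : 0 <= n -> (0 : R) < (weight n)%:~R by move=> n0; rewrite ltr0z weight_gt0.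
rewrite /log_weight -!lnM ?posrE ?mulr_gt0 ?P// mulr_natl -lnXn ?P//.
rewrite ler_ln ?posrE ?mulr_gt0 ?exprn_gt0 ?P//.
by rewrite -!rmorphM -rmorphXn ler_int.
Qed.

Definition log_norm x : R := log_weight (sqnorm x).

Lemma sqnorm2 x : sqnorm x = x 0 ord0 ^+ 2 + x 0 ord_max ^+ 2.
Proof. by rewrite /sqnorm big_ord_recl big_ord1; congr (_ + x 0 _ ^+ 2); exact: val_inj. Qed.

Lemma sqnorm_eq0 d (x : site d) : (sqnorm x == 0) = (x == 0).
Proof.
apply/eqP/eqP => [x0|->]; last by rewrite /sqnorm big1// => i _; rewrite mxE.
apply/matrixP => i j; rewrite (ord1 i) mxE; apply/eqP; rewrite -sqrf_eq0.
by rewrite eq_le sqr_ge0 -x0 sqr_coord_le.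
Qed.

Lemma spread_log_norm x : x != 0 -> spread log_norm x <= log_norm x.
Proof.
rewrite -sqnorm_eq0 => x0; rewrite /spread sum_direction big_ord_recl big_ord1.
rewrite ler_pdivrMl ?ltr0n// /log_norm.
have -> : lift ord0 ord0 = ord_max :> 'I_2 by exact: val_inj.
have p e : 0 <= sqnorm (x + unit_step e) by exact: sqnorm_ge0.
have := p (ord0, false); have := p (ord0, true).
have := p (ord_max, false); have := p (ord_max, true).
rewrite !sqnorm_step/= !expr1 !expr0 !mulN1r !mul1r !mulNrn.
rewrite -(mulr_natl (x 0 ord0) 2) -(mulr_natl (x 0 ord_max) 2) => p1 p2 p3 p4.
apply: (log_weight_sum p4 p3 p2 p1 (sqnorm_ge0 x)).
by move: x0; rewrite !sqnorm2; exact: weight_prod.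
Qed.

Lemma log_norm_ge0 x : 0 <= log_norm x.
Proof.
rewrite /log_norm /log_weight ln_ge0// ler1z; have := weight_gt0 (sqnorm_ge0 x).
by rewrite -gtz0_ge1.
Qed.

Lemma log_norm_le x (m : nat) : sqnorm x <= m%:Z ^+ 2 -> log_norm x <= (126 * (m * m) + 1)%:R.
Proof.
move=> xm; rewrite /log_norm /log_weight.
have w0 : 0 < (weight (sqnorm x))%:~R :> R by rewrite ltr0z weight_gt0// sqnorm_ge0.
apply: le_trans (ltW (ln_sublinear w0)) _.
rewrite -[leRHS]mulrz_nat ler_int /weight; have := sqnorm_ge0 x.
by case: eqP => _; move: xm; rewrite expr2; lia.
Qed.

Lemma sqnorm_neighbor_le x e : sqnorm (x + unit_step e) <= 2 * sqnorm x + 2.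
Proof.
rewrite sqnorm_step; have := sqr_coord_le x e.1; set v := x 0 e.1.
have := sqr_ge0 (v - 1); have := sqr_ge0 (v + 1).
by case: e.2; rewrite ?expr1 ?expr0; nia.
Qed.

Lemma log_norm_proper (N : nat) : exists2 C : R, 0 < C & forall x, log_norm x < N%:R ->
  (sqnorm x)%:~R <= C /\ forall e, (sqnorm (x + unit_step e))%:~R <= C.
Proof.
(* The weight is below exp N, the squared norm is at most the weight plus 1, and a step turns a
   squared norm s into at most 2 s + 2. *)
exists (2 * (expR N%:R + 1) + 2).
  by have := expR_gt0 (N%:R : R); lra.
move=> x xN; have s0 : 0 <= sqnorm x by exact: sqnorm_ge0.
have w0 : 0 < (weight (sqnorm x))%:~R :> R by rewrite ltr0z weight_gt0.
have wN : (weight (sqnorm x))%:~R < expR N%:R :> R.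
  by rewrite -[ltLHS]lnK ?posrE// ltr_expR.
have sw : (sqnorm x)%:~R <= (weight (sqnorm x))%:~R + 1 :> R.
  by rewrite -[1]/(1%:~R) -rmorphD ler_int /weight; case: eqP => [->//|]; lia.
have s0R : 0 <= (sqnorm x)%:~R :> R by rewrite ler0z.
split=> [|e]; first by lra.
have : (sqnorm (x + unit_step e))%:~R <= (2 * sqnorm x + 2)%:~R :> R.
  by rewrite ler_int sqnorm_neighbor_le.
rewrite rmorphD rmorphM/=; lra.
Qed.

Section Chain.
Variables (disp : measure_display) (T : measurableType disp) (P : probability T R).
Variable X : nat -> T -> state 2.
Hypothesis PX : chain_law (step (@greedy_ask 2 M) (@greedy_aim R 2)) (start 2) P X.
Hypothesis XP : forall w, psrw_path (@greedy_ask 2 M) (@greedy_aim R 2) (X ^~ w).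

Lemma greedy_recurrent : {ae P, forall w, recurrent (walk (@greedy_ask 2 M) X) w}.
Proof.
have inv0 : in_dom (start 2) /\ displaced (start 2).
  by split; [exact: in_dom_start|exact: displaced_start].
have ninv := stochastic_displaced (@greedy_stochastic R 2 M isT).
apply: (recurrent_of_chain inv0 ninv (V0 := log_norm) (S0 := fun x => (sqnorm x)%:~R)
  (bound := fun t => (126 * (t * t) + 1)%:R) _ _ _ _ _ _ _ PX XP).
- exact: log_norm_ge0.
- by move=> x; rewrite ler0z sqnorm_ge0.
- by move=> s _ sa s0; rewrite average_open//= spread_log_norm.
- by move=> s _ sa s0; rewrite average_open//= spread_sqnorm.
- exact: log_norm_proper.
- by move=> s [_ sd]; exact: log_norm_le.
- by [].
Qed.

End Chain.
End PlaneRecurrence.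

(** * A coordinate plane in Z^d *)

Section Plane.
Context (d' : nat).
Let d := d'.+2.
Implicit Types (p y : int * int) (D : seq (int * int)).

Definition emb p : site d :=
  \row_(i < d) (if val i == 0%N then p.1 else if val i == 1%N then p.2 else 0).

Definition dec (x : site d) : int * int := (x 0 ord0, x 0 (lift ord0 ord0)).

Definition neighbors p : seq (int * int) :=
  [:: (p.1 + 1, p.2); (p.1 - 1, p.2); (p.1, p.2 + 1); (p.1, p.2 - 1)].

Lemma embK : cancel emb dec.
Proof. by case=> a b; rewrite /dec !mxE. Qed.

Lemma emb_inj : injective emb.
Proof. exact: can_inj embK. Qed.

Lemma emb0 : emb (0, 0) = 0.
Proof. by apply/matrixP => i j; rewrite !mxE; case: ifP => // _; case: ifP. Qed.

Lemma emb_step p b :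
  (emb p + unit_step (ord0, b) = emb (p.1 + (-1) ^+ b, p.2)) *
  (emb p + unit_step (lift ord0 ord0, b) = emb (p.1, p.2 + (-1) ^+ b)).
Proof.
split; apply/matrixP => i j; rewrite (ord1 i) mxE unit_stepE !mxE/=.
  by case: j => -[|[|j]] jd //=; rewrite ?mulr1 ?mulr0 ?addr0.
by case: j => -[|[|j]] jd //=; rewrite ?mulr1 ?mulr0 ?addr0.
Qed.

Lemma emb_step_out p (i : 'I_d') b q :
  emb p + unit_step (lift ord0 (lift ord0 i), b) <> emb q.
Proof.
move=> /matrixP/(_ 0 (lift ord0 (lift ord0 i))); rewrite mxE unit_stepE !mxE eqxx/=.
by rewrite add0r mulr1; case: b.
Qed.

(** The domain lies in the plane, so steps along the other axes are closed. *)
Lemma sum_neighbors (V : nmodType) D p (F : site d -> V) :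
  \sum_(e : direction d | emb p + unit_step e \in map emb D) F (emb p + unit_step e)
  = \sum_(y <- neighbors p | y \in D) F (emb y).
Proof.
rewrite big_mkcond/= sum_direction !big_ord_recl/= [X in _ + (_ + X)]big1; last first.
  move=> i _; have out b : emb p + unit_step (lift ord0 (lift ord0 i), b) \notin map emb D.
    by apply/mapP => -[q _]; exact: emb_step_out.
  by rewrite !(negbTE (out _)) addr0.
rewrite addr0 !emb_step !(mem_map emb_inj) !big_cons big_nil/= !expr0 !expr1.
by do 4![case: (_ \in D)]; rewrite ?addr0 ?add0r ?addrA.
Qed.

Lemma neighbor_step p y : y \in neighbors p -> exists e, emb y = emb p + unit_step e.
Proof.
rewrite !inE => /or4P[]/eqP->.
- by exists (ord0, false); rewrite emb_step expr0.
- by exists (ord0, true); rewrite emb_step expr1.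
- by exists (lift ord0 ord0, false); rewrite emb_step expr0.
- by exists (lift ord0 ord0, true); rewrite emb_step expr1.
Qed.

Lemma step_neighbor p e y : emb p + unit_step e = emb y -> y \in neighbors p.
Proof.
case: e => i b; case: (unliftP ord0 i) => [j|] ->.
  case: (unliftP ord0 j) => [k|] ->; first by move=> /emb_step_out.
  by rewrite emb_step => /emb_inj <-; rewrite !inE; case: b; rewrite ?expr0 ?expr1 !eqxx ?orbT.
by rewrite emb_step => /emb_inj <-; rewrite !inE; case: b; rewrite ?expr0 ?expr1 !eqxx ?orbT.
Qed.

Lemma at_distance_one_emb D p y : p \in D -> y \in neighbors p -> y \notin D ->
  at_distance_one (map emb D) (emb y).
Proof.
move=> pD yp yD; split.
  exists (emb p); first exact: map_f.
  by have [e ->] := neighbor_step yp; exact: dist1_unit_step.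
move=> _ /mapP[q qD ->]; apply: dist1_gt0; rewrite (inj_eq emb_inj).
by apply: contraNneq yD => <-.
Qed.

End Plane.

(** * Deterministic strategies in the plane *)

Section Automaton.
Context (R : realType) (d' : nat) (C : Type).
Let d := d'.+2.
Variables (c0 : C) (upd : C -> int * int -> C) (plan : C -> seq (int * int)).
Variables (cdom : C -> seq (int * int)) (cpos : C -> int * int) (good : C -> Prop).

Definition full c := cdom c ++ plan c.

Definition exits c : seq (int * int) := [seq y <- neighbors (cpos c) | y \in full c].

(** A configuration describes the situation at one time: [plan] lists the sites to be probed then,
    [cdom] is the domain before these probes, and [upd] yields the next configuration once the walk
    has moved to y. *)
Record automaton : Prop := Automaton {
  start_good : good c0;
  start_dom : cdom c0 = [:: (0, 0)];
  start_pos : cpos c0 = (0, 0);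
  upd_good : forall c y, good c -> y \in exits c -> good (upd c y);
  upd_dom : forall c y, cdom (upd c y) = full c;
  upd_pos : forall c y, cpos (upd c y) = y;
  plan_grows : forall c i, good c -> (i < size (plan c))%N ->
    let D := cdom c ++ take i (plan c) in let y := nth (0, 0) (plan c) i in
    y \notin D /\ exists2 p, p \in D & y \in neighbors p;
  exits_ex : forall c, good c -> exits c != [::] }.

Hypothesis aut : automaton.

Implicit Types (s : state d) (c : C).

(** Recomputed from the past positions instead of being stored in the state, so that the type of
    configurations need not be countable. [behead] removes the position at time 0, for which [c0]
    stands. *)
Definition config s : C :=
  foldl upd c0 (behead (rcons (map (@dec d' \o fst) s.1) (dec (pos s)))).

Definition plan_ask s : bool := (size s.2.2 < size (plan (config s)))%N.

Definition plan_site s : site d := emb d' (nth (0, 0) (plan (config s)) (size s.2.2)).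

Definition plan_aim s : seq (site d * R) := [:: (plan_site s, 1)].

Let nxt := step plan_ask plan_aim.

Definition plan_inv s : Prop :=
  let c := config s in
  [/\ good c, pos s = emb d' (cpos c), (size s.2.2 <= size (plan c))%N &
      dom s = map (emb d') (cdom c ++ take (size s.2.2) (plan c))].

Lemma config_probe s y : config (probe s y) = config s.
Proof. by []. Qed.

Lemma config_move s y : config (move s (emb d' y)) = upd (config s) y.
Proof.
rewrite /config /= map_rcons/= embK -foldl_rcons; congr foldl.
by case: (map _ s.1).
Qed.

Lemma plan_inv_start : plan_inv (start d).
Proof.
have [g D p _ _ _ _ _] := aut.
rewrite /plan_inv /config/=; split => //; first by rewrite p emb0.
by rewrite take0 cats0 D /= emb0.
Qed.

Lemma ask_full_dom s : plan_inv s -> ~~ plan_ask s ->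
  dom s = map (emb d') (full (config s)).
Proof.
move=> [_ _ sp ->]; rewrite /plan_ask -leqNgt => ps.
by rewrite take_oversize.
Qed.

Lemma open_steps s (F : site d -> R) : plan_inv s -> ~~ plan_ask s ->
  \sum_(e : direction d | pos s + unit_step e \in dom s) F (pos s + unit_step e) =
  \sum_(y <- exits (config s)) F (emb d' y).
Proof.
move=> si sa; rewrite (ask_full_dom si sa); case: si => _ -> _ _.
by rewrite sum_neighbors big_filter.
Qed.

Lemma nopen_exits s : plan_inv s -> ~~ plan_ask s ->
  (nopen (dom s) (pos s))%:R = (size (exits (config s)))%:R :> R.
Proof.
move=> si sa; have := open_steps (fun=> 1) si sa.
by rewrite sumr_const -/(nopen _ _) big_const_seq count_predT iter_addr_0.
Qed.

Lemma exits_gt0 c : good c -> (0 < size (exits c))%N.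
Proof. by move=> /(exits_ex aut); case: exits. Qed.

Definition exit_mean (F : C -> R) c : R :=
  (size (exits c))%:R^-1 * \sum_(y <- exits c) F (upd c y).

Lemma average_plan (V : state d -> R) (F : C -> R) s : plan_inv s -> ~~ plan_ask s ->
  (forall y, y \in exits (config s) -> V (move s (emb d' y)) = F (upd (config s) y)) ->
  average nxt V s = exit_mean F (config s).
Proof.
move=> si sa VF; rewrite /average /nxt /step (negbTE sa) big_map/= big_enum/=.
rewrite -mulr_sumr nopen_exits// (open_steps (fun x => V (move s x)))//.
by congr (_ * _); apply: eq_big_seq.
Qed.

Lemma plan_stochastic : stochastic_on nxt plan_inv.
Proof.
move=> s si; rewrite /nxt /step; case: ifPn => sa; split.
- by rewrite /nonneg_weights/= ler01.
- by rewrite /mass /= big_seq1.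
- move=> s'; rewrite /= inE => /eqP ->; have [g sp sq sd] := si; split => //.
    by rewrite /= size_rcons.
  rewrite dom_probe sd config_probe /= size_rcons (take_nth (0, 0))//.
  by rewrite -rcons_cat map_rcons.
- by apply/allP => z /mapP[e _ ->] /=; rewrite invr_ge0.
- rewrite /mass big_map/= big_enum/= sumr_const -/(nopen _ _) nopen_exits//.
  rewrite -[_ *+ _]mulr_natl nopen_exits// divff// pnatr_eq0 -lt0n exits_gt0//.
  by case: si.
- move=> _ /mapP[z /mapP[e + ->] ->]; rewrite mem_enum /= -topredE/= => es.
  have [g sp sq sd] := si.
  have [y ys ->] : exists2 y, y \in exits (config s) & pos s + unit_step e = emb d' y.
    move: es; rewrite (ask_full_dom si sa) => /mapP[y yf ye]; exists y => //.
    by rewrite mem_filter yf /=; apply: (@step_neighbor d' _ e); rewrite -ye sp.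
  rewrite /plan_inv config_move; split => //.
  - exact: (upd_good aut).
  - by rewrite (upd_pos aut).
  - by rewrite dom_move (ask_full_dom si sa) (upd_dom aut) take0 cats0.
Qed.

Lemma config_start : config (start d) = c0.
Proof. by []. Qed.

Section Chain.
Context (disp : measure_display) (T : measurableType disp) (P : probability T R).
Variable X : nat -> T -> state d.
Hypothesis PX : chain_law nxt (start d) P X.

(** Probes leave the configuration unchanged, so only the moves have to be examined. *)
Lemma plan_lyapunov (V : C -> R) (B : C -> Prop) :
  (forall c, good c -> 0 <= V c) ->
  (forall c, good c -> exit_mean V c + (`[< B c >])%:R <= V c) ->
  {ae P, forall w, exists N, forall n, (N <= n)%N ->
     ~ (~~ plan_ask (X n w) /\ B (config (X n w)))}.
Proof.
move=> V0 VB; apply: (lyapunov_finite plan_inv_start plan_stochastic PX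
  (V := fun s => V (config s)) (B := fun s => ~~ plan_ask s /\ B (config s))) => s si.
  by case: si => /V0.
have [sa|/negP sa] := pselect (is_true (plan_ask s)).
  rewrite asboolF ?addr0; last by case=> /negP.
  by rewrite (average_probe_const plan_stochastic (c := V (config s))).
rewrite (average_plan (F := V))//; last by move=> y _; rewrite config_move.
have [g _ _ _] := si; apply: le_trans (VB _ g); rewrite lerD2l ler_nat.
by case: asboolP => // -[_ ?]; rewrite asboolT.
Qed.

End Chain.

(* A time step with k planned probes takes k + 1 steps of the chain. *)
Lemma plan_psrw_path x : chain_path nxt (start d) x -> psrw_path plan_ask plan_aim x.
Proof.
move=> xP; split=> // n; apply: contrapT => nm.
have {}nm m : (n <= m)%N -> plan_ask (x m).
  by move=> nm'; apply: contrapT => /negP am; apply: nm; exists m.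
have xk k : config (x (n + k)%N) = config (x n) /\
    size (x (n + k)%N).2.2 = (size (x n).2.2 + k)%N.
  elim: k => [|k [c1 c2]]; first by rewrite !addn0.
  have := xP.2 (n + k)%N; rewrite /nxt /step nm ?leq_addr// addnS.
  by rewrite inE => /eqP ->; rewrite config_probe c1 /= size_rcons c2 addnS.
have [c1 c2] := xk (size (plan (config (x n)))).
have := nm _ (leq_addr (size (plan (config (x n)))) n).
by rewrite /plan_ask c1 c2 ltnNge leq_addl.
Qed.

Lemma plan_chain : exists (disp : measure_display) (T : measurableType disp)
    (P : probability T R) (X : nat -> T -> state d),
  chain_law nxt (start d) P X /\ forall w, psrw_path plan_ask plan_aim (X ^~ w).
Proof.
have [|disp [T [P [X [PX Xp]]]]] := chain_exists plan_inv_start plan_stochastic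
    (G := fun=> True).
  by move=> disp T P X PX; exact: aeW.
by exists disp, T, P, X; split=> // w; have [xp _] := Xp w; exact: plan_psrw_path.
Qed.

Section Path.
Context (disp : measure_display) (T : measurableType disp).
Variable X : nat -> T -> state d.
Hypothesis XP : forall w, psrw_path plan_ask plan_aim (X ^~ w).

Lemma plan_at_distance_one :
  probes_chosen_at_distance_one (walk plan_ask X) (probes plan_ask X).
Proof.
apply: (at_distance_one_of_chain plan_inv_start plan_stochastic XP) => s si sa.
  by [].
have [g sp sq ->] := si; have [nD [p pD py]] := plan_grows aut g sa.
exact: (at_distance_one_emb d' pD py nD).
Qed.

Definition configs t w : C := config (X (moment plan_ask (X ^~ w) t) w).

Lemma plan_inv_path n w : plan_inv (X n w).
Proof. exact: (inv_path plan_inv_start plan_stochastic XP). Qed.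

Lemma size_probes_plan t w : size (probes plan_ask X t w) = size (plan (configs t w)).
Proof.
have [_ am] := momentP (XP w) t; apply/eqP; rewrite eqn_leq.
have [_ _ -> _] := plan_inv_path (moment plan_ask (X ^~ w) t) w.
by move: am; rewrite /plan_ask -leqNgt.
Qed.

Lemma walk_plan t w : walk plan_ask X t w = emb d' (cpos (configs t w)).
Proof. by case: (plan_inv_path (moment plan_ask (X ^~ w) t) w). Qed.

Lemma configs0 w : configs 0 w = c0.
Proof.
rewrite /configs /config; have [mt _] := momentP (XP w) 0.
by move: mt => /size0nil ->.
Qed.

Lemma configsS t w : exists2 y, y \in exits (configs t w) &
  configs t.+1 w = upd (configs t w) y.
Proof.
have [mt am] := momentP (XP w) t; have si := plan_inv_path (moment plan_ask (X ^~ w) t) w.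
have := step_cases (XP w) (moment plan_ask (X ^~ w) t); rewrite (negbTE am) => -[[]//|[_ [e es Xm]]].
have [y ys ey] : exists2 y, y \in exits (configs t w) &
    pos (X (moment plan_ask (X ^~ w) t) w) + unit_step e = emb d' y.
  move: es; rewrite (ask_full_dom si am) => /mapP[y yf ye]; exists y => //.
  rewrite mem_filter yf /=; case: si => _ sp _ _.
  by apply: (@step_neighbor d' _ e); rewrite -ye sp.
exists y => //; rewrite -config_move -ey -Xm.
have t1 : size (X (moment plan_ask (X ^~ w) t).+1 w).1 = t.+1 by rewrite Xm /= size_rcons mt.
have [e1 e2 _ _] := same_time (XP w) (le_moment (XP w) t1) (etrans t1 (esym (momentP (XP w) t.+1).1)).
by rewrite /configs /config e1 e2.
Qed.

Lemma good_configs t w : good (configs t w).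
Proof. by case: (plan_inv_path (moment plan_ask (X ^~ w) t) w). Qed.

Lemma configs_finite (B : C -> Prop) w :
  (exists N, forall n, (N <= n)%N -> ~ (~~ plan_ask (X n w) /\ B (config (X n w)))) ->
  exists N, forall t, (N <= t)%N -> ~ B (configs t w).
Proof.
move=> [N XN]; exists N => t Nt Bt; apply: (XN (moment plan_ask (X ^~ w) t)).
  exact: leq_trans (le_time_moment w XP t).
by have [_ am] := momentP (XP w) t.
Qed.

End Path.

End Automaton.

(** * The growing half-line: recurrence with many probes *)

Section HalfLine.
Context (R : realType) (d' M : nat).
Hypothesis M0 : (0 < M)%N.
Let d := d'.+2.

Local Notation config_type := (nat * (int * int))%type.

Definition line (m n : nat) : seq (int * int) := [seq (i%:Z, 0) | i <- iota m n].

Lemma mem_line m n (a b : int) : ((a, b) \in line m n) = (m%:Z <= a < (m + n)%N%:Z) && (b == 0).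
Proof.
apply/mapP/idP => [[i]|/andP[/andP[ma an] /eqP ->]].
  by rewrite mem_iota => /andP[mi im] [-> ->]; rewrite eqxx andbT; lia.
by exists `|a|%N; [rewrite mem_iota; lia|congr pair; lia].
Qed.

Lemma line_cat m n : line 0 (m + n) = line 0 m ++ line m n.
Proof. by rewrite /line iotaD map_cat. Qed.

Let upd (c : config_type) y : config_type := (c.1.+1, y).
Let plan (c : config_type) := line (c.1 * M).+1 M.
Let cdom (c : config_type) := line 0 (c.1 * M).+1.
Let cpos (c : config_type) := c.2.
Let c0 : config_type := (0%N, (0, 0)).
Let good (c : config_type) : Prop := (0 <= c.2.1 <= c.1%:Z) && (c.2.2 == 0).

Let fullE c : full plan cdom c = line 0 (c.1.+1 * M).+1.
Proof. by rewrite /full /cdom /plan -line_cat; congr line; rewrite mulSn; lia. Qed.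

(** At time t the walk is no further than t, and the half-line already extends to (t + 1) M >= t +
    1, so the origin is the only barrier. *)
Let exitsE c : good c -> exits plan cdom cpos c =
  if c.2.1 == 0 then [:: (1, 0)] else [:: (c.2.1 + 1, 0); (c.2.1 - 1, 0)].
Proof.
case: c => t [a b] /andP[/= ta /eqP ->]; rewrite /exits fullE /cpos /neighbors /=.
rewrite !mem_line /=.
have -> : (0 <= a + 1 < (0 + (t.+1 * M).+1)%N%:Z) by nia.
have -> : (0 <= a - 1 < (0 + (t.+1 * M).+1)%N%:Z) = (a != 0) by nia.
by rewrite !andbF !andbT; case: eqP => [->|].
Qed.

Lemma half_line_automaton : automaton c0 upd plan cdom cpos good.
Proof.
have updE c y : cdom (upd c y) = full plan cdom c by rewrite fullE.
split=> //.
- move=> c y gc; rewrite exitsE//; move: gc; rewrite /good /upd /= => /andP[ca /eqP c2].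
  case: eqP => [c1|c1]; rewrite !inE; first by move=> /eqP ->.
  by move=> /orP[]/eqP-> /=; rewrite eqxx andbT; lia.
- move=> c i _; rewrite size_map size_iota => iM D y; rewrite {}/D {}/y.
  have -> : take i (plan c) = line (c.1 * M).+1 i.
    by rewrite /plan /line -map_take take_iota (minn_idPl (ltnW iM)).
  have -> : nth (0, 0) (plan c) i = (((c.1 * M).+1 + i)%N%:Z, 0).
    by rewrite /plan /line (nth_map 0%N) ?size_iota// nth_iota.
  rewrite /cdom -line_cat mem_line; split; first by lia.
  exists ((c.1 * M + i)%N%:Z, 0); first by rewrite mem_line; lia.
  by rewrite /neighbors !inE/=; apply/orP; left; apply/eqP; congr pair; lia.
- by move=> c gc; rewrite exitsE//; case: ifP.
Qed.

Let aut := half_line_automaton.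
Let ask := @plan_ask d' config_type c0 upd plan.
Let aim := @plan_aim R d' config_type c0 upd plan.

Let coord (x : site d) : R := (`|x 0 ord0|)%:~R.
Let sqcoord (x : site d) : R := (x 0 ord0 ^+ 2)%:~R.

Let exit_mean2 (F : config_type -> R) c : good c -> c.2.1 != 0 ->
  exit_mean upd plan cdom cpos F c =
  (F (upd c (c.2.1 + 1, 0)) + F (upd c (c.2.1 - 1, 0))) / 2.
Proof.
by move=> gc c0'; rewrite /exit_mean exitsE// (negbTE c0') !big_cons big_nil/= addr0 mulrC.
Qed.

(** For the reflected walk, |x| is harmonic off the origin and x ^ 2 gains 1 per step on average. *)
Lemma half_line_recurrent (disp : measure_display) (T : measurableType disp)
    (P : probability T R) (X : nat -> T -> state d) :
  chain_law (step ask aim) (start d) P X ->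
  (forall w, psrw_path ask aim (X ^~ w)) -> {ae P, forall w, recurrent (walk ask X) w}.
Proof.
move=> PX XP.
have inv0 : plan_inv c0 upd plan cdom cpos good (start d) /\ displaced (start d).
  by split; [exact: plan_inv_start aut|exact: displaced_start].
have ninv := stochastic_displaced (@plan_stochastic R d' _ _ _ _ _ _ _ aut).
have average2 (F : site d -> R) s : plan_inv c0 upd plan cdom cpos good s ->
    ~~ ask s -> pos s != 0 -> average (step ask aim) (F \o @pos d) s =
    (F (emb d' (pos s 0 ord0 + 1, 0)) + F (emb d' (pos s 0 ord0 - 1, 0))) / 2.
  move=> si sa s0; have [g sp _ _] := si.
  rewrite (average_plan (F := fun c => F (emb d' (cpos c))) si sa)//.
  have pE : pos s 0 ord0 = (config c0 upd s).2.1 by rewrite sp !mxE.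
  rewrite exit_mean2// ?pE//; apply: contraNneq s0 => e0.
  have /andP[_ /eqP e1] := g; rewrite sp /cpos (surjective_pairing (_.2)) e0 e1 emb0.
  by [].
have coordE (a : int) : emb d' (a, 0) 0 ord0 = a by rewrite !mxE.
apply: (recurrent_of_chain inv0 ninv (V0 := coord) (S0 := sqcoord)
  (bound := fun t => t%:R) _ _ _ _ _ _ _ PX XP).
- by move=> x; rewrite ler0z.
- by move=> x; rewrite ler0z sqr_ge0.
- move=> s [si _] sa s0; rewrite average2// /coord !coordE.
  have : (0 < pos s 0 ord0).
    have [g sp _ _] := si; move: s0; rewrite sp !mxE/=.
    have /andP[/andP[g0 _] /eqP g1] := g; rewrite lt_neqAle g0 andbT eq_sym.
    by apply: contraNneq => e0; rewrite /cpos (surjective_pairing (_.2)) -e0 g1 emb0.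
  move: (pos s 0 ord0) => a a0; rewrite -rmorphD/= ler_pdivrMr// mulr_natr -rmorphMn ler_int.
  by lia.
- move=> s [si _] sa s0; rewrite average2// /sqcoord !coordE.
  move: (pos s 0 ord0) => a; rewrite ler_pdivlMr// -rmorphD -[1]/(1%:~R) -rmorphD.
  by rewrite mulr_natr -rmorphMn ler_int; nia.
- move=> N; exists ((N.+1)%:R ^+ 2) => [|x]; first by rewrite exprn_gt0.
  rewrite /coord /sqcoord -[N%:R]mulrz_nat ltr_int => xN.
  rewrite -[N.+1%:R]mulrz_nat -rmorphXn; split=> [|e]; rewrite ler_int.
    by move: xN; move: (x 0 ord0) => a; rewrite !expr2; nia.
  rewrite mxE unit_stepE; move: xN; move: (x 0 ord0) => a aN.
  have [b bE] : exists b : int, (-1) ^+ e.2 * (ord0 == e.1)%:R = b by eexists.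
  have : `|b| <= 1 by rewrite -bE; case: e.2; case: (_ == _).
  by rewrite bE !expr2; nia.
- move=> s [_ sd]; rewrite /coord -[X in _ <= X]mulrz_nat ler_int.
  have := sqr_coord_le (pos s) ord0; move: sd; rewrite /displaced.
  by move: (pos s 0 ord0) => a; rewrite !expr2; nia.
- by [].
Qed.

Lemma half_line_psrw : exists (disp : measure_display) (T : measurableType disp)
    (P : probability T R) (K : nat -> T -> site d) (Q : nat -> T -> seq (site d)),
  [/\ is_psrw P K Q, probes_chosen_at_distance_one K Q,
      forall t w, size (Q t w) = M & {ae P, forall w, recurrent K w}].
Proof.
have [disp [T [P [X [PX XP]]]]] := plan_chain R d' aut.
exists disp, T, P, (walk ask X), (probes ask X); split.
- exact: psrw_of_chain PX XP.
- exact: (plan_at_distance_one aut XP).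
- by move=> t w; rewrite (size_probes_plan aut XP) /plan size_map size_iota.
- exact: half_line_recurrent.
Qed.

End HalfLine.

(** * Combs *)

Fixpoint grows (D l : seq (int * int)) : Prop :=
  if l is y :: l' then
    [/\ y \notin D, exists2 p, p \in D & y \in neighbors p & grows (rcons D y) l']
  else True.

Lemma grows_nth D l k : grows D l -> (k < size l)%N ->
  nth (0, 0) l k \notin D ++ take k l /\
  exists2 p, p \in D ++ take k l & nth (0, 0) l k \in neighbors p.
Proof.
elim: l D k => [//|y l IH] D [|k] /= [yD py gl]; first by rewrite cats0.
by rewrite ltnS => kl; have := IH _ _ gl kl; rewrite cat_rcons.
Qed.

Lemma grows_cat D l1 l2 : grows D (l1 ++ l2) <-> grows D l1 /\ grows (D ++ l1) l2.
Proof.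
elim: l1 D => [|y l1 IH] D /=; first by rewrite cats0; split=> [|[]].
rewrite -cat_rcons; split=> [[yD py /IH[]]|[[yD py g1] g2]]; first by [].
by split=> //; apply/IH.
Qed.

Lemma grows_run D (f : nat -> int * int) a k :
  (forall u, u \in iota a k -> f u \notin D) ->
  (forall u v, u \in iota a k -> v \in iota a k -> f u = f v -> u = v) ->
  (forall u, u \in iota a k -> f u.+1 \in neighbors (f u)) ->
  (exists2 p, p \in D & f a \in neighbors p) ->
  grows D [seq f u | u <- iota a k].
Proof.
elim: k a D => [//|k IH] a D /= fD finj fn pa; split=> //; first by rewrite fD ?inE ?eqxx.
have sub u : u \in iota a.+1 k -> u \in a :: iota a.+1 k by rewrite inE orbC => ->.
apply: IH.
- move=> u ua; rewrite mem_rcons inE negb_or fD ?sub// andbT.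
  apply/eqP => /finj; rewrite sub// inE eqxx => /(_ isT isT) e.
  by move: ua; rewrite e mem_iota ltnn.
- by move=> u v /sub ua /sub va; exact: finj.
- by move=> u /sub; exact: fn.
- exists (f a); first by rewrite mem_rcons inE eqxx.
  by apply: fn; rewrite inE eqxx.
Qed.

Section Comb.
Variables (n g : nat).
Hypothesis g0 : (0 < g)%N.
Implicit Types (i j : int) (p y : int * int) (m : nat).

(* In coordinates relative to its base (0, 0), the comb consists of a neck
   (1, 0), a spine (2, j) for 0 <= j <= 2 n, and teeth (2 + i, 2 m) with
   1 <= i <= g and m <= n. *)
Definition in_comb i j : bool :=
  [|| (i == 1) && (j == 0), (i == 2) && (0 <= j <= (2 * n)%N%:Z) |
      (3 <= i <= g%:Z + 2) && (0 <= j <= (2 * n)%N%:Z) && ~~ odd `|j|%N].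

(** Listed in an order fit for probing: the neck, the spine upwards, then every tooth from the spine
    outwards. *)
Definition comb (b : int * int) : seq (int * int) :=
  (b.1 + 1, b.2) :: [seq (b.1 + 2, b.2 + u%:Z) | u <- iota 0 (2 * n).+1] ++
  [seq (b.1 + 2 + u%:Z, b.2 + (2 * m)%N%:Z) | m <- iota 0 n.+1, u <- iota 1 g].

Lemma mem_comb b y : (y \in comb b) = in_comb (y.1 - b.1) (y.2 - b.2).
Proof.
case: b y => [X Y] [a c]; rewrite /comb in_cons mem_cat /in_comb; cbn [fst snd]; congr (_ || _).
  by rewrite -pair_eqE; cbn [fst snd pair_eq]; lia.
congr (_ || _).
  apply/idP/idP => [/mapP[u]|h]; first by rewrite mem_iota => jn [-> ->]; lia.
  by apply/mapP; exists (absz (c - Y)%R); [rewrite mem_iota; lia|congr pair; lia].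
apply/idP/idP => [/allpairsP[[m u]]|h]; cbn [fst snd].
  by rewrite !mem_iota => -[mn ig [-> ->]]; lia.
apply/allpairsP; exists ((absz (c - Y)%R)%N./2, absz (a - X - 2)%R); cbn [fst snd]; rewrite !mem_iota; split; [lia|lia|].
by congr pair; lia.
Qed.

Lemma size_comb b : size (comb b) = (2 * n + 2 + n.+1 * g)%N.
Proof.
rewrite /comb -cat1s size_cat size_cat size_map size_allpairs !size_iota.
by rewrite -[size [:: _]]/1%N !addnA; congr (_ + _)%N; lia.
Qed.

Lemma comb_grows (D : seq (int * int)) b k :
  b \in D -> (forall p, p \in D -> p.1 <= b.1) -> (k < size (comb b))%N ->
  nth (0, 0) (comb b) k \notin D ++ take k (comb b) /\
  exists2 p, p \in D ++ take k (comb b) & nth (0, 0) (comb b) k \in neighbors p.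
Proof.
move=> bD Db; apply: grows_nth; case: b bD Db => X Y bD Db.
rewrite /comb -cat1s; cbn [fst snd]; apply/grows_cat; split; first split=> //.
  - by apply/negP => /Db /=; lia.
  - by exists (X, Y) => //; rewrite !inE /= eqxx.
apply/grows_cat; split.
  apply: grows_run.
  - move=> u _; rewrite mem_cat negb_or; apply/andP; split.
      by apply/negP => /Db /=; lia.
    by rewrite inE -pair_eqE /=; lia.
  - by move=> u v _ _ [/addrI[]].
  - by move=> u _; rewrite !inE -!pair_eqE /=; lia.
  - exists (X + 1, Y); first by rewrite mem_cat inE eqxx orbT.
    by rewrite !inE -!pair_eqE /=; lia.
(* Induction on the teeth still to come; of the current domain E it is only kept that it contains
   the spine and none of these teeth. *)
set E := (D ++ [:: _]) ++ map _ _.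
have ED (u v : int) : 0 < u -> ((X + 2 + u, v) : int * int) \notin E.
  move=> u0; rewrite /E mem_cat negb_or mem_cat negb_or mem_seq1 -andbA; apply/and3P; split.
  - by apply/negP => /Db; cbn [fst snd]; lia.
  - by rewrite xpair_eqE; lia.
  - by apply/negP => /mapP[w _ [+ _]]; lia.
have ES u : (u < (2 * n).+1)%N -> ((X + 2, Y + u%:Z) : int * int) \in E.
  move=> un; rewrite /E mem_cat; apply/orP; right; apply/mapP; exists u => //.
  by rewrite mem_iota.
have : forall m, m \in iota 0 n.+1 -> (m < n.+1)%N by move=> m; rewrite mem_iota.
have : uniq (iota 0 n.+1) by exact: iota_uniq.
have EP (u : int) m : m \in iota 0 n.+1 -> 0 < u -> ((X + 2 + u, Y + (2 * m)%N%:Z) : int * int) \notin E.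
  by move=> _; exact: ED.
move: E ES EP {ED}; elim: (iota 0 n.+1) => [//|m s IH] E ES EP /= /andP[ms us] sn.
apply/grows_cat; split.
  apply: grows_run.
  - by move=> u; rewrite mem_iota => /andP[u0 _]; apply: EP; rewrite ?inE ?eqxx//; lia.
  - by move=> u v _ _ [/addrI[]].
  - by move=> u _; rewrite !inE -!pair_eqE /=; lia.
  - exists (X + 2, Y + (2 * m)%N%:Z).
      by apply: ES; have := sn m; rewrite inE eqxx => /(_ isT); lia.
    by rewrite !inE -!pair_eqE /=; lia.
apply: IH => //.
- by move=> u un; rewrite mem_cat ES.
- move=> u m' m's u0; rewrite mem_cat negb_or EP ?inE ?m's ?orbT//=.
  apply/negP => /mapP[w _ [_ /addrI]] e; move: ms; have -> : m = m' by lia.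
  by rewrite m's.
- by move=> m' m's; apply: sn; rewrite inE m's orbT.
Qed.

End Comb.

(** * Laplacians on a domain with a comb attached *)

Definition lap (D : seq (int * int)) (f : int * int -> int) (x : int * int) : int :=
  \sum_(y <- neighbors x | y \in D) (f y - f x).

Lemma lapE D f (a b : int) : lap D f (a, b) =
  (if (a + 1, b) \in D then f (a + 1, b) - f (a, b) else 0) +
  (if (a - 1, b) \in D then f (a - 1, b) - f (a, b) else 0) +
  (if (a, b + 1) \in D then f (a, b + 1) - f (a, b) else 0) +
  (if (a, b - 1) \in D then f (a, b - 1) - f (a, b) else 0).
Proof.
rewrite /lap /neighbors !big_cons big_nil /=.
by do 4![case: ifP => _]; rewrite ?addr0 ?add0r ?addrA.
Qed.

Section CombLaplacian.
Variables (n g : nat).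
Hypothesis g0 : (0 < g)%N.
Variables (D : seq (int * int)) (X Y : int).
Hypothesis bD : (X, Y) \in D.
Hypothesis Db : forall a b : int, (a, b) \in D -> a <= X.

Let F := D ++ comb n g (X, Y).

Lemma mem_fullE (a b : int) : ((a, b) \in F) =
  if a <= X then (a, b) \in D else in_comb n g (a - X) (b - Y).
Proof.
rewrite mem_cat mem_comb//; cbn [fst snd]; have [aX|aX] := boolP (a <= X).
  have -> : in_comb n g (a - X) (b - Y) = false by rewrite /in_comb; lia.
  by rewrite orbF.
by case: (boolP ((a, b) \in D)) => // /Db; rewrite (negbTE aX).
Qed.

(** The only edge between D and the comb joins base and neck: D ends at column X, and column X + 1
    of the comb consists of the neck. *)
Lemma lap_old f (a b : int) : (a, b) \in D -> (a, b) != (X, Y) ->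
  lap F f (a, b) = lap D f (a, b).
Proof.
move=> abD; rewrite xpair_eqE => ab; have aX := Db abD.
rewrite !lapE; congr (_ + _ + _ + _); rewrite mem_fullE; last 3 first.
- by have -> : a - 1 <= X by lia.
- by rewrite aX.
- by rewrite aX.
have [//|a1] := boolP (a + 1 <= X).
have -> : in_comb n g (a + 1 - X) (b - Y) = false by rewrite /in_comb; lia.
by case: ifP => // /Db; rewrite (negbTE a1).
Qed.

Lemma lap_base f : lap F f (X, Y) = lap D f (X, Y) + (f (X + 1, Y) - f (X, Y)).
Proof.
rewrite !lapE !mem_fullE !lexx.
have -> : (X + 1 <= X) = false by lia.
have -> : X - 1 <= X by lia.
have -> : in_comb n g (X + 1 - X) (Y - Y) by rewrite /in_comb; lia.
have -> : ((X + 1, Y) \in D) = false.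
  by apply/negP => /Db; lia.
by rewrite /= add0r; ring.
Qed.

(** Here h is f in coordinates relative to the base, whose value is h 0 0. Off the neck, the four
    terms belong to the neighbours on the right, on the left, above and below. *)
Lemma lap_comb f (h : int -> int -> int) (i j : int) :
  (forall i j, in_comb n g i j -> f (X + i, Y + j) = h i j) -> f (X, Y) = h 0 0 ->
  in_comb n g i j -> lap F f (X + i, Y + j) =
  if i == 1 then h 2 0 + h 0 0 - h 1 0 * 2 else
  (if (i < g%:Z + 2) && ~~ odd `|j|%N then h (i + 1) j - h i j else 0) +
  (if (2 < i) || (j == 0) then h (i - 1) j - h i j else 0) +
  (if (i == 2) && (j < (2 * n)%N%:Z) then h 2 (j + 1) - h 2 j else 0) +
  (if (i == 2) && (0 < j) then h 2 (j - 1) - h 2 j else 0).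
Proof.
move=> fh fb ij.
have cE k l : in_comb n g k l -> (((X + k, Y + l) : int * int) \in F) = true.
  move=> kl; rewrite mem_fullE ifF ?[X + k]addrC ?[Y + l]addrC ?addrK//.
  by move: kl; rewrite /in_comb; lia.
have nE k l : 0 < k -> in_comb n g k l = false -> (((X + k, Y + l) : int * int) \in F) = false.
  by move=> k0 kl; rewrite mem_fullE ifF ?[X + k]addrC ?[Y + l]addrC ?addrK//; lia.
rewrite lapE -!addrA.
rewrite (fh i j ij).
case: eqP => [i1|i1].
  have j0 : j = 0 by move: ij; rewrite /in_comb; lia.
  have c2 : in_comb n g 2 0 by rewrite /in_comb; lia.
  have c1 : in_comb n g 1 0 by rewrite /in_comb; lia.
  have bF : (((X + (1 - 1), Y + 0) : int * int) \in F) = true.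
    by rewrite subrr !addr0 mem_fullE lexx.
  subst i j; rewrite (cE (1 + 1))// (fh (1 + 1))// bF.
  rewrite [f (X + (1 - 1), _)](_ : _ = h 0 0); last by rewrite subrr !addr0.
  rewrite !nE; [|by []|by rewrite /in_comb; lia|by []|by rewrite /in_comb; lia].
  by rewrite -[1 + 1]/(2 : int); ring.
have i2 : 2 <= i by move: ij i1; rewrite /in_comb; lia.
congr (_ + (_ + (_ + _))).
- case: (boolP (in_comb n g (i + 1) j)) => c.
    by rewrite cE// fh// ifT//; move: c i1 ij; rewrite /in_comb; lia.
  by rewrite nE ?ifF//; [move: c ij; rewrite /in_comb|lia|exact/negbTE]; lia.
- case: (boolP (in_comb n g (i - 1) j)) => c.
    by rewrite cE// fh// ifT//; move: c i1 ij; rewrite /in_comb; lia.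
  by rewrite nE ?ifF//; [move: c ij; rewrite /in_comb|lia|exact/negbTE]; lia.
- case: (boolP (in_comb n g i (j + 1))) => c.
    rewrite cE// fh// ifT//; last by move: c i1 ij; rewrite /in_comb; lia.
    by have -> : i = 2 by move: c i1 ij; rewrite /in_comb; lia.
  by rewrite nE ?ifF//; [move: c ij; rewrite /in_comb|lia|exact/negbTE]; lia.
case: (boolP (in_comb n g i (j - 1))) => c.
  rewrite cE// fh// ifT//; last by move: c i1 ij; rewrite /in_comb; lia.
  by have -> : i = 2 by move: c i1 ij; rewrite /in_comb; lia.
by rewrite nE ?ifF//; [move: c ij; rewrite /in_comb|lia|exact/negbTE]; lia.
Qed.

End CombLaplacian.

(** The height [phi] acts as the potential of a unit flow between the origin and b: it is
    subharmonic except at b, where at most one unit is lost. The function [rk] certifies that b can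
    be reached from every site within r steps. *)
Record geometry (D : seq (int * int)) (b : int * int) (phi : int * int -> int)
    (len : int) (rk : int * int -> nat) (r : nat) : Prop := Geometry {
  base_in : b \in D;
  origin_in : (0, 0) \in D;
  base_right : forall a c : int, (a, c) \in D -> a <= b.1;
  phi_origin : phi (0, 0) = 0;
  phi_base : phi b = len;
  phi_range : forall x, x \in D -> 0 <= phi x <= len;
  phi_step : forall x y, x \in D -> y \in D -> y \in neighbors x -> -1 <= phi y - phi x <= 1;
  phi_lap : forall x, x \in D -> x != b -> 0 <= lap D phi x;
  phi_lap_base : -1 <= lap D phi b;
  rank_le : forall x, x \in D -> (rk x <= r)%N;
  rank_step : forall x, x \in D -> x != b ->
    exists y, [/\ y \in D, y \in neighbors x & (rk y < rk x)%N] }.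

Lemma neighborsP (a b c d : int) : ((c, d) \in neighbors (a, b)) =
  ((c == a) && ((d == b + 1) || (d == b - 1))) || ((d == b) && ((c == a + 1) || (c == a - 1))).
Proof. by rewrite /neighbors !inE !xpair_eqE /=; lia. Qed.

Section Extension.
Variables (n g : nat).
Hypothesis g0 : (0 < g)%N.
Variables (D : seq (int * int)) (X Y : int) (phi : int * int -> int) (len : int).
Variables (rk : int * int -> nat) (r : nat).
Hypothesis geo : geometry D (X, Y) phi len rk r.

Let F := D ++ comb n g (X, Y).

Let bD : (X, Y) \in D. Proof. exact: base_in geo. Qed.
Let Db (a b : int) : (a, b) \in D -> a <= X.
Proof. by move=> /(base_right geo). Qed.

Let len0 : 0 <= len.
Proof. by have /andP[_] := phi_range geo bD; rewrite (phi_base geo) => h; have := phi_range geo (origin_in geo); rewrite (phi_origin geo). Qed.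

Section Target.
Variable m : nat.
Hypothesis mn : (m <= n)%N.

Definition target (b : int * int) : int * int := (b.1 + 2 + g%:Z, b.2 + (2 * m)%N%:Z).

Let ph (i j : int) : int := Num.min i 2 + Num.min j (2 * m)%N%:Z +
  (if j == (2 * m)%N%:Z then Num.max (i - 2) 0 else 0).

(** The flow is prolonged to the tip of tooth m: the potential grows linearly along neck, spine and
    tooth m, and is constant on everything that branches off. *)
Definition phi_ext (b : int * int) (phi : int * int -> int) (len : int) (y : int * int) : int :=
  if y.1 <= b.1 then phi y else
  let i := y.1 - b.1 in let j := y.2 - b.2 in
  len + (Num.min i 2 + Num.min j (2 * m)%N%:Z +
  (if j == (2 * m)%N%:Z then Num.max (i - 2) 0 else 0)).

Definition len_ext : int := len + 2 + (2 * m)%N%:Z + g%:Z.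

Let f := phi_ext (X, Y) phi len.

Let f_comb i j : in_comb n g i j -> f (X + i, Y + j) = len + ph i j.
Proof.
move=> ij; rewrite /f /phi_ext; cbn [fst snd].
have -> : (X + i <= X) = false by move: ij; rewrite /in_comb; lia.
by rewrite ![X + i]addrC ![Y + j]addrC !addrK.
Qed.

Let f_old (a b : int) : a <= X -> f (a, b) = phi (a, b).
Proof. by move=> aX; rewrite /f /phi_ext /= aX. Qed.

Let f_base : f (X, Y) = len + ph 0 0.
Proof.
rewrite f_old// (phi_base geo) /ph; have -> : Num.min 0 2 = 0 :> int by lia.
have -> : Num.min 0 (2 * m)%N%:Z = 0 :> int by lia.
by case: ifP => _; lia.
Qed.

Let lap_comb_phi i j : in_comb n g i j ->
  lap F f (X + i, Y + j) = if (i == g%:Z + 2) && (j == (2 * m)%N%:Z) then -1 else 0.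
Proof.
move=> ij; rewrite (lap_comb g0 bD Db f_comb f_base ij) /ph.
move: ij mn g0; rewrite /in_comb; clear.
case: eqP => [->|i1] ij mn g0.
  have -> : j = 0 by lia.
  by repeat (case: ifP => ?); lia.
Time by repeat (case: ifP => ?; try by lia); lia.
Qed.

(** On the comb, the length of the way to the tip of tooth m; old sites have to get to the base
    first. *)
Definition rank_ext (b : int * int) (rk : int * int -> nat) (y : int * int) : nat :=
  if y.1 <= b.1 then (rk y + 2 + 2 * m + g)%N else
  let i := y.1 - b.1 in let j := y.2 - b.2 in
  if i == 1 then (1 + 2 * m + g)%N else
  if j == (2 * m)%N%:Z then absz (g%:Z + 2 - i)%R else (absz (i - 2)%R + absz (j - (2 * m)%N%:Z)%R + g)%N.

Let caseF (a b : int) : (a, b) \in F -> (a, b) \in D \/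
  exists i j, [/\ in_comb n g i j, a = X + i & b = Y + j].
Proof.
rewrite mem_cat mem_comb// => /orP[|ab]; [by left|right; exists (a - X), (b - Y)].
by split; rewrite // addrC subrK.
Qed.

Let memF i j : in_comb n g i j -> ((X + i, Y + j) : int * int) \in F.
Proof. by move=> ij; rewrite mem_cat mem_comb//; cbn [fst snd]; rewrite ![_ + i]addrC ![_ + j]addrC !addrK ij orbT. Qed.

Let rk_comb i j : in_comb n g i j -> rank_ext (X, Y) rk (X + i, Y + j) =
  if i == 1 then (1 + 2 * m + g)%N else
  if j == (2 * m)%N%:Z then absz (g%:Z + 2 - i)%R else (absz (i - 2)%R + absz (j - (2 * m)%N%:Z)%R + g)%N.
Proof.
move=> ij; rewrite /rank_ext; cbn [fst snd].
have -> : (X + i <= X) = false by move: ij; rewrite /in_comb; lia.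
by rewrite ![X + i]addrC ![Y + j]addrC !addrK.
Qed.

Let rk_old (a b : int) : a <= X -> rank_ext (X, Y) rk (a, b) = (rk (a, b) + 2 + 2 * m + g)%N.
Proof. by move=> aX; rewrite /rank_ext /= aX. Qed.

Let stepF (x1 x2 y1 y2 : int) : (x1, x2) \in F -> (y1, y2) \in F ->
  (y1, y2) \in neighbors (x1, x2) -> -1 <= f (y1, y2) - f (x1, x2) <= 1.
Proof.
move=> /caseF[xD|[i [j [ij -> ->]]]] /caseF[yD|[k [l [kl -> ->]]]] xy.
- by rewrite !f_old ?(Db xD) ?(Db yD)//; exact: (phi_step geo).
- have xX := Db xD; have [k1 l0 ex ey] : [/\ k = 1, l = 0, x1 = X & x2 = Y].
    by move: xy kl; rewrite neighborsP /in_comb => h1 h2; split; lia.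
  move: kl; rewrite k1 l0 => kl; rewrite f_comb// ex ey f_base /ph.
  by repeat (case: ifP => ?); lia.
- have yX := Db yD; have [k1 l0 ex ey] : [/\ i = 1, j = 0, y1 = X & y2 = Y].
    by move: xy ij; rewrite neighborsP /in_comb => h1 h2; split; lia.
  move: ij; rewrite k1 l0 => kl; rewrite f_comb// ex ey f_base /ph.
  by repeat (case: ifP => ?); lia.
rewrite !f_comb// /ph; move: mn ij kl xy g0; rewrite /in_comb neighborsP; clear.
by repeat (case: ifP => ?); lia.
Qed.

Let rangeF (x1 x2 : int) : (x1, x2) \in F -> 0 <= f (x1, x2) <= len_ext.
Proof.
move=> /caseF[xD|[i [j [ij -> ->]]]].
  by rewrite f_old ?(Db xD)//; have := phi_range geo xD; rewrite /len_ext; lia.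
rewrite f_comb// /ph /len_ext; move: mn ij len0; rewrite /in_comb; clear.
by case: ifP => ?; lia.
Qed.

Let lapF (x1 x2 : int) : (x1, x2) \in F ->
  (if (x1, x2) == target (X, Y) then -1 else 0) <= lap F f (x1, x2).
Proof.
move=> /caseF[xD|[i [j [ij -> ->]]]]; last first.
  rewrite lap_comb_phi// /target xpair_eqE; cbn [fst snd].
  have -> : (X + i == X + 2 + g%:Z) && (Y + j == Y + (2 * m)%N%:Z) =
    (i == g%:Z + 2) && (j == (2 * m)%N%:Z) by lia.
  by [].
have xX := Db xD; rewrite ifF; last first.
  by rewrite /target xpair_eqE; cbn [fst snd]; lia.
have [->|xb] := eqVneq (x1, x2) (X, Y).
  rewrite (lap_base n g0 bD Db).
  have c1 : in_comb n g 1 0 by rewrite /in_comb; lia.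
  have := f_comb c1; rewrite addr0 => ->; rewrite f_base.
  have -> : lap D f (X, Y) = lap D phi (X, Y).
    rewrite !lapE; congr (_ + _ + _ + _); case: ifP => // h;
      rewrite !f_old//; exact: (Db h).
  have := phi_lap_base geo; rewrite /ph; move: (lap _ _ _) => z; move: mn; clear.
  by repeat (case: ifP => ?); lia.
rewrite (lap_old n g0 bD Db)//.
have -> : lap D f (x1, x2) = lap D phi (x1, x2).
  rewrite !lapE; congr (_ + _ + _ + _); case: ifP => // h;
      rewrite !f_old//; exact: (Db h).
exact: (phi_lap geo).
Qed.

Let rankF (x1 x2 : int) : (x1, x2) \in F ->
  (rank_ext (X, Y) rk (x1, x2) <= r + 2 + 2 * n + 2 * g)%N.
Proof.
move=> /caseF[xD|[i [j [ij -> ->]]]].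
  by rewrite rk_old ?(Db xD)//; have := rank_le geo xD; move: mn; clear; lia.
rewrite rk_comb//; move: mn ij g0; rewrite /in_comb; clear.
by repeat (case: ifP => ?); lia.
Qed.

Let down (x1 x2 : int) : (x1, x2) \in F -> (x1, x2) != target (X, Y) ->
  exists y, [/\ y \in F, y \in neighbors (x1, x2) &
    (rank_ext (X, Y) rk y < rank_ext (X, Y) rk (x1, x2))%N].
Proof.
have c1 : in_comb n g 1 0 by rewrite /in_comb; lia.
move=> /caseF[xD _|[i [j [ij -> ->]]]].
  have xX := Db xD; have [[-> ->]|xb] := eqVneq (x1, x2) (X, Y).
    exists (X + 1, Y + 0); split; first exact: memF.
      by rewrite neighborsP; lia.
    by rewrite rk_comb// rk_old// eqxx; clear; lia.
  have [[y1 y2] [yD yn yr]] := rank_step geo xD xb; exists (y1, y2); split=> //.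
    by rewrite mem_cat yD.
  by rewrite !rk_old ?(Db xD) ?(Db yD)// !ltn_add2r.
rewrite /target xpair_eqE; cbn [fst snd] => xt.
suff [k [l [kl nb rl]]] : exists k l, [/\ in_comb n g k l,
    ((k == i) && ((l == j + 1) || (l == j - 1))) || ((l == j) && ((k == i + 1) || (k == i - 1))) &
    (rank_ext (X, Y) rk (X + k, Y + l)%R < rank_ext (X, Y) rk (X + i, Y + j)%R)%N].
  exists (X + k, Y + l); split=> //; first exact: memF.
  by rewrite neighborsP; lia.
have [i1|i1] := eqVneq i 1.
  have c2 : in_comb n g 2 0 by move: mn; rewrite /in_comb; lia.
  exists 2, 0; split=> //; first by move: ij; rewrite i1 /in_comb; lia.
  rewrite !rk_comb// i1 eqxx; move: mn; clear; repeat (case: ifP => ?); lia.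
have [jm|jm] := eqVneq j (2 * m)%N%:Z.
  have c2 : in_comb n g (i + 1) j by move: mn ij i1 xt; rewrite jm /in_comb; clear; lia.
  exists (i + 1), j; split=> //; first by lia.
  rewrite !rk_comb// jm eqxx; move: mn c2 ij i1 xt; rewrite jm /in_comb; clear; repeat (case: ifP => ?); lia.
have [i2|i2] := eqVneq i 2.
  have [jl|jl] := leP (2 * m)%N%:Z j.
    have c2 : in_comb n g 2 (j - 1) by move: mn ij jm jl; rewrite i2 /in_comb; clear; lia.
    exists 2, (j - 1); split=> //; first by lia.
    rewrite !rk_comb// i2; move: jm jl c2; rewrite /in_comb; clear; repeat (case: ifP => ?); lia.
  have c2 : in_comb n g 2 (j + 1) by move: mn ij jm jl; rewrite i2 /in_comb; clear; lia.
  exists 2, (j + 1); split=> //; first by lia.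
  rewrite !rk_comb// i2; move: jm jl c2; rewrite /in_comb; clear; repeat (case: ifP => ?); lia.
have c2 : in_comb n g (i - 1) j by move: mn ij jm i1 i2; rewrite /in_comb; clear; lia.
exists (i - 1), j; split=> //; first by lia.
rewrite !rk_comb//; move: jm i1 i2 c2 ij; rewrite /in_comb; clear; repeat (case: ifP => ?); lia.
Qed.

(** The induction step of the construction: the tip of any tooth can serve as the next base. *)
Lemma geometry_extend : geometry F (target (X, Y)) f len_ext (rank_ext (X, Y) rk)
  (r + 2 + 2 * n + 2 * g).
Proof.
have ct : in_comb n g (g%:Z + 2) (2 * m)%N%:Z by move: mn g0; rewrite /in_comb; clear; lia.
have tE : target (X, Y) = (X + (g%:Z + 2), Y + (2 * m)%N%:Z).
  by rewrite /target; cbn [fst snd]; congr pair; clear; lia.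
have tF : target (X, Y) \in F by rewrite tE; exact: memF.
split=> //.
- by rewrite mem_cat (origin_in geo).
- move=> a c /caseF[/Db|[i [j [ij -> _]]]]; rewrite /target; cbn [fst snd]; first by lia.
  by move: ij; rewrite /in_comb; lia.
- by rewrite f_old ?(phi_origin geo)//; exact: Db (origin_in geo).
- rewrite tE f_comb// /ph /len_ext eqxx; clear; lia.
- by move=> [x1 x2]; exact: rangeF.
- by move=> [x1 x2] [y1 y2]; exact: stepF.
- by move=> [x1 x2] xF xt; have := lapF xF; rewrite (negbTE xt).
- by have := lapF tF; rewrite eqxx.
- by move=> [x1 x2]; exact: rankF.
- by move=> [x1 x2]; exact: down.
Qed.

End Target.
End Extension.

(** * Reaching a tip before the origin *)

Section Escape.
Variables (n g : nat).
Hypothesis g0 : (0 < g)%N.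
Variables (D : seq (int * int)) (X Y : int) (phi : int * int -> int) (len : int).
Variables (rk : int * int -> nat) (r : nat).
Hypothesis geo : geometry D (X, Y) phi len rk r.

Let F := D ++ comb n g (X, Y).

Let bD : (X, Y) \in D. Proof. exact: base_in geo. Qed.
Let Db (a b : int) : (a, b) \in D -> a <= X.
Proof. by move=> /(base_right geo). Qed.

Fixpoint spine_sum (u : nat) : nat := if u is v.+1 then (spine_sum v + v./2 + 1)%N else 0%N.

(** The increment from row j + 1 down to row j is the number of teeth above row j
    ([spine_value_step]). *)
Definition spine_value (j : int) : int := (g + spine_sum (absz ((2 * n)%N%:Z - j)%R))%N%:Z.

(** Superharmonic off the tips and zero at them, so that its quotient by the value at the origin
    bounds the probability of reaching the origin before a tip. Each of the n + 1 teeth drains at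
    least g, so a flow g (n + 1) is prescribed through the neck, and this is the slope with respect
    to [phi] on the old domain. *)
Definition escape (b : int * int) (phi : int * int -> int) (len : int) (y : int * int) : int :=
  let t := spine_value 0 in let i := y.1 - b.1 in
  if y.1 <= b.1 then g%:Z * (t + (n.+1)%:Z * (2 + len - phi y)) else
  if i == 1 then g%:Z * (t + (n.+1)%:Z) else (g%:Z + 2 - i) * spine_value (y.2 - b.2).

Let h (i j : int) : int := if i == 0 then g%:Z * (spine_value 0 + (n.+1)%:Z * 2) else
  if i == 1 then g%:Z * (spine_value 0 + (n.+1)%:Z) else (g%:Z + 2 - i) * spine_value j.

Let h00 : h 0 0 = g%:Z * (spine_value 0 + (n.+1)%:Z * 2). Proof. by []. Qed.
Let h1 j : h 1 j = g%:Z * (spine_value 0 + (n.+1)%:Z). Proof. by []. Qed.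
Let h2 i j : 2 <= i -> h i j = (g%:Z + 2 - i) * spine_value j.
Proof.
move=> i2; rewrite /h; have -> : (i == 0) = false by lia.
by have -> : (i == 1) = false by lia.
Qed.

Let f := escape (X, Y) phi len.

Let f_comb i j : in_comb n g i j -> f (X + i, Y + j) = h i j.
Proof.
move=> ij; rewrite /f /escape; cbn [fst snd].
have -> : (X + i <= X) = false by move: ij; rewrite /in_comb; lia.
rewrite ![X + i]addrC ![Y + j]addrC !addrK /h.
by have -> : (i == 0) = false by move: ij; rewrite /in_comb; clear; lia.
Qed.

Let f_old (a b : int) : a <= X ->
  f (a, b) = g%:Z * (spine_value 0 + (n.+1)%:Z * (2 + len - phi (a, b))).
Proof. by move=> aX; rewrite /f /escape /= aX. Qed.

Let f_base : f (X, Y) = h 0 0.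
Proof. by rewrite f_old// (phi_base geo) /h eqxx addrK. Qed.

Let spine_value_step (j : int) : 0 <= j < (2 * n)%N%:Z ->
  spine_value j = spine_value (j + 1) + (n%:Z - (absz j)./2%N%:Z).
Proof.
move=> jn; rewrite /spine_value.
have [u uE jE] : exists2 u : nat, absz ((2 * n)%N%:Z - j)%R = u.+1 & absz ((2 * n)%N%:Z - (j + 1))%R = u.
  by exists (absz ((2 * n)%N%:Z - (j + 1))%R); lia.
rewrite uE jE /=; move: (spine_sum u) => s; lia.
Qed.

Let spine_value_ge j : g%:Z <= spine_value j.
Proof. by rewrite /spine_value lez_nat leq_addr. Qed.

Lemma lap_escape_old (a b : int) : (a, b) \in D -> lap D f (a, b) =
  - (g%:Z * (n.+1)%:Z) * lap D phi (a, b).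
Proof.
move=> abD; rewrite /lap mulr_sumr; apply: eq_bigr => -[u v] uvD.
by rewrite !f_old ?(Db abD) ?(Db uvD)//; ring.
Qed.

Lemma escape_super x : x \in F -> x.1 != X + 2 + g%:Z -> lap F f x <= 0.
Proof.
case: x => a b; cbn [fst].
rewrite mem_cat mem_comb// => /orP[xD _|]; last first.
  cbn [fst snd] => ij ai.
  have -> : (a, b) = (X + (a - X), Y + (b - Y)) by rewrite ![_ + (_ - _)]addrC !subrK.
  have : a - X != g%:Z + 2 by apply: contraNneq ai; lia.
  move: (a - X) (b - Y) ij => i j ij {ai} ig.
  rewrite (lap_comb g0 bD Db f_comb f_base ij).
  have [i1|i1] := eqVneq i 1.
    by rewrite h00 h1 h2// -subr_ge0 le_eqVlt; apply/orP; left; apply/eqP; ring.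
  have [i2|i2] := eqVneq i 2; last first.
    have [i3 i4] : 3 <= i /\ i < g%:Z + 2 by move: ij ig i1 i2; rewrite /in_comb; clear; lia.
    have oj : ~~ odd (absz j) by move: ij i3; rewrite /in_comb; clear; lia.
    have -> : 2 < i by lia.
    rewrite oj i4 /= !addr0 !h2; [|lia..].
    by rewrite -subr_ge0 le_eqVlt; apply/orP; left; apply/eqP; ring.
  move: ij; rewrite i2 ltxx /= => {i i1 i2 ig} ij.
  have jn : 0 <= j <= (2 * n)%N%:Z by move: ij; rewrite /in_comb; clear; lia.
  have -> : 2 < g%:Z + 2 by lia.
  have hE (k : int) : h 2 k = g%:Z * spine_value k by rewrite h2//; congr (_ * _); lia.
  rewrite !hE h1 h2//.
  set A := (if ~~ _ then _ else _); set B := (if _ == 0 then _ else _).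
  set C := (if _ < _ then _ else _); set E := (if 0 < j then _ else _).
  have AE : A = if odd (absz j) then 0 else - spine_value j.
    by rewrite /A; case: (odd _) => //=; ring.
  have BE : B = if j == 0 then g%:Z * (n.+1)%:Z else 0 by rewrite /B; case: eqP => // ->; ring.
  have CE : C = if j < (2 * n)%N%:Z then - (g%:Z * (n%:Z - (absz j)./2%N%:Z)) else 0.
    by rewrite /C; case: ifP => // jl; rewrite [spine_value j]spine_value_step; [ring|lia].
  have EE : E = if 0 < j then g%:Z * (n%:Z - (absz (j - 1)%R)./2%N%:Z) else 0.
    rewrite /E; case: ifP => // jl; rewrite [spine_value (j - 1)]spine_value_step; last lia.
    by rewrite subrK; ring.
  rewrite AE BE CE EE => {A B C E AE BE CE EE}.
  (* Flow balance on the spine: at odd rows inflow and outflow agree; at even rows the inflow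
     exceeds the outflow upwards by g, and the tooth takes [spine_value j], which is at least g. *)
  have := spine_value_ge j; move: (spine_value j) jn => s; clear.
  have [jo|jo] := boolP (odd (absz j)) => jn gs.
    have -> : j < (2 * n)%N%:Z by lia.
    have -> : 0 < j by lia.
    have -> : (j == 0) = false by lia.
    have -> : (absz (j - 1)%R)./2 = (absz j)./2 by lia.
    by rewrite !add0r addNr.
  have [->|j0] := eqVneq j 0.
    rewrite ltxx addr0 /= subr0 (_ : n.+1%:Z = n%:Z + 1) ?mulrDr ?mulr1; last lia.
    case: ltP => n0; first by move: gs; move: (_ * _) => z; lia.
    have -> : n%:Z = 0 by lia.
    by rewrite mulr0; lia.
  have -> : 0 < j by lia.
  have [v ve] : exists v, (absz j)./2 = v.+1 by exists ((absz j)./2.-1); lia.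
  have -> : (absz (j - 1)%R)./2 = v by lia.
  rewrite ve addr0; case: ltP => jl.
    have -> : n%:Z - v%:Z = n%:Z - v.+1%:Z + 1 by lia.
    by rewrite [g%:Z * (_ + 1)]mulrDr mulr1; move: (_ * _) => z; lia.
  have -> : n%:Z - v%:Z = 1 by lia.
  by rewrite mulr1; lia.
have gn : 0 <= g%:Z * (n.+1)%:Z by rewrite mulr_ge0.
have [[-> ->]|xb] := eqVneq (a, b) (X, Y).
  (* At the base the neck takes away g (n + 1), which covers the defect of [phi] there. *)
  rewrite (lap_base n g0 bD Db) lap_escape_old//.
  have c1 : in_comb n g 1 0 by rewrite /in_comb; lia.
  have := f_comb c1; rewrite addr0 => ->; rewrite f_base h00 h1.
  have := ler_wpM2l gn (phi_lap_base geo); rewrite mulNr mulrDr; move: (lap _ _ _) => z; lia.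
rewrite (lap_old n g0 bD Db)// lap_escape_old// mulNr oppr_le0 mulr_ge0//.
exact: (phi_lap geo).
Qed.

Lemma escape_ge0 x : x \in F -> 0 <= f x.
Proof.
case: x => a b.
rewrite mem_cat mem_comb// => /orP[xD|].
  rewrite f_old ?(Db xD)//; have := phi_range geo xD; have := spine_value_ge 0 => s0 pr.
  apply: mulr_ge0 => //; apply: addr_ge0; first by [].
  by apply: mulr_ge0 => //; move: pr; move: (phi _) => z; lia.
cbn [fst snd] => ij.
have -> : (a, b) = (X + (a - X), Y + (b - Y)) by rewrite ![_ + (_ - _)]addrC !subrK.
rewrite f_comb//; move: (a - X) (b - Y) ij => i j ij.
have [->|i1] := eqVneq i 1; first by rewrite h1 mulr_ge0// addr_ge0.
rewrite h2; last by move: ij i1; rewrite /in_comb; lia.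
by apply: mulr_ge0 => //; move: ij; rewrite /in_comb; lia.
Qed.

Lemma escape_target m : f (target g m (X, Y)) = 0.
Proof.
rewrite /f /escape /target; cbn [fst snd].
have -> : (X + 2 + g%:Z <= X) = false by clear; lia.
have -> : (X + 2 + g%:Z - X == 1) = false by clear; lia.
by rewrite [X in X * _](_ : _ = 0) ?mul0r//; ring.
Qed.

Lemma escape_origin : f (0, 0) = g%:Z * (spine_value 0 + (n.+1)%:Z * (2 + len)).
Proof. by rewrite f_old ?(Db (origin_in geo))// (phi_origin geo) subr0. Qed.

Lemma escape_start : f (X, Y) = g%:Z * (spine_value 0 + (n.+1)%:Z * 2).
Proof. by rewrite f_base. Qed.

Lemma spine_value0 : spine_value 0 = g%:Z + n%:Z * n.+1%:Z.
Proof.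
rewrite /spine_value subr0 absz_nat PoszD; congr (_ + _).
suff -> : spine_sum (2 * n) = (n * n.+1)%N by rewrite PoszM.
clear; elim: n => [//|k IH]; have -> : (2 * k.+1 = (2 * k).+2)%N by lia.
by rewrite /= IH; lia.
Qed.

End Escape.

(** * The comb strategy *)

Record cfg := Cfg {
  stage : nat;
  time : nat;
  here : int * int;
  base : int * int;
  olds : seq (int * int);
  height : int * int -> int;
  dist : int;
  rank : int * int -> nat;
  fresh : bool;
  seen : bool;
  hit : option nat }.

Section CombAutomaton.
Variable C : nat.
Implicit Types (c : cfg) (y : int * int) (k : nat).

(** The scales are chosen so that 2 ^ k teeth in parallel outweigh a way back to the origin of
    length at least 4 ^ (k - 1), the tooth length 4 ^ k outweighs the diffusive scale 8 ^ (k / 2) of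
    the waiting time, and the waiting time is of order C times the size of the next comb. *)
Definition width k : nat := (2 ^ k).-1.
Definition tooth k : nat := (4 ^ k)%N.
Definition patience k : nat := (C * 8 ^ k.+1)%N.

Definition teeth c := comb (width (stage c)) (tooth (stage c)) (base c).
Definition region c := olds c ++ teeth c.

(** [fresh] marks the first time of a stage, at which the whole comb is probed. *)
Definition comb_plan c := if fresh c then teeth c else [::].
Definition comb_dom c := if fresh c then olds c else region c.

Definition at_target c y : bool := y.1 == (base c).1 + 2 + (tooth (stage c))%:Z.

Definition tooth_index c y : nat := (absz (y.2 - (base c).2)%R)./2.

Definition next_height c m := phi_ext m (base c) (height c) (dist c).
Definition next_dist c m := len_ext (tooth (stage c)) (dist c) m.
Definition next_rank c m := rank_ext (tooth (stage c)) m (base c) (rank c).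

Definition next_stage c y : cfg := let m := tooth_index c y in
  Cfg (stage c).+1 (time c).+1 y y (region c) (next_height c m) (next_dist c m)
      (next_rank c m) true false None.

(** [seen] leaves out the present position, so that the first visit to the origin in a stage happens
    with the flag still down. [hit] keeps the number of the first tooth whose tip is reached. *)
Definition same_stage c y : cfg :=
  Cfg (stage c) (time c).+1 y (base c) (olds c) (height c) (dist c) (rank c) false
    (seen c || (here c == (0, 0)))
    (if hit c is None then if at_target c y then Some (tooth_index c y) else None else hit c).

Definition ends c y t : bool := at_target c y && (patience (stage c) <= t)%N.

Definition comb_upd c y : cfg :=
  if ends c y (time c).+1 then next_stage c y else same_stage c y.

Definition comb_start : cfg :=
  Cfg 0 0 (0, 0) (0, 0) [:: (0, 0)] (fun=> 0) 0 (fun=> 0%N) true false None.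

Fixpoint max_rank k : nat :=
  if k is j.+1 then (max_rank j + 2 + 2 * width j + 2 * tooth j)%N else 0%N.

Record comb_good c : Prop := CombGood {
  good_geometry : geometry (olds c) (base c) (height c) (dist c) (rank c) (max_rank (stage c));
  good_here : here c \in region c;
  good_hit : forall m, hit c = Some m -> (m <= width (stage c))%N;
  good_unhit : hit c = None -> ~~ at_target c (here c);
  good_running : ~~ ends c (here c) (time c);
  good_time : forall j, stage c = j.+1 -> (patience j <= time c)%N;
  good_dist : forall j, stage c = j.+1 -> (tooth j)%:Z <= dist c }.

Lemma tooth_gt0 k : (0 < tooth k)%N.
Proof. by rewrite expn_gt0. Qed.

Lemma region_full c : full comb_plan comb_dom c = region c.
Proof. by rewrite /full /comb_plan /comb_dom /region; case: fresh; rewrite ?cats0. Qed.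

Lemma mem_exits c y : (y \in exits comb_plan comb_dom here c) =
  (y \in neighbors (here c)) && (y \in region c).
Proof. by rewrite mem_filter region_full andbC. Qed.

Lemma stage_extend c m : comb_good c -> (m <= width (stage c))%N ->
  geometry (region c) (target (tooth (stage c)) m (base c)) (next_height c m)
    (next_dist c m) (next_rank c m) (max_rank (stage c).+1).
Proof.
move=> cg mw; have := good_geometry cg; rewrite /region /teeth /next_height /next_rank.
by case: (base c) => X Y geo; exact: (geometry_extend (tooth_gt0 _) geo mw).
Qed.

Lemma base_maximal c y : comb_good c -> y \in olds c -> y.1 <= (base c).1.
Proof. by move=> cg; case: y => a b /(base_right (good_geometry cg)). Qed.

Lemma at_targetP c y : comb_good c -> y \in region c -> at_target c y ->
  (tooth_index c y <= width (stage c))%N /\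
  y = target (tooth (stage c)) (tooth_index c y) (base c).
Proof.
move=> cg; rewrite mem_cat => /orP[/(base_maximal cg)|].
  by rewrite /at_target; have := tooth_gt0 (stage c); lia.
rewrite mem_comb ?tooth_gt0// /in_comb /at_target /target /tooth_index.
have := tooth_gt0 (stage c); move: (tooth _) (width _) => g n.
case: y (base c) => [a b] [X Y]; cbn [fst snd] => g0 yc at_t; split; first by lia.
by congr pair; lia.
Qed.

Lemma target_at c m : at_target c (target (tooth (stage c)) m (base c)).
Proof. by rewrite /at_target. Qed.

Lemma tooth_index_target c m :
  tooth_index c (target (tooth (stage c)) m (base c)) = m.
Proof. by rewrite /tooth_index /target; case: (base c) => X Y; cbn [fst snd]; lia. Qed.

Lemma comb_start_good : comb_good comb_start.
Proof.
split=> //.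
- split=> //.
  + by move=> a c; rewrite inE xpair_eqE => /andP[/eqP-> _].
  + move=> x; rewrite inE => /eqP-> /eqP; by [].
  + by rewrite lapE !inE !xpair_eqE.
  + by move=> x; rewrite inE => /eqP -> /eqP.
Qed.

Lemma base_not_target c : ~~ at_target c (base c).
Proof. by rewrite /at_target; have := tooth_gt0 (stage c); lia. Qed.

Lemma comb_upd_good c y : comb_good c -> y \in exits comb_plan comb_dom here c ->
  comb_good (comb_upd c y).
Proof.
move=> cg; rewrite mem_exits => /andP[yn yr]; rewrite /comb_upd; case: ifPn => ye.
  have /andP[at_y Tt] := ye; have [mw yE] := at_targetP cg yr at_y.
  have geo := stage_extend cg mw; split=> //=.
  - by move: geo; rewrite -yE.
  - by rewrite /region /= mem_cat yr.
  - by move=> _; exact: (base_not_target (next_stage c y)).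
  - by rewrite negb_and (base_not_target (next_stage c y)).
  - by move=> _ [<-].
  - move=> _ [<-]; rewrite /next_dist /len_ext.
    by have := phi_range (good_geometry cg) (base_in (good_geometry cg)); lia.
split=> //=.
- exact: good_geometry cg.
- move=> m; case: (hit c) (good_hit cg) => [m'|] hc; first by move=> [<-]; exact: hc.
  by case: ifP => // at_y [<-]; have [] := at_targetP cg yr at_y.
- by case: (hit c) => //; case: ifPn.
- by move=> j /(good_time cg); lia.
- by move=> j /(good_dist cg).
Qed.

Lemma comb_exits_ex c : comb_good c -> exits comb_plan comb_dom here c != [::].
Proof.
move=> cg; suff [y yn yr] : exists2 y, y \in neighbors (here c) & y \in region c.
  have : y \in exits comb_plan comb_dom here c by rewrite mem_exits yn.
  by case: exits.
have geo := stage_extend cg (leq0n _).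
have [xt|xt] := eqVneq (here c) (target (tooth (stage c)) 0 (base c)); last first.
  by have [y [yr yn _]] := rank_step geo (good_here cg) xt; exists y.
exists ((base c).1 + 1 + (tooth (stage c))%:Z, (base c).2).
  by rewrite xt /target neighborsP; lia.
rewrite mem_cat mem_comb ?tooth_gt0// /in_comb; cbn [fst snd].
by have := tooth_gt0 (stage c); lia.
Qed.

Lemma comb_automaton :
  automaton comb_start comb_upd comb_plan comb_dom here comb_good.
Proof.
split=> //.
- exact: comb_start_good.
- exact: comb_upd_good.
- by move=> c y; rewrite region_full /comb_upd; case: ifP.
- by move=> c y; rewrite /comb_upd; case: ifP.
- move=> c i cg; rewrite /comb_plan /comb_dom; case: fresh => // ic.
  apply: comb_grows => //; first exact: tooth_gt0.
    exact: base_in (good_geometry cg).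
  by move=> p; exact: base_maximal.
- exact: comb_exits_ex.
Qed.

End CombAutomaton.

(** * The Lyapunov function for visits to the origin *)

Section Risk.
Context (R : realType).
Variable C : nat.
Implicit Types (c : cfg) (y : int * int) (k : nat).

Local Notation doors := (exits comb_plan comb_dom here).
Local Notation average_exit := (exit_mean (comb_upd C) comb_plan comb_dom here).

Lemma doors_gt0 c : comb_good C c -> (0 < size (doors c))%N.
Proof. by move=> /comb_exits_ex; case: (doors c). Qed.

(** An affine bound in terms of an integer function f reduces the mean over exits to the Laplacian
    of f; e is the mean increase of f allowed per step. *)
Lemma exit_mean_lap c (F : cfg -> R) (f : int * int -> int) (a b : R) (e : int) :
  comb_good C c -> 0 <= a ->
  (forall y, y \in doors c -> F (comb_upd C c y) <= a * (f y)%:~R + b) ->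
  lap (region c) f (here c) <= e * (size (doors c))%:Z ->
  average_exit F c <= a * (f (here c) + e)%:~R + b.
Proof.
move=> cg a0 Ff fe; rewrite /exit_mean ler_pdivrMl ?ltr0n ?doors_gt0//.
have sE : \sum_(y <- doors c) (f y)%:~R =
    ((lap (region c) f (here c) + f (here c) * (size (doors c))%:Z)%:~R : R).
  rewrite -raddf_sum/=; congr (_%:~R); rewrite /lap sumrB.
  have -> : \sum_(y <- neighbors (here c) | y \in region c) f y = \sum_(y <- doors c) f y.
    by rewrite /exits big_filter region_full.
  have -> : \sum_(y <- neighbors (here c) | y \in region c) f (here c) =
    \sum_(y <- doors c) f (here c) by rewrite /exits big_filter region_full.
  rewrite [X in _ = _ - X + _]big_const_seq count_predT iter_addr_0 -mulr_natr.
  by rewrite natz subrK.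
apply: (@le_trans _ _ (\sum_(y <- doors c) (a * (f y)%:~R + b))).
  by rewrite !big_seq; exact: ler_sum.
rewrite big_split/= -mulr_sumr sE big_const_seq count_predT iter_addr_0.
rewrite mulrDr -[b *+ _]mulr_natl lerD2r mulrCA ler_wpM2l//.
rewrite -[(size _)%:R]/((size (doors c))%:Z%:~R) -intrM ler_int mulrDr.
by rewrite [_ * f _]mulrC addrC lerD2l mulrC.
Qed.

Lemma exit_mean_le c (F : cfg -> R) (b : R) : comb_good C c ->
  (forall y, y \in doors c -> F (comb_upd C c y) <= b) -> average_exit F c <= b.
Proof.
move=> cg Fb; have := @exit_mean_lap c F (fun=> 0) 0 b 0 cg (lexx _).
by rewrite !mul0r !add0r; apply=> //; rewrite /lap big1.
Qed.

(** The budget for all stages from k on. A stage costs 12 (3/4) ^ k by [esc_base] and (4 C + 1)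
    (3/4) ^ k by [delay_tooth], and summing the geometric series multiplies 12 + 4 C + 1 by 4. *)
Definition slack k : R := (16 * C + 52)%:R * (3 / 4) ^+ k.

(** While the stage waits, g ^ 2 + (patience - t) is a supermartingale for the gap g. It controls g
    itself through g <= (g ^ 2 / 3 ^ k + 3 ^ k) / 2, and the scale 3 ^ k lies between 8 ^ (k / 2)
    and 4 ^ k. *)
Definition delay (L : R) k (g : R) (t : nat) : R :=
  ((g ^+ 2 + ((patience C k)%:R - t%:R)) / 3 ^+ k + 3 ^+ k) / 2 / L.

Definition esc c y : R :=
  (escape (width (stage c)) (tooth (stage c)) (base c) (height c) (dist c) y)%:~R.

Definition gap c m y : int := next_dist c m - next_height c m y.

Definition far c m : R := (next_dist c m)%:~R.

(** A bound for the expected number of stages in which the origin is still to be visited for the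
    first time. The present stage, unless [seen], has three phases: before a tip is reached, waiting
    after that, and heading back to tip m once the waiting time is over, when gap / far bounds the
    probability of meeting the origin first. *)
Definition risk c : R := let k := stage c in slack k.+1 +
  if seen c then 0 else
  if hit c is Some m then
    if (time c < patience C k)%N then delay (far c m) k (gap c m (here c))%:~R (time c)
    else (gap c m (here c))%:~R / far c m
  else esc c (here c) / esc c (0, 0) + delay (tooth k)%:R k 0 0.

Lemma slack_ge0 k : 0 <= slack k.
Proof. by rewrite mulr_ge0// exprn_ge0// divr_ge0. Qed.

Lemma far_ge c m : comb_good C c -> (tooth (stage c))%:R <= far c m.
Proof.
move=> cg; rewrite /far -[_%:R]/(_%:Z%:~R) ler_int /next_dist /len_ext.
by have := phi_range (good_geometry cg) (base_in (good_geometry cg)); lia.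
Qed.

Lemma far_gt0 c m : comb_good C c -> 0 < far c m.
Proof. by move=> cg; apply: lt_le_trans (far_ge m cg); rewrite ltr0n tooth_gt0. Qed.

Lemma gap_ge0 c m y : comb_good C c -> (m <= width (stage c))%N -> y \in region c -> 0 <= gap c m y.
Proof.
move=> cg mw yr; have := phi_range (stage_extend cg mw) yr.
by rewrite /gap; lia.
Qed.

Lemma esc_ge0 c y : comb_good C c -> y \in region c -> 0 <= esc c y.
Proof.
move=> cg; have := good_geometry cg; rewrite /esc ler0z /region /teeth.
by case: (base c) => X Y geo; exact: (escape_ge0 (tooth_gt0 _) geo).
Qed.

Lemma esc_origin c : comb_good C c -> 0 < esc c (0, 0).
Proof.
move=> cg; have geo := good_geometry cg.
have := phi_range geo (base_in geo); move: geo; rewrite /esc ltr0z.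
case: (base c) => X Y geo pr; rewrite (escape_origin _ _ geo).
rewrite spine_value0; apply: mulr_gt0.
  by rewrite ltz_nat tooth_gt0.
have := tooth_gt0 (stage c) => t0.
have : 0 <= (width (stage c)).+1%:Z * (2 + dist c) by apply: mulr_ge0 => //; lia.
by have : 0 <= (width (stage c))%:Z * (width (stage c)).+1%:Z by []; lia.
Qed.

Lemma origin_region c : comb_good C c -> (0, 0) \in region c.
Proof. by move=> cg; rewrite mem_cat (origin_in (good_geometry cg)). Qed.

Lemma delay_ge0 (L : R) k g t : 0 < L -> (t <= patience C k)%N -> 0 <= delay L k g t.
Proof.
move=> L0 tk; rewrite /delay !divr_ge0 ?(ltW L0)// addr_ge0 ?exprn_ge0//.
by rewrite divr_ge0 ?exprn_ge0// addr_ge0 ?sqr_ge0// subr_ge0 ler_nat.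
Qed.

(* AM-GM *)
Lemma delay_ge (L : R) k g t : 0 < L -> (t <= patience C k)%N -> g / L <= delay L k g t.
Proof.
move=> L0 tk; rewrite /delay ler_pM2r ?invr_gt0//.
have s0 : 0 < 3 ^+ k :> R by rewrite exprn_gt0.
have d0 : 0 <= (patience C k)%:R - t%:R :> R by rewrite subr_ge0 ler_nat.
rewrite ler_pdivlMr// -(ler_pM2r s0) [leRHS]mulrDl divfK ?gt_eqF//.
move: s0 d0; move: (3 ^+ k) (_ - _) => s u s0 u0.
by have := sqr_ge0 (g - s); nra.
Qed.

Lemma risk_ge0 c : comb_good C c -> 0 <= risk c.
Proof.
move=> cg; rewrite /risk addr_ge0 ?slack_ge0//; case: ifP => // _.
case E : (hit c) => [m|]; last first.
  rewrite addr_ge0 ?delay_ge0 ?ltr0n ?tooth_gt0// divr_ge0 ?(ltW (esc_origin cg))//.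
  exact/esc_ge0/(good_here cg).
have g0 := gap_ge0 cg (good_hit cg E) (good_here cg).
case: ltnP => tk; first by apply: delay_ge0; [exact: far_gt0|exact: ltnW].
by apply: divr_ge0; [rewrite ler0z|exact/ltW/far_gt0].
Qed.

(** In each of the three phases the term of the present stage is at least 1 at the origin, which
    pays for the visit. *)
Lemma risk_origin c : comb_good C c -> ~~ seen c -> here c = (0, 0) ->
  1 + slack (stage c).+1 <= risk c.
Proof.
move=> cg sc hc; rewrite /risk addrC lerD2l (negbTE sc) hc.
case E : (hit c) => [m|]; last first.
  by rewrite divff ?gt_eqF ?esc_origin// lerDl delay_ge0// ltr0n tooth_gt0.
have gE : (gap c m (0, 0))%:~R / far c m = 1.
  rewrite /gap (phi_origin (stage_extend cg (good_hit cg E))) subr0 divff//.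
  by apply/lt0r_neq0/far_gt0.
case: ltnP => tk; last by rewrite gE.
by rewrite -{1}gE; apply: delay_ge; [exact: far_gt0|exact: ltnW].
Qed.

Lemma width_succ k : (width k).+1 = (2 ^ k)%N.
Proof. by rewrite /width prednK// expn_gt0. Qed.

(** With N = 2 ^ k and l = [dist c] the quotient is (2 N ^ 2 + N) / (2 N ^ 2 + N + N l), and l is at
    least N ^ 2 / 4. *)
Lemma esc_base c j : comb_good C c -> stage c = j.+1 ->
  esc c (base c) / esc c (0, 0) <= 12 * (3 / 4) ^+ (stage c).
Proof.
move=> cg sj; have ld := good_dist cg sj; have e0 := esc_origin cg.
apply: (@le_trans _ _ (12 / 2 ^+ stage c)); last first.
  rewrite ler_pM2l// -exprVn lerXn2r ?nnegrE//; lra.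
rewrite ler_pdivrMr// mulrAC ler_pdivlMr ?exprn_gt0//.
have geo := good_geometry cg; rewrite /esc.
have -> : 2 ^+ stage c = (width (stage c)).+1%:Z%:~R :> R.
  by rewrite width_succ -[RHS]/((2 ^ stage c)%:R) natrX.
rewrite -[12]/(12%:Z%:~R) -!intrM ler_int.
move: geo; case: (base c) => X Y geo.
rewrite (escape_origin _ _ geo) (escape_start _ _ geo) spine_value0.
have tE : (tooth (stage c))%:Z = (width (stage c)).+1%:Z * (width (stage c)).+1%:Z.
  by rewrite width_succ -PoszM /tooth (_ : 4 = 2 * 2)%N// expnMn.
have tj : (tooth (stage c))%:Z = 4 * (tooth j)%:Z by rewrite sj /tooth expnS PoszM.
have -> : (width (stage c))%:Z = (width (stage c)).+1%:Z - 1 by lia.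
rewrite {2 4}tE; move: tj ld; rewrite tE.
have : 0 < (width (stage c)).+1%:Z by [].
have : 0 <= (tooth j)%:Z by [].
move: (_.+1%:Z) (Posz (tooth j)) (dist c) => N t l t0 N0 Nt tl.
have h1 : N * N <= 4 * l by lia.
have h2 : 0 <= N * N * N by rewrite !mulr_ge0// ltW.
rewrite [leLHS](_ : _ = N * N * N * (2 * (N * N) + N)); last ring.
rewrite [leRHS](_ : _ = N * N * N * (24 * N + 12 + 12 * l)); last ring.
by rewrite ler_wpM2l//; lia.
Qed.

(** As 8 < 9, the waiting time divided by 3 ^ k is at most 8 C 3 ^ k; division by the tooth length
    leaves (3/4) ^ k. *)
Lemma delay_tooth k : delay (tooth k)%:R k 0 0 <= (4 * C + 1)%:R * (3 / 4) ^+ k.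
Proof.
rewrite /delay expr0n/= add0r subr0 /patience natrM natrX exprS /tooth natrX.
rewrite expr_div_n.
have h : (8%:R ^+ k / 3 ^+ k <= 3 ^+ k :> R).
  by rewrite ler_pdivrMr ?exprn_gt0// -exprMn lerXn2r ?nnegrE//; lra.
rewrite -[leLHS]mulrA -invfM ler_pdivrMr ?mulr_gt0 ?exprn_gt0//.
rewrite [leRHS](_ : _ = (4 * C + 1)%:R * 3 ^+ k * 2); last by field; rewrite expf_neq0.
rewrite -!mulrA; move: h; rewrite natrD natrM; move: (8%:R ^+ k / _) => z.
have s0 : 0 < 3 ^+ k :> R by rewrite exprn_gt0.
move: (3 ^+ k) s0 => s s0 h; have C0 : 0 <= C%:R :> R by [].
have : C%:R * z <= C%:R * s :> R by rewrite ler_wpM2l.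
by rewrite [_ * (8 * z)]mulrCA; lra.
Qed.

Lemma risk_fresh c j : comb_good C c -> stage c = j.+1 -> ~~ seen c -> hit c = None ->
  here c = base c -> risk c <= slack (stage c).
Proof.
move=> cg sj sc hc he; rewrite /risk (negbTE sc) hc he.
have := esc_base cg sj; have := delay_tooth (stage c).
rewrite /slack [_ ^+ _.+1]exprS natrD natrM natrD natrM.
have : 0 <= (3 / 4) ^+ stage c :> R by rewrite exprn_ge0// divr_ge0.
move: (esc _ _ / _) (delay _ _ _ _) (_ ^+ _) => u v q q0.
have : 0 <= C%:R * q by rewrite mulr_ge0.
by lra.
Qed.

Lemma risk_upd_ends c y : comb_good C c -> y \in doors c -> ends C c y (time c).+1 ->
  risk (comb_upd C c y) <= slack (stage c).+1.
Proof.
move=> cg yd ye; have := comb_upd_good cg yd; rewrite /comb_upd ye => cg'.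
exact: (risk_fresh cg' (j := stage c)).
Qed.

Lemma esc_super c : comb_good C c -> ~~ at_target c (here c) ->
  lap (region c) (escape (width (stage c)) (tooth (stage c)) (base c) (height c) (dist c)) (here c) <= 0.
Proof.
move=> cg; have := good_geometry cg; have := good_here cg; rewrite /at_target /region /teeth.
by case: (base c) => X Y hc geo; exact: (escape_super (tooth_gt0 _) geo).
Qed.

Lemma delayE (L : R) k g t : 0 < L -> delay L k g t =
  (3 ^+ k * 2 * L)^-1 * (g ^+ 2 + ((patience C k)%:R - t%:R)) + 3 ^+ k / 2 / L.
Proof. by move=> L0; rewrite /delay; field; rewrite gt_eqF// expf_neq0. Qed.

(** Heights change by at most 1 along an edge. The cross term has the right sign, because the height
    is subharmonic except at tip m, where the gap vanishes. *)
Lemma lap_gap_sqr c m : comb_good C c -> (m <= width (stage c))%N ->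
  lap (region c) (fun y => gap c m y ^+ 2) (here c) <= (size (doors c))%:Z.
Proof.
move=> cg mw; have geo := stage_extend cg mw; have hr := good_here cg.
have -> : lap (region c) (fun y => gap c m y ^+ 2) (here c) =
    \sum_(y <- neighbors (here c) | y \in region c) (next_height c m y - next_height c m (here c)) ^+ 2 -
    2 * gap c m (here c) * lap (region c) (next_height c m) (here c).
  by rewrite /lap mulr_sumr -sumrB; apply: eq_bigr => y _; rewrite /gap; ring.
have l0 : 0 <= 2 * gap c m (here c) * lap (region c) (next_height c m) (here c).
  have [hc|hc] := eqVneq (here c) (target (tooth (stage c)) m (base c)).
    by rewrite /gap hc (phi_base geo) subrr mulr0 mul0r.
  by rewrite !mulr_ge0// ?(phi_lap geo)// gap_ge0.
suff : \sum_(y <- neighbors (here c) | y \in region c)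
    (next_height c m y - next_height c m (here c)) ^+ 2 <= (size (doors c))%:Z by lia.
have -> : (size (doors c))%:Z = \sum_(y <- neighbors (here c) | y \in region c) 1.
  by rewrite big_const_seq iter_addr_0 natz size_filter region_full.
rewrite big_seq_cond [leRHS]big_seq_cond; apply: ler_sum => y /andP[yn yr].
have /andP[] := phi_step geo hr yr yn; move: (_ - _) => x x1 x2.
by rewrite -subr_ge0 (_ : _ - _ = (1 + x) * (1 - x)) ?mulr_ge0//; [lia|lia|ring].
Qed.

Lemma risk_step c : comb_good C c ->
  average_exit risk c + (~~ seen c && (here c == (0, 0)))%:R <= risk c.
Proof.
(* After a visit to the origin the stage carries no further risk, and only the budget of the later
   stages is left. *)
move=> cg; have [so|] := boolP (seen c || (here c == (0, 0))).
  have : average_exit risk c <= slack (stage c).+1.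
    apply: exit_mean_le => // y yd; have [ye|ye] := boolP (ends C c y (time c).+1).
      exact: risk_upd_ends.
    by rewrite /comb_upd (negbTE ye) /risk /= so addr0.
  case: (boolP (seen c)) so => sc /= so le.
    by rewrite addr0 /risk sc addr0.
  by rewrite so /=; have := risk_origin cg sc (eqP so); lra.
rewrite negb_or => /andP[sc ho]; rewrite (negbTE ho) andbF addr0.
case E : (hit c) => [m|]; last first.
  have rE : risk c = (esc c (0, 0))^-1 * (esc c (here c) + 0%:~R) +
      (slack (stage c).+1 + delay (tooth (stage c))%:R (stage c) 0 0).
    by rewrite /risk (negbTE sc) E addr0 addrCA [_^-1 * _]mulrC.
  rewrite rE -rmorphD; apply: exit_mean_lap => //.
  - by rewrite invr_ge0 ltW// esc_origin.
  - move=> y yd; have yr : y \in region c by move: yd; rewrite mem_exits => /andP[].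
    have d0 t g : (t <= patience C (stage c))%N -> 0 <= delay (tooth (stage c))%:R (stage c) g t.
      by apply: delay_ge0; rewrite ltr0n tooth_gt0.
    have e0 : 0 <= (esc c (0, 0))^-1 * esc c y.
      by rewrite mulr_ge0 ?invr_ge0 ?(ltW (esc_origin cg))// esc_ge0.
    have [ye|ye] := boolP (ends C c y (time c).+1).
      apply: le_trans (risk_upd_ends cg yd ye) _.
      by rewrite addrCA lerDl addr_ge0 ?d0.
    rewrite /comb_upd (negbTE ye) /risk /= (negbTE sc) (negbTE ho) E /=.
    case: ifPn => at_y; last by rewrite [leRHS]addrCA [_^-1 * _]mulrC.
    have [mw yE] := at_targetP cg yr at_y.
    have tk : ((time c).+1 < patience C (stage c))%N.
      by move: ye; rewrite /ends at_y/= -ltnNge.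
    rewrite tk /gap /next_dist /next_height /=.
    (* On arrival at a tip the gap is 0. The reserve held during the first phase covers the waiting,
       since [far] is at least the tooth length. *)
    have := phi_base (stage_extend cg mw); rewrite -yE /next_height => ->.
    rewrite subrr; apply: (@le_trans _ _ (slack (stage c).+1 + delay (tooth (stage c))%:R (stage c) 0 0)); last first.
      by rewrite lerDr; exact: e0.
    rewrite lerD2l /delay; apply: ler_pM.
    + by rewrite divr_ge0// addr_ge0 ?exprn_ge0// divr_ge0 ?exprn_ge0// addr_ge0 ?sqr_ge0// subr_ge0 ler_nat ltnW.
    + by rewrite invr_ge0 ltW//; exact: (far_gt0 _ cg).
    + rewrite ler_pM2r// lerD2r ler_pM2r ?invr_gt0 ?exprn_gt0//.
      by rewrite lerD2l lerD2l lerN2.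
    + by rewrite lef_pV2 ?posrE ?ltr0n ?tooth_gt0//; [exact: far_ge|exact: (far_gt0 _ cg)].
  - by rewrite mul0r esc_super// (good_unhit cg).
have mw := good_hit cg E; have L0 := far_gt0 m cg.
have geo := stage_extend cg mw.
have rE : ~~ (time c < patience C (stage c))%N ->
    risk c = slack (stage c).+1 + (gap c m (here c))%:~R / far c m.
  by move=> tk; rewrite /risk (negbTE sc) E (negbTE tk).
have sE y : ~~ ends C c y (time c).+1 -> risk (comb_upd C c y) = slack (stage c).+1 +
    if ((time c).+1 < patience C (stage c))%N
    then delay (far c m) (stage c) (gap c m y)%:~R (time c).+1 else (gap c m y)%:~R / far c m.
  by move=> /negbTE ye; rewrite /comb_upd ye /risk /= (negbTE sc) (negbTE ho) E.
have [tk|tk] := ltnP (time c) (patience C (stage c)).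
  rewrite [leRHS]/risk (negbTE sc) E tk delayE//.
  have sqE1 (g : int) : ((g ^+ 2 + 1)%:~R : R) = g%:~R ^+ 2 + 1 by rewrite intrD rmorphXn.
  have sqE (g : int) : ((g ^+ 2)%:~R : R) = g%:~R ^+ 2 by rewrite rmorphXn.
  set a := (_ * _ * _)^-1; set z := _ / _ / _.
  have a0 : 0 <= a by rewrite invr_ge0 !mulr_ge0 ?exprn_ge0// ltW.
  have z0 : 0 <= z by rewrite !divr_ge0 ?exprn_ge0// ltW.
  rewrite [leRHS](_ : _ = a * (gap c m (here c) ^+ 2 + 1)%:~R +
      (a * ((patience C (stage c))%:R - (time c).+1%:R) + z + slack (stage c).+1)); last first.
    by rewrite sqE1 -natr1; ring.
  have p0 : 0 <= (patience C (stage c))%:R - (time c).+1%:R :> R by rewrite subr_ge0 ler_nat.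
  apply: (exit_mean_lap (f := fun y => gap c m y ^+ 2)) => //.
    move=> y yd; have [ye|ye] := boolP (ends C c y (time c).+1).
      apply: le_trans (risk_upd_ends cg yd ye) _.
      rewrite addrA lerDr; apply: addr_ge0; last by apply: addr_ge0 => //; exact: mulr_ge0.
      by apply: mulr_ge0 => //; rewrite ler0z sqr_ge0.
    (* If the waiting time runs out with this step, [delay_ge] leads over to gap / far. *)
    rewrite sE//; apply: (@le_trans _ _ (slack (stage c).+1 +
      delay (far c m) (stage c) (gap c m y)%:~R (time c).+1)).
      by rewrite lerD2l; case: ifP => // _; exact: delay_ge.
    rewrite delayE// -/a -/z sqE [leLHS]addrC.
    by rewrite mulrDr !addrA.
  by rewrite mul1r lap_gap_sqr.
rewrite rE -?leqNgt// addrC [_ / _]mulrC -[gap c m (here c)]addr0.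
apply: exit_mean_lap => //; first by rewrite invr_ge0 ltW.
  move=> y yd; have [ye|ye] := boolP (ends C c y (time c).+1).
    apply: le_trans (risk_upd_ends cg yd ye) _.
    rewrite lerDr mulr_ge0 ?invr_ge0 ?(ltW L0)// ler0z gap_ge0//.
    by move: yd; rewrite mem_exits => /andP[].
  by rewrite sE// ltnNge (leq_trans tk)//= [_ / _]mulrC addrC.
rewrite mul0r; have -> : lap (region c) (gap c m) (here c) =
    - lap (region c) (next_height c m) (here c).
  by rewrite /lap -sumrN; apply: eq_bigr => y _; rewrite /gap; ring.
(* After the waiting time the stage would have ended at a tip, so the walk is not at tip m and the
   height is subharmonic at its position. *)
rewrite oppr_le0; apply: (phi_lap geo); first exact: (good_here cg).
have := good_running cg; rewrite /ends tk andbT; apply: contra => /eqP ->.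
exact: target_at.
Qed.

End Risk.

(** * Every stage ends, and the combs are sparse in time *)

Section Transience.
Context (R : realType).
Variable C : nat.
Implicit Types (c : cfg) (y : int * int) (k : nat).

Local Notation doors := (exits comb_plan comb_dom here).
Local Notation average_exit := (exit_mean (comb_upd C) comb_plan comb_dom here).

Definition waiting k c : bool := (stage c < k)%N || ((stage c == k) && (time c < patience C k)%N).

(** Let r be the rank towards tip 0 and N a bound for it. After the waiting time, 8 ^ (N - r) grows
    at least eightfold through one of at most four exits, so it at least doubles on average and the
    potential falls by at least 1. *)
Definition stage_potential k c : R :=
  if waiting k c then 8 ^+ max_rank k.+1 else
  if stage c == k then 8 ^+ max_rank k.+1 - 8 ^+ (max_rank k.+1 - next_rank c 0 (here c)) else 0.

Lemma stage_potential_le k c : stage_potential k c <= 8 ^+ max_rank k.+1.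
Proof.
rewrite /stage_potential; case: ifP => // _; case: ifP => _; last by rewrite exprn_ge0.
by rewrite gerBl exprn_ge0.
Qed.

Lemma stage_potential_ge0 k c : 0 <= stage_potential k c.
Proof.
rewrite /stage_potential; case: ifP => _; first by rewrite exprn_ge0.
case: ifP => // _; rewrite subr_ge0 ler_weXn2l ?leq_subr//.
by rewrite -[1]/(1%:R) ler_nat.
Qed.

Lemma size_doors c : (size (doors c) <= 4)%N.
Proof. by rewrite /exits size_filter count_size. Qed.

Lemma comb_upd_cases c y : comb_upd C c y = next_stage c y \/ comb_upd C c y = same_stage c y.
Proof. by rewrite /comb_upd; case: ifP; [left|right]. Qed.

Lemma stage_step k c : comb_good C c ->
  average_exit (stage_potential k) c + (`[< stage c = k /\ (patience C k <= time c)%N >])%:R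
    <= stage_potential k c.
Proof.
move=> cg; case: asboolP => [[sk tk]|nB].
  have cw : waiting k c = false by rewrite /waiting sk ltnn eqxx/= ltnNge tk.
  rewrite {2}/stage_potential cw sk eqxx.
  set N := max_rank k.+1; set r := next_rank c 0.
  have hn : here c != target (tooth (stage c)) 0 (base c).
    by have := good_running cg; apply: contra => /eqP hE; rewrite /ends hE target_at sk tk.
  have geo := stage_extend cg (leq0n _); rewrite sk -/N -/r in geo.
  have rN y : y \in region c -> (r y <= N)%N by move=> yr; apply: (rank_le geo).
  rewrite sk in hn; have [y0 [y0r y0n r0]] := rank_step geo (good_here cg) hn.
  have y0d : y0 \in doors c by rewrite mem_exits y0n.
  have Vy y : y \in doors c -> stage_potential k (comb_upd C c y) <= 8 ^+ N - 8 ^+ (N - r y).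
    have p8 : 8 ^+ (N - r y) <= 8 ^+ N :> R.
      by rewrite ler_weXn2l ?leq_subr// -[1]/(1%:R) ler_nat.
    case: (comb_upd_cases c y) => -> _; rewrite /stage_potential /waiting /= sk.
      by rewrite ltnNge leqnSn/= gtn_eqF//= subr_ge0.
    by rewrite ltnn eqxx/= ltnNge (leq_trans tk).
  have d0 := doors_gt0 cg; have d4 := size_doors c.
  have e0 : 8 * 8 ^+ (N - r (here c)) <= 8 ^+ (N - r y0) :> R.
    rewrite -exprS ler_weXn2l ?ltn_sub2l//; first by rewrite -[1]/(1%:R) ler_nat.
    exact: leq_trans r0 (rN _ (good_here cg)).
  have e1 : 1 <= 8 ^+ (N - r (here c)) :> R.
    by rewrite exprn_ege1// -[1]/(1%:R) ler_nat.
  have dR : (size (doors c))%:R <= 4 :> R by rewrite -[4]/(4%:R) ler_nat.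
  suff : average_exit (stage_potential k) c <= 8 ^+ N - 2 * 8 ^+ (N - r (here c)) by rewrite /=; lra.
  rewrite /exit_mean ler_pdivrMl ?ltr0n//.
  apply: (@le_trans _ _ (\sum_(y <- doors c) (8 ^+ N - 8 ^+ (N - r y)))).
    by rewrite !big_seq; exact: ler_sum.
  rewrite sumrB big_const_seq count_predT iter_addr_0 mulrBr -[_ ^+ _ *+ _]mulr_natl lerD2l lerN2.
  rewrite (big_rem y0)//=.
  have : 0 <= \sum_(y <- rem y0 (doors c)) 8 ^+ (N - r y) :> R by apply: sumr_ge0 => y _; exact: exprn_ge0.
  by move: (\sum_(y <- _) _) => z z0; nra.
rewrite addr0; have [cw|cw] := boolP (waiting k c).
  rewrite {2}/stage_potential cw; apply: (exit_mean_le cg) => y _.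
  exact: stage_potential_le.
have kc : (k < stage c)%N.
  move: cw; rewrite /waiting negb_or -leqNgt negb_and -leqNgt => /andP[].
  by rewrite leq_eqVlt => /orP[/eqP ck|//]; rewrite -ck eqxx/= => tk; case: nB.
apply: (@le_trans _ _ 0); last exact: stage_potential_ge0.
apply: (exit_mean_le cg) => y _; case: (comb_upd_cases c y) => ->; rewrite /stage_potential /waiting /=.
  by rewrite ltnNge (ltnW (leqW kc))/= gtn_eqF// leqW.
by rewrite ltnNge (ltnW kc)/= gtn_eqF.
Qed.

Section Path.
Variable c : nat -> cfg.
Hypothesis c0 : c 0%N = comb_start.
Hypothesis cS : forall t, exists2 y, y \in doors (c t) & c t.+1 = comb_upd C (c t) y.

Lemma path_cases t : exists y, c t.+1 = next_stage (c t) y \/ c t.+1 = same_stage (c t) y.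
Proof. by have [y _ ->] := cS t; exists y; exact: comb_upd_cases. Qed.

Lemma path_good t : comb_good C (c t).
Proof.
elim: t => [|t IH]; first by rewrite c0; exact: comb_start_good.
by have [y yd ->] := cS t; exact: comb_upd_good.
Qed.

Lemma path_time t : time (c t) = t.
Proof.
elim: t => [|t IH]; first by rewrite c0.
by have [y [] ->] := path_cases t; rewrite /= IH.
Qed.

Lemma path_stage_le s t : (s <= t)%N -> (stage (c s) <= stage (c t))%N.
Proof.
move=> /subnK <-; elim: (t - s)%N => [//|u IH]; rewrite addSn.
by apply: (leq_trans IH); have [y [] ->] := path_cases (u + s); rewrite /= ?leqnSn.
Qed.

Lemma path_stage_unbounded :
  (forall k, exists N, forall t, (N <= t)%N ->
     ~ (stage (c t) = k /\ (patience C k <= time (c t))%N)) ->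
  forall k, exists t, (k < stage (c t))%N.
Proof.
move=> fin; have leave k : exists N, forall t, (N <= t)%N -> stage (c t) != k.
  have [N cN] := fin k; exists (maxn N (patience C k)) => t; rewrite geq_max => /andP[Nt kt].
  by apply/eqP => tk; apply: (cN t Nt); rewrite path_time.
have up k : exists t, (k <= stage (c t))%N.
  elim: k => [|k [t kt]]; first by exists 0%N.
  have [N cN] := leave k; exists (maxn N t).
  rewrite ltn_neqAle eq_sym cN ?leq_maxl//=.
  exact: leq_trans kt (path_stage_le (leq_maxr _ _)).
by move=> k; have [t kt] := up k.+1; exists t.
Qed.

(** A change of stage after time N lowers the flag [seen], and the flag stays down because the
    origin is no longer visited with the flag down. *)
Lemma path_transient N :
  (forall k, exists t, (k < stage (c t))%N) ->
  (forall t, (N <= t)%N -> ~ (~~ seen (c t) && (here (c t) == (0, 0)))) ->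
  exists M, forall t, (M <= t)%N -> here (c t) != (0, 0).
Proof.
move=> up cN; have [t Nt st] : exists2 t, (N <= t)%N & stage (c t.+1) != stage (c t).
  apply: contrapT => nst; have [t] := up (stage (c N)).
  suff sN u : stage (c (u + N)%N) = stage (c N).
    by rewrite ltnNge -(sN (t - N)%N) path_stage_le//; lia.
  elim: u => [//|u <-]; apply/eqP; apply: contrapT => /negP su; apply: nst.
  by exists (u + N)%N; rewrite ?leq_addl// -addSn.
have unseen u : seen (c (u + t.+1)%N) = false.
  elim: u => [|u IH]; first by have [y [] E] := path_cases t; move: st; rewrite E //= eqxx.
  rewrite addSn; have [y [] ->] := path_cases (u + t.+1)%N; rewrite //= IH /=.
  have /cN : (N <= u + t.+1)%N by rewrite (leq_trans (leqW Nt))// leq_addl.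
  by rewrite IH /= => /negP/negbTE.
exists t.+1 => u tu; have /cN : (N <= u)%N by rewrite (leq_trans (leqW Nt)).
by rewrite -(subnK tu) unseen/= => /negP.
Qed.

(** The number of sites in the combs of stages 1 to k. The comb of stage 0 is probed at time 0,
    which the running average leaves out. *)
Fixpoint volume k : nat := if k is j.+1 then
  (volume j + (2 * width k + 2 + (width k).+1 * tooth k))%N else 0%N.

Lemma volume_le k : (volume k <= 4 * 8 ^ k)%N.
Proof.
elim: k => [//|k IH]; rewrite /=.
have wk : (width k.+1).+1 = (2 * 2 ^ k)%N by rewrite width_succ expnS.
have h : (1 <= 2 ^ k)%N by rewrite expn_gt0.
have h4 : (1 <= 4 ^ k)%N by rewrite expn_gt0.
have e : (2 ^ k * 4 ^ k = 8 ^ k)%N by rewrite -expnMn.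
have h2 : (2 ^ k <= 8 ^ k)%N by rewrite -e leq_pmulr.
have w1 : (2 * width k.+1 + 2 = 4 * 2 ^ k)%N by lia.
rewrite w1 wk /tooth !expnS mulnACA e; lia.
Qed.

Lemma path_volume t :
  (\sum_(1 <= s < t.+1) size (comb_plan (c s)) <= volume (stage (c t)))%N.
Proof.
elim: t => [|t IH]; first by rewrite big_geq.
rewrite big_nat_recr//=; have [y [] ->] := path_cases t; last by rewrite addn0.
rewrite -[comb_plan _]/(teeth (next_stage (c t) y)) size_comb ?tooth_gt0//.
exact: leq_add.
Qed.

(** Stage j + 1 begins no earlier than time C 8 ^ (j + 1), and the combs of the stages 1 to j + 1
    have at most 4 * 8 ^ (j + 1) sites together. *)
Lemma path_mean t : (C * (\sum_(1 <= s < t.+1) size (comb_plan (c s))) <= 4 * t)%N.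
Proof.
have vt := path_volume t; apply: (leq_trans (leq_mul (leqnn C) vt)).
have gt := @good_time _ _ (path_good t); rewrite path_time in gt.
case: (stage (c t)) gt => [|j] gt; first by rewrite muln0.
have := gt _ erefl; rewrite /patience => tj.
apply: (leq_trans (leq_mul (leqnn C) (volume_le _))).
by rewrite mulnCA leq_mul2l tj orbT.
Qed.

End Path.
End Transience.

Lemma comb_psrw (R : realType) (d' : nat) (eps : R) : 0 < eps ->
  exists (disp : measure_display) (T : measurableType disp)
    (P : probability T R) (K : nat -> T -> site d'.+2) (Q : nat -> T -> seq (site d'.+2)),
  [/\ is_psrw P K Q, probes_chosen_at_distance_one K Q,
      forall w t, (0 < t)%N -> mean_probes R Q w t < eps
    & {ae P, forall w, transient K w}].
Proof.
move=> eps0; pose C := (Num.truncn (4 / eps)).+1.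
have C4 : 4 < C%:R * eps by rewrite -ltr_pdivrMr// /C truncnS_gt.
have aut := comb_automaton C.
have [disp [T [P [X [PX XP]]]]] := plan_chain R d' aut.
pose ask := @plan_ask d' cfg comb_start (comb_upd C) comb_plan.
pose c w t := configs comb_start (comb_upd C) comb_plan X t w.
have c0 w : c w 0%N = comb_start by exact: configs0.
have cS w t : exists2 y, y \in exits comb_plan comb_dom here (c w t) & c w t.+1 = comb_upd C (c w t) y.
  exact: (configsS aut XP).
exists disp, T, P, (walk ask X), (probes ask X); split.
- exact: psrw_of_chain PX XP.
- exact: (plan_at_distance_one aut XP).
- move=> w t t0; have := path_mean (c0 w) (cS w) t.
  rewrite /mean_probes ltr_pdivrMl ?ltr0n// -natr_sum.
  under [X in _ -> X%:R < _]eq_bigr do rewrite (size_probes_plan aut XP).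
  rewrite -/(c w _); move: (\sum_(_ <= s < _) _)%N => z; rewrite -(ler_nat R) !natrM => zt.
  have t1 : 0 < t%:R :> R by rewrite ltr0n.
  have C0 : 0 < C%:R :> R by rewrite ltr0n.
  by rewrite -(ltr_pM2l C0); nra.
have never B : {ae P, forall w, exists N, forall n, (N <= n)%N ->
    ~ (~~ ask (X n w) /\ B (config comb_start (comb_upd C) (X n w)))} ->
    {ae P, forall w, exists N, forall t, (N <= t)%N -> ~ B (c w t)}.
  by apply: filterS => w; exact: configs_finite.
have home : {ae P, forall w, exists N, forall t, (N <= t)%N ->
    ~ (~~ seen (c w t) && (here (c w t) == (0, 0)))}.
  apply: (never (fun b => ~~ seen b && (here b == (0, 0)))).
  apply: (plan_lyapunov aut PX (V := risk R C) (B := fun b => ~~ seen b && (here b == (0, 0)))) => b bg.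
    exact: risk_ge0.
  by rewrite asboolb; exact: risk_step.
have stages : {ae P, forall w, forall k, exists N, forall t, (N <= t)%N ->
    ~ (stage (c w t) = k /\ (patience C k <= time (c w t))%N)}.
  apply: ae_foralln => k; apply: (never (fun b => stage b = k /\ (patience C k <= time b)%N)).
  apply: (plan_lyapunov aut PX (V := stage_potential R C k)
    (B := fun b => stage b = k /\ (patience C k <= time b)%N)) => b bg.
    exact: stage_potential_ge0.
  exact: stage_step.
apply: filterS2 home stages => w [N hN] sN rec.
have [M cM] := path_transient (cS w) (path_stage_unbounded (c0 w) (cS w) sN) hN.
have [t Mt] := rec M; rewrite (walk_plan aut XP) -/(c w t) -(emb0 d') => /emb_inj h0.
by have := cM _ Mt; rewrite h0 eqxx.
Qed.

Theorem proposition1p19 (R : realType) :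
  (* (a) *)
  (forall (d : nat) (eps : R), (2 <= d)%N -> 0 < eps ->
     (exists (disp : measure_display) (T : measurableType disp)
        (P : probability T R) (K : nat -> T -> site d)
        (Q : nat -> T -> seq (site d)),
        [/\ is_psrw P K Q,
            probes_chosen_at_distance_one K Q,
            {ae P, forall w, \forall t \near \oo, mean_probes R Q w t < eps}
          & {ae P, forall w, transient K w}]) /\
     (exists (disp : measure_display) (T : measurableType disp)
        (P : probability T R) (K : nat -> T -> site d)
        (Q : nat -> T -> seq (site d)),
        [/\ is_psrw P K Q,
            probes_chosen_at_distance_one K Q,
            {ae P, forall w, \forall t \near \oo, eps^-1 < mean_probes R Q w t}
          & {ae P, forall w, recurrent K w}])) /\
  (* (b), d >= 3 *)
  (forall d : nat, (3 <= d)%N ->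
     exists (c : R) (disp : measure_display) (T : measurableType disp)
       (P : probability T R) (K : nat -> T -> site d)
       (Q : nat -> T -> seq (site d)),
       [/\ is_psrw P K Q,
           probes_by_hitting_measure P K Q,
           {ae P, forall w,
              (limn_esup (fun t => (mean_probes R Q w t)%:E) < c%:E)%E}
         & {ae P, forall w, transient K w}]) /\
  (* (b), d = 2 *)
  (forall M : R,
     exists (c : R) (disp : measure_display) (T : measurableType disp)
       (P : probability T R) (K : nat -> T -> site 2)
       (Q : nat -> T -> seq (site 2)),
       [/\ is_psrw P K Q,
           probes_by_hitting_measure P K Q,
           {ae P, forall w,
              (M%:E <= limn_einf (fun t => (mean_probes R Q w t)%:E))%E},
           {ae P, forall w,
              (limn_esup (fun t => (mean_probes R Q w t)%:E) < c%:E)%E}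
         & {ae P, forall w, recurrent K w}]).
Proof.
split; [|split].
- case=> [|[|d']] // eps _ eps0; split.
    have [disp [T [P [K [Q [KQ Q1 Qm Kt]]]]]] := comb_psrw d' eps0.
    exists disp, T, P, K, Q; split=> //.
    by apply: aeW => w; exists 1%N => // t t0; exact: Qm.
  pose M := (Num.truncn eps^-1).+1.
  have [disp [T [P [K [Q [KQ Q1 QM Kr]]]]]] := half_line_psrw R d' (ltn0Sn (Num.truncn eps^-1)).
  exists disp, T, P, K, Q; split=> //.
  apply: aeW => w; exists 1%N => // t t0; apply: lt_le_trans (truncnS_gt _) _.
  rewrite /mean_probes (eq_bigr (fun=> M%:R)); last by move=> s _; rewrite QM.
  rewrite sumr_const_nat subSS subn0 -(mulr_natl M%:R t) mulKf//.
  by rewrite pnatr_eq0 -lt0n.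
(* With M = 0 the probes serve only to open the missing neighbours. *)
- case=> [|[|[|d']]] // _; have [c Qc] := greedy_limsup R 0 (ltn0Sn d'.+2).
  have [disp [T [P [X [PX XP]]]]] := greedy_chain R 0 (ltn0Sn d'.+2).
  exists c, disp, T, P, (walk (@greedy_ask _ 0) X), (probes (@greedy_ask _ 0) X); split.
  + exact: (greedy_psrw PX XP).
  + exact: (greedy_hitting (ltn0Sn _) PX XP).
  + exact: Qc.
  + exact: (greedy_transient PX XP).
- move=> M; pose m := (Num.truncn M).+1; have [c Qc] := greedy_limsup R m (ltn0Sn 1).
  have [disp [T [P [X [PX XP]]]]] := greedy_chain R m (ltn0Sn 1).
  exists c, disp, T, P, (walk (@greedy_ask _ m) X), (probes (@greedy_ask _ m) X); split.
  + exact: (greedy_psrw PX XP).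
  + exact: (greedy_hitting (ltn0Sn _) PX XP).
  + apply: aeW => w; apply: limn_einf_ge; exists 1%N => t t0.
    apply: le_trans (greedy_mean_ge XP w t0); exact/ltW/truncnS_gt.
  + exact: Qc.
  + exact: (greedy_recurrent PX XP).
Qed.
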